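(* Let $n\ge 2$, $m\ge1$, let $g_{ij}(x^k)$ be a (pseudo-)Riemannian metric in $n$ independent variables and $H_{AB}(u^C)$ a (pseudo-)Riemannian metric in $m$ dependent variables, and consider the Lagrangian $$L(x^k,u^C,u^C_{,k})=\tfrac12\sqrt g\,g^{ij}H_{AB}u^A_{,i}u^B_{,j}-\sqrt g\,V(x^k,u^C).$$ The Noether point symmetries of $L$ are generated by the conformal Killing vectors (CKVs) $\xi^i$ of $g_{ij}$ with conformal factor $\psi(x^k)$ and the Killing vectors (KVs) of $H_{AB}$ as follows. Throughout, $K^A=K_G^A+K_{NG}^A$, where $K_G$ (without index) denotes the potential of $K_G^A$. (a) If $n>2$ and $H_{AB}$ admits a proper gradient homothetic vector (HV) $Y^A$ with homothetic factor $\bar\psi_Y=1$ and potential $Y$, the generic Noether point symmetry is $$X=\xi^i(x^k)\partial_i+\left[\frac{2-n}{2}\psi(x^k)Y^A(u^C)+K_G^A(x^k,u^C)+K_{NG}^A(u^C)\right]\partial_A ,$$ where $K_G^A$ is a gradient KV/HV of $H_{AB}$, $K_{NG}^A$ is a non-gradient KV/HV of $H_{AB}$, and the following condition holds: $$\mathcal L_\xi V+n\psi V+\frac{2-n}{2}\left(\psi V_{,A}Y^A+Y\Delta_g\psi\right)+\left(\Delta_gK_G+V_{,A}K^A\right)+\Phi^k_{;k}=0 .$$ The corresponding gauge vector field is $$A^i=\sqrt g\left(\frac{2-n}{2}g^{ij}\psi_{,j}Y+g^{ij}K_{G,j}+\Phi^i(x^k)\right),$$ and the generic Noether conservation current is $$I^i=\xi^k\mathcal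 H^i_k-\left(\frac{2-n}{2}\psi Y^A+K_G^A+K_{NG}^A\right)\sqrt g\,g^{ij}H_{AB}u^B_{,j}+\sqrt g\left(\frac{2-n}{2}g^{ij}\psi_{,j}Y+g^{ij}K_{G,j}+\Phi^i\right).$$ (b) If $n>2$ and $H_{AB}$ does not admit a proper gradient HV, the generic Noether point symmetry is $$X=\xi^i(x^k)\partial_i+\left(K_G^A(x^k,u^C)+K_{NG}^A(u^C)\right)\partial_A ,$$ where $\xi^i$ is a KV of $g_{ij}$ (i.e. $\psi=0$), $K_G^A$ is a gradient KV of $H_{AB}$, $K_{NG}^A$ is a non-gradient KV of $H_{AB}$, and the following condition holds: $$\mathcal L_\xi V+\left(\Delta_gK_G+V_{,A}K^A\right)+\Phi^k_{;k}=0 .$$ The corresponding gauge vector field is $A^i=\sqrt g\left(g^{ij}K_{G,j}+\Phi^i(x^k)\right)$ and the generic Noether conservation current is $$I^i=\xi^k\mathcal H^i_k-\left(K_G^A+K_{NG}^A\right)\sqrt g\,g^{ij}H_{AB}u^B_{,j}+\sqrt g\left(g^{ij}K_{G,j}+\Phi^i\right).$$ (c) If $n=2$, the generic Noether point symmetry is $$X=\xi^i(x^k)\partial_i+\left(K_G^A(x^k,u^C)+K_{NG}^A(u^C)\right)\partial_A ,$$ where $K_G^A$ is a gradient KV/HV of $H_{AB}$, $K_{NG}^A$ is a non-gradient KV/HV of $H_{AB}$, and the following condition holds: $$\mathcal L_\xi V+2\psi V+\left(\Delta_gK_G+V_{,A}K^A\right)+\Phi^k_{;k}=0 .$$ The corresponding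 gauge vector field is $A^i=\sqrt g\left(g^{ij}K_{G,j}+\Phi^i(x^k)\right)$ and the generic Noether conservation current is $$I^i=\xi^k\mathcal H^i_k-\left(K_G^A+K_{NG}^A\right)\sqrt g\,g^{ij}H_{AB}u^B_{,j}+\sqrt g\left(g^{ij}K_{G,j}+\Phi^i\right).$$ In all cases $\mathcal H^i_k$ is the Hamiltonian of $L$, that is, $$\mathcal H^i_k=\tfrac12\sqrt g\,H_{AB}\left(2g^{ij}u^{(A}_{,k}u^{B)}_{,j}-\delta^i_kg^{rs}u^A_{,r}u^B_{,s}\right)+\delta^i_k\sqrt g\,V .$$
   Context: Indices $i,j,k,r,s$ run over $1,\dots,n$ and $A,B,C$ over $1,\dots,m$; commas denote partial derivatives, $u^A_{,i}=\partial u^A/\partial x^i$; $\partial_i=\partial/\partial x^i$, $\partial_A=\partial/\partial u^A$; parentheses around indices denote symmetrization with factor $\frac12$. $\sqrt g$ is the square root of the absolute value of the determinant of $g_{ij}$. '';'' and ''$|$'' denote the covariant derivatives of $g_{ij}$ and $H_{AB}$. $\Phi^i(x^k)$ is a vector field in the space of the independent variables. A vector field $X=\xi^i(x^k,u^B)\partial_i+\eta^A(x^k,u^B)\partial_A$ that is a Lie point symmetry of the Euler–Lagrange equations of $L$ is a Noether point symmetry of $L$ if there is a gauge vector field $A^i(x^k,u^C)$ with $X^{[1]}L+L\,D_i\xi^i=D_iA^i$, where $X^{[1]}$ is the first prolongation of $X$ and $D_i$ the total derivative with respect to $x^i$. The corresponding Noether current $I^i=\xi^k\left(u^A_{,k}\frac{\partial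 L}{\partial u^A_{,i}}-\delta^i_kL\right)-\eta^A\frac{\partial L}{\partial u^A_{,i}}+A^i$ satisfies $D_iI^i=0$ on solutions of the Euler–Lagrange equations. ''Generic'' refers to the general form of the symmetry vector or current. $\xi$ is a CKV of $g_{ij}$ with conformal factor $\psi$ if $\mathcal L_\xi g_{ij}=2\psi g_{ij}$; it is an HV if $\psi$ is constant and a KV if $\psi=0$. KVs and HVs of $H_{AB}$ are defined in the same way, in the variables $u$ for each fixed $x$; ''KV/HV'' means Killing or homothetic vector. Such a vector $K_G^A$ is gradient if $K_G^A=H^{AB}K_{G,B}$ for a function (potential) $K_G(x^k,u^C)$. A proper gradient HV with homothetic factor $1$ satisfies $Y_{A|B}=H_{AB}$ with $Y_A=Y_{,A}$ for a function $Y(u^C)$ (the potential). $\mathcal L_\xi V=\xi^kV_{,k}$; $\Delta_gf=g^{ij}f_{;ij}$ is the Laplacian of $g_{ij}$ acting on the $x$-dependence.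
   Formalization: In (a) and (c) K^A = K_G^A + K_NG^A is required to be a KV; K_NG^A may be zero; in (b) a generic symmetry may also have ξ a proper HV of g (constant ψ ≠ 0) with K_NG^A a non-gradient HV of H of factor (2-n)ψ/2 and the extra term nψV in the condition, since (b) as printed fails then. *)

(* Defs.v *)
From HB Require Import structures.
From mathcomp Require Import all_boot all_order all_algebra.
From mathcomp Require Import all_classical all_reals all_analysis.
Import Order.TTheory GRing.Theory Num.Theory.
Import numFieldNormedType.Exports.

Set Implicit Arguments.
Unset Strict Implicit.
Unset Printing Implicit Defensive.

Local Open Scope classical_set_scope.
Local Open Scope ring_scope.

(* All fields are total functions; only their values on open coordinate
   domains U (variables x) and W (variables u) are ever constrained.  Vectors
   are row vectors, so [v 0 k] is the component v^k.                          *)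

Section Calculus.
Context {R : realType}.

(* Partial derivative with respect to the (i, j) entry; row vectors are the
   case i = 0.                                                               *)
Definition mpartial {a b : nat} (i : 'I_a) (j : 'I_b) (f : 'M[R]_(a, b) -> R)
    (z : 'M[R]_(a, b)) : R :=
  'D_(delta_mx i j) f z.

Definition partial {a : nat} (i : 'I_a) (f : 'rV[R]_a -> R) (x : 'rV[R]_a) : R :=
  mpartial 0 i f x.

Fixpoint Ck {a : nat} (k : nat) (U : set 'rV[R]_a) (f : 'rV[R]_a -> R) : Prop :=
  (forall x, U x -> {for x, continuous f}) /\
  if k is k'.+1 then
    forall i, (forall x, U x -> derivable f x (delta_mx 0 i)) /\
              Ck k' U (partial i f)
  else True.

Definition smooth {a : nat} (U : set 'rV[R]_a) (f : 'rV[R]_a -> R) : Prop :=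
  forall k, Ck k U f.

(* Joint smoothness on U x W, the pair (x, u) being the concatenated vector. *)
Definition smooth2 {a b : nat} (U : set 'rV[R]_a) (W : set 'rV[R]_b)
    (f : 'rV[R]_a -> 'rV[R]_b -> R) : Prop :=
  smooth [set z : 'rV[R]_(a + b) | U (lsubmx z) /\ W (rsubmx z)]
         (fun z : 'rV[R]_(a + b) => f (lsubmx z) (rsubmx z)).

Definition vsmooth {a c : nat} (U : set 'rV[R]_a) (v : 'rV[R]_a -> 'rV[R]_c)
  : Prop := forall k, smooth U (fun x => v x 0 k).

Definition vsmooth2 {a b c : nat} (U : set 'rV[R]_a) (W : set 'rV[R]_b)
    (v : 'rV[R]_a -> 'rV[R]_b -> 'rV[R]_c) : Prop :=
  forall k, smooth2 U W (fun x u => v x u 0 k).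

End Calculus.

Section Geometry.
Context {R : realType} {a : nat}.
Implicit Types (U : set 'rV[R]_a) (g : 'rV[R]_a -> 'M[R]_a).
Implicit Types (v : 'rV[R]_a -> 'rV[R]_a) (f : 'rV[R]_a -> R).

(* Metrics of arbitrary signature. *)
Definition metric U g : Prop :=
  [/\ forall i j, smooth U (fun x => g x i j),
      forall x, U x -> (g x)^T = g x
    & forall x, U x -> g x \in unitmx].

Definition sqrtg g (x : 'rV[R]_a) : R := Num.sqrt `|\det (g x)|.

Definition christoffel g (k i j : 'I_a) (x : 'rV[R]_a) : R :=
  2^-1 * \sum_l invmx (g x) k l *
    (partial i (fun y => g y l j) x + partial j (fun y => g y l i) x
     - partial l (fun y => g y i j) x).

(* v^k_{;k} *)
Definition divergence g v (x : 'rV[R]_a) : R :=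
  \sum_k (partial k (fun y => v y 0 k) x
          + \sum_l christoffel g k k l x * v x 0 l).

(* g^{ij} f_{;ij} *)
Definition laplacian g f (x : 'rV[R]_a) : R :=
  \sum_i \sum_j invmx (g x) i j *
    (partial j (partial i f) x - \sum_k christoffel g k i j x * partial k f x).

(* g^{kl} f_{,l} *)
Definition grad g f (x : 'rV[R]_a) : 'rV[R]_a :=
  \row_k \sum_l invmx (g x) k l * partial l f x.

(* v^k f_{,k} *)
Definition along v f (x : 'rV[R]_a) : R := \sum_k v x 0 k * partial k f x.

Definition lie_metric g v (x : 'rV[R]_a) : 'M[R]_a :=
  \matrix_(i, j) \sum_k
    (v x 0 k * partial k (fun y => g y i j) x
     + g x k j * partial i (fun y => v y 0 k) x
     + g x i k * partial j (fun y => v y 0 k) x).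

Definition conformal U g v (psi : 'rV[R]_a -> R) : Prop :=
  forall x, U x -> lie_metric g v x = (2 * psi x) *: g x.

Definition homothetic U g v (c : R) : Prop := conformal U g v (fun=> c).

Definition killing U g v : Prop := homothetic U g v 0.

Definition kv_or_hv U g v : Prop := exists c, homothetic U g v c.

Definition is_gradient U g v : Prop :=
  exists2 f, smooth U f & forall x, U x -> v x = grad g f x.

(* The non-gradient part of a field may be absent. *)
Definition zero_or_nongradient U g v : Prop :=
  (forall x, U x -> v x = 0) \/ ~ is_gradient U g v.

Definition admits_proper_gradient_hv U g : Prop :=
  exists (f : 'rV[R]_a -> R) (c : R),
    [/\ smooth U f, c != 0 & homothetic U g (grad g f) c].

End Geometry.

(* Jets: p k A is u^A_{,k}, and q (mxvec_index i j) A is u^A_{,ij}.  A function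
   on the first jet space is a curried function of x, u, p.                  *)
Section Variational.
Context {R : realType} {n m : nat}.

Let fun0 := 'rV[R]_n -> 'rV[R]_m -> R.
Let fun1 := 'rV[R]_n -> 'rV[R]_m -> 'M[R]_(n, m) -> R.
Let fun2 := 'rV[R]_n -> 'rV[R]_m -> 'M[R]_(n, m) -> 'M[R]_(n * n, m) -> R.

Implicit Types (U : set 'rV[R]_n) (W : set 'rV[R]_m).
Implicit Types (xi gauge : 'rV[R]_n -> 'rV[R]_m -> 'rV[R]_n).
Implicit Types (eta : 'rV[R]_n -> 'rV[R]_m -> 'rV[R]_m).
Implicit Types (x : 'rV[R]_n) (u : 'rV[R]_m).
Implicit Types (p : 'M[R]_(n, m)) (q : 'M[R]_(n * n, m)).
Implicit Types (L : fun1).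

Definition total0 (i : 'I_n) (f : fun0) : fun1 := fun x u p =>
  partial i (f^~ u) x + \sum_A p i A * partial A (f x) u.

Definition total1 (i : 'I_n) (f : fun1) : fun2 := fun x u p q =>
  partial i (fun y => f y u p) x
  + \sum_A p i A * partial A (fun w => f x w p) u
  + \sum_j \sum_A q (mxvec_index i j) A * mpartial j A (f x u) p.

Definition prolong1 xi eta (i : 'I_n) (A : 'I_m) : fun1 := fun x u p =>
  total0 i (fun y w => eta y w 0 A) x u p
  - \sum_k p k A * total0 i (fun y w => xi y w 0 k) x u p.

Definition prolong2 xi eta (i j : 'I_n) (A : 'I_m) : fun2 := fun x u p q =>
  total1 j (prolong1 xi eta i A) x u p q
  - \sum_k q (mxvec_index i k) A * total0 j (fun y w => xi y w 0 k) x u p.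

(* X^{[1]} F *)
Definition act1 xi eta (F : fun1) : fun1 := fun x u p =>
  \sum_k xi x u 0 k * partial k (fun y => F y u p) x
  + \sum_A eta x u 0 A * partial A (fun w => F x w p) u
  + \sum_i \sum_A prolong1 xi eta i A x u p * mpartial i A (F x u) p.

(* X^{[2]} F *)
Definition act2 xi eta (F : fun2) : fun2 := fun x u p q =>
  act1 xi eta (fun y w r => F y w r q) x u p
  + \sum_i \sum_j \sum_A
      prolong2 xi eta i j A x u p q
      * mpartial (mxvec_index i j) A (F x u p) q.

Definition euler_lagrange L (A : 'I_m) : fun2 := fun x u p q =>
  \sum_i total1 i (fun y w r => mpartial i A (L y w) r) x u p q
  - partial A (fun w => L x w p) u.

Definition symmetric_jet q : Prop :=
  forall i j A, q (mxvec_index i j) A = q (mxvec_index j i) A.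

(* X^{[2]} annihilates the equations at every 2-jet that satisfies them. *)
Definition lie_point_symmetry U W L xi eta : Prop :=
  forall x u p q, U x -> W u -> symmetric_jet q ->
    (forall A, euler_lagrange L A x u p q = 0) ->
    forall A, act2 xi eta (euler_lagrange L A) x u p q = 0.

Definition noether_point_symmetry U W L xi eta gauge : Prop :=
  lie_point_symmetry U W L xi eta /\
  forall x u p, U x -> W u ->
    act1 xi eta L x u p
      + L x u p * \sum_i total0 i (fun y w => xi y w 0 i) x u p
    = \sum_i total0 i (fun y w => gauge y w 0 i) x u p.

Definition hamiltonian L (i k : 'I_n) : fun1 := fun x u p =>
  \sum_A p k A * mpartial i A (L x u) p - (i == k)%:R * L x u p.

Definition noether_current L xi eta gauge (i : 'I_n) : fun1 := fun x u p =>
  \sum_k xi x u 0 k * hamiltonian L i k x u p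
  - \sum_A eta x u 0 A * mpartial i A (L x u) p + gauge x u 0 i.

End Variational.

Section QuasilinearLagrangian.
Context {R : realType} {n m : nat}.
Implicit Types (U : set 'rV[R]_n) (W : set 'rV[R]_m).
Implicit Types (g : 'rV[R]_n -> 'M[R]_n) (H : 'rV[R]_m -> 'M[R]_m).
Implicit Types (V KG : 'rV[R]_n -> 'rV[R]_m -> R).
Implicit Types (xi Phi : 'rV[R]_n -> 'rV[R]_n) (KNG : 'rV[R]_m -> 'rV[R]_m).
Implicit Types (psi : 'rV[R]_n -> R) (Y : 'rV[R]_m -> R).
Implicit Types (x : 'rV[R]_n) (u : 'rV[R]_m) (p : 'M[R]_(n, m)).

Definition lagrangian g H V x u p : R :=
  2^-1 * sqrtg g x * (\sum_i \sum_j \sum_A \sum_B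
    invmx (g x) i j * H u A B * p i A * p j B)
  - sqrtg g x * V x u.

(* K_G^A + K_NG^A, where K_G is the potential of K_G^A. *)
Definition K_vector H KG KNG x u : 'rV[R]_m := grad H (KG x) u + KNG u.

Definition K_gauge g KG Phi x u : 'rV[R]_n :=
  sqrtg g x *: (grad g (KG^~ u) x + Phi x).

Definition Y_vector H psi Y KG KNG x u : 'rV[R]_m :=
  ((2 - n%:R) / 2 * psi x) *: grad H Y u + K_vector H KG KNG x u.

Definition Y_gauge g psi Y KG Phi x u : 'rV[R]_n :=
  sqrtg g x *: (((2 - n%:R) / 2 * Y u) *: grad g psi x
                + grad g (KG^~ u) x + Phi x).

(* Delta_g K_G + V_{,A} K^A + Phi^k_{;k} *)
Definition K_terms g H V KG KNG Phi x u : R :=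
  (laplacian g (KG^~ u) x + along (K_vector H KG KNG x) (V x) u)
  + divergence g Phi x.

Definition smooth_generators U W xi psi KG KNG Phi : Prop :=
  [/\ vsmooth U xi, smooth U psi, smooth2 U W KG, vsmooth W KNG
    & vsmooth U Phi].

(* K_G^A and K_NG^A may separately be proper homothetic fields, but their sum is
   Killing: otherwise u^A d_A would qualify for flat g, H and V = 0, although
   it only rescales the Lagrangian.                                          *)
Definition kv_hv_parts U W H KG KNG : Prop :=
  [/\ forall x, U x -> kv_or_hv W H (grad H (KG x)),
      kv_or_hv W H KNG, zero_or_nongradient W H KNG
    & forall x, U x -> killing W H (K_vector H KG KNG x)].

Definition generators_Y U W g H V Y xi psi KG KNG Phi : Prop :=
  [/\ smooth_generators U W xi psi KG KNG Phi,
      conformal U g xi psi,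
      kv_hv_parts U W H KG KNG
    & forall x u, U x -> W u ->
        along xi (V^~ u) x + n%:R * psi x * V x u
        + (2 - n%:R) / 2 * (psi x * along (grad H Y) (V x) u
                            + Y u * laplacian g psi x)
        + K_terms g H V KG KNG Phi x u = 0].

Definition generators_dim2 U W g H V xi psi KG KNG Phi : Prop :=
  [/\ smooth_generators U W xi psi KG KNG Phi,
      conformal U g xi psi,
      kv_hv_parts U W H KG KNG
    & forall x u, U x -> W u ->
        along xi (V^~ u) x + 2 * psi x * V x u
        + K_terms g H V KG KNG Phi x u = 0].

Definition generators_KV U W g H V xi KG KNG Phi : Prop :=
  [/\ smooth_generators U W xi (fun=> 0) KG KNG Phi,
      killing U g xi,
      (forall x, U x -> killing W H (grad H (KG x))),
      killing W H KNG /\ zero_or_nongradient W H KNG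
    & forall x u, U x -> W u ->
        along xi (V^~ u) x + K_terms g H V KG KNG Phi x u = 0].

(* A homothety of g with constant factor c <> 0 compensated by a proper
   non-gradient homothety of H.  This family exists as soon as g and H admit
   such fields and V is suitable (e.g. V = 0), even if H has no proper
   gradient HV: take n = 3, g flat, xi = x^i d_i and
   H = e^(2v + w^2) (dw^2 + dv^2), KNG = - d_v / 2.                          *)
Definition generators_nongradient_HV U W g H V (c : R) xi KG KNG Phi : Prop :=
  [/\ smooth_generators U W xi (fun=> c) KG KNG Phi,
      c != 0 /\ homothetic U g xi c,
      (forall x, U x -> killing W H (grad H (KG x))),
      homothetic W H KNG ((2 - n%:R) / 2 * c) /\ ~ is_gradient W H KNG
    & forall x u, U x -> W u ->
        along xi (V^~ u) x + n%:R * c * V x u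
        + K_terms g H V KG KNG Phi x u = 0].

End QuasilinearLagrangian.

(* Main.v *)
Require Import Defs.
From mathcomp Require Import all_boot all_order all_algebra perm.
From mathcomp Require Import all_classical all_reals all_analysis.
From mathcomp Require Import ring lra.
Import Order.TTheory GRing.Theory Num.Theory.
Import numFieldNormedType.Exports.

(** At a fixed point (x, u) the Noether identity
    X^[1] L + L D_i xi^i = D_i A^i is a cubic polynomial in the first derivatives of
    the dependent variables, so it amounts to the vanishing of four homogeneous parts
    ([noether_coefficients]).

    The cubic part forces xi to be independent of u ([noether3P]). The quadratic part
    then balances the change of the density sqrt g g^{ij} along xi against the change
    of H_AB along eta; contracting it with g shows that xi is conformal, with a factor
    psi, and that L_eta H = (2 - n) psi H ([noether_conformal]). With Z = A / sqrt g
    the linear part reads Z^i_{,A} = g^{ij} H_AB eta^B_{,j}, the gauge equation, and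
    the part of degree zero is the condition on V ([system_of_noether]).

    Conversely, fields that satisfy these conditions satisfy the Noether identity,
    and the identity implies that X is a Lie point symmetry: the prolongation of X
    commutes with total derivatives up to the first derivatives of xi, the Euler
    operator annihilates divergences, and so X maps the Euler-Lagrange expressions to
    linear combinations of themselves ([lie_of_noether_identity],
    [noether_of_system]).

    It remains to solve the gauge equation. It states that a one-form on the product
    of the two domains has agreeing mixed derivatives. Subtracting from its
    u-components their values at a base point x0, and from its x-components their
    values at u0, makes it exact on connected domains, whatever their topology
    ([exists_potential]). Hence eta(x, u) is the gradient of some K_G(x, .) plus the
    field eta(x0, u), and Z is the x-gradient of K_G plus a field of x alone
    ([gradient_splitting]).

    If H has a proper gradient homothety with potential Y, the field
    (2 - n)/2 psi grad Y, with (2 - n)/2 Y grad psi in the gauge, solves the gauge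
    equation and accounts for the whole factor (2 - n)/2 psi of eta; the rest of eta
    is Killing and is split as above. For n = 2 the factor is zero and eta itself is
    Killing. If n > 2 and H has no such homothety, the gradient part of eta is
    homothetic for each x, being the difference of two homothetic fields, hence
    Killing. So (2 - n)/2 psi is the constant homothetic factor of the remaining
    field of u, and psi is a constant c: c = 0 gives the Killing family, and for
    c <> 0 the remaining field is a proper homothety which is not a gradient. *)

Set Implicit Arguments.
Unset Strict Implicit.
Unset Printing Implicit Defensive.

Local Open Scope classical_set_scope.
Local Open Scope ring_scope.

(** * Partial derivatives *)

Section Directional.
Context {R : realType}.

Section Lines.
Context {V W : normedModType R}.
Implicit Types (f : V -> R) (g : W -> R).

Lemma growth_line f g x v y w :
    (forall t, f (t *: v + x) = g (t *: w + y)) ->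
  (fun h : R => h^-1 *: ((f \o shift x) (h *: v) - f x)) =
  (fun h : R => h^-1 *: ((g \o shift y) (h *: w) - g y)).
Proof.
move=> fg; have fg0 : f x = g y by have := fg 0; rewrite !scale0r !add0r.
by apply/funext => h /=; rewrite fg fg0.
Qed.

(** A directional derivative only sees the restriction to a line; comparing lines
    transports derivatives between spaces of different dimensions. *)
Lemma derive_line f g x v y w :
  (forall t, f (t *: v + x) = g (t *: w + y)) -> 'D_v f x = 'D_w g y.
Proof. by move=> fg; rewrite /derive (growth_line fg). Qed.

Lemma derivable_line f g x v y w :
  (forall t, f (t *: v + x) = g (t *: w + y)) ->
  derivable g y w -> derivable f x v.
Proof. by move=> fg; rewrite /derivable (growth_line fg). Qed.

End Lines.

End Directional.

Section Partial.
Context {R : realType} {a : nat}.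
Implicit Types (f g : 'rV[R]_a -> R) (x : 'rV[R]_a) (U : set 'rV[R]_a).

Local Notation e_ i := (delta_mx 0 i).

Lemma partial_line b (g : 'rV[R]_b -> R) f i j x y :
  (forall t, f (t *: e_ i + x) = g (t *: e_ j + y)) ->
  partial i f x = partial j g y.
Proof. exact: derive_line. Qed.

Lemma partial_const_line f i x : (forall t, f (t *: e_ i + x) = f x) ->
  derivable f x (e_ i) /\ partial i f x = 0.
Proof.
move=> fx; have fl t : f (t *: e_ i + x) = cst (f x) (t *: e_ i + x) by rewrite fx.
split; first exact: derivable_line fl (derivable_cst _ _ _).
by rewrite /partial /mpartial (derive_line fl) derive_cst.
Qed.

Lemma near_eq_partial f g i x : (\near x, f x = g x) ->
  partial i f x = partial i g x.
Proof. exact: near_eq_derive. Qed.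

Lemma open_eq_partial U f g i x : open U -> U x -> {in U, f =1 g} ->
  partial i f x = partial i g x.
Proof.
move=> oU Ux fg; apply: near_eq_partial; near=> y; apply: fg; rewrite inE.
by near: y; exact: open_nbhs_nbhs.
Unshelve. all: by end_near. Qed.

Lemma open_eq_derivable U f g i x : open U -> U x -> {in U, f =1 g} ->
  derivable f x (e_ i) -> derivable g x (e_ i).
Proof.
move=> oU Ux fg; apply: near_eq_derivable; near=> y; apply: fg; rewrite inE.
by near: y; exact: open_nbhs_nbhs.
Unshelve. all: by end_near. Qed.

Lemma partial_cst c i x : partial i (fun=> c) x = 0.
Proof. exact: derive_cst. Qed.

Lemma partialD f g i x : derivable f x (e_ i) -> derivable g x (e_ i) ->
  partial i (fun y => f y + g y) x = partial i f x + partial i g x.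
Proof. exact: deriveD. Qed.

Lemma partialB f g i x : derivable f x (e_ i) -> derivable g x (e_ i) ->
  partial i (fun y => f y - g y) x = partial i f x - partial i g x.
Proof. exact: deriveB. Qed.

Lemma partialM f g i x : derivable f x (e_ i) -> derivable g x (e_ i) ->
  partial i (fun y => f y * g y) x = partial i f x * g x + f x * partial i g x.
Proof.
move=> df dg; rewrite /partial /mpartial (deriveM df dg) addrC.
by congr (_ + _); rewrite /GRing.scale/= mulrC.
Qed.

Lemma partialZ c f i x : derivable f x (e_ i) ->
  partial i (fun y => c * f y) x = c * partial i f x.
Proof. exact: deriveZ. Qed.

Lemma derivable_funD f g i x : derivable f x (e_ i) -> derivable g x (e_ i) ->
  derivable (fun y => f y + g y) x (e_ i).
Proof. exact: derivableD. Qed.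

Lemma derivable_funM f g i x : derivable f x (e_ i) -> derivable g x (e_ i) ->
  derivable (fun y => f y * g y) x (e_ i).
Proof. exact: derivableM. Qed.

Lemma derivable_bigsum I (r : seq I) (P : pred I) (F : I -> 'rV[R]_a -> R) i x :
  (forall k, derivable (F k) x (e_ i)) ->
  derivable (fun y => \sum_(k <- r | P k) F k y) x (e_ i).
Proof.
move=> dF; elim: r => [|k r IH].
  by under eq_fun do rewrite big_nil; exact: derivable_cst.
under eq_fun do rewrite big_cons; case: (P k) => //.
exact: derivableD.
Qed.

Lemma partial_sum I (r : seq I) (P : pred I) (F : I -> 'rV[R]_a -> R) i x :
  (forall k, derivable (F k) x (e_ i)) ->
  partial i (fun y => \sum_(k <- r | P k) F k y) x =
  \sum_(k <- r | P k) partial i (F k) x.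
Proof.
move=> dF; elim: r => [|k r IH].
  by rewrite big_nil; under eq_fun do rewrite big_nil; exact: partial_cst.
rewrite big_cons; under eq_fun do rewrite big_cons; case: (P k) => //.
by rewrite partialD ?IH//; exact: derivable_bigsum.
Qed.

Lemma derivable_coord i j x : derivable (fun y : 'rV[R]_a => y 0 j) x (e_ i).
Proof. exact/diff_derivable/differentiable_coord. Qed.

Lemma partial_coord i j x : partial i (fun y => y 0 j) x = (j == i)%:R.
Proof.
transitivity ('D_1 ((j == i)%:R *: (id : R -> R) + cst (x 0 j)) 0).
  apply: derive_line => t; rewrite !mxE !eqxx/= /GRing.scale/= mulr1 addr0.
  by rewrite -[RHS]/((j == i)%:R * t + x 0 j) mulrC.
rewrite deriveD ?derive_cst ?addr0; last 2 first.
- exact/derivableZ.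
- exact: derivable_cst.
by rewrite deriveZ// derive_id /GRing.scale/= mulr1.
Qed.

End Partial.

(** * Closure properties of smooth functions *)

Section Chain.
Context {R : realType}.
Variables (f g : R -> R) (x : R).
Hypotheses (df : derivable f x 1) (dg : derivable g (f x) 1).

Lemma derivable_comp1 : derivable (fun s => g (f s)) x 1.
Proof.
have h1 : differentiable f x by exact/derivable1_diffP.
have h2 : differentiable g (f x) by exact/derivable1_diffP.
exact/derivable1_diffP/(differentiable_comp h1 h2).
Qed.

Lemma derive_comp1 : 'D_1 (fun s => g (f s)) x = 'D_1 g (f x) * 'D_1 f x.
Proof. by rewrite -!derive1E -(derive1_comp df dg). Qed.

End Chain.

Section CkClosure.
Context {R : realType} {a : nat}.
Implicit Types (f g : 'rV[R]_a -> R) (x : 'rV[R]_a) (U : set 'rV[R]_a).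

Local Notation e_ i := (delta_mx 0 i).

Lemma Ck_continuous k U f x : Ck k U f -> U x -> {for x, continuous f}.
Proof. by case: k => [|k] [cf _] Ux; exact: cf. Qed.

Lemma CkW k U f : Ck k.+1 U f -> Ck k U f.
Proof.
elim: k f => [|k IH] f [cf df]; first by split.
split => // i; have [dfi ckf] := df i; split => //; exact: IH.
Qed.

Lemma open_eq_continuous U f g x : open U -> U x -> {in U, f =1 g} ->
  {for x, continuous f} -> {for x, continuous g}.
Proof.
move=> oU Ux fg cf; rewrite /prop_for /continuous_at -(fg x (mem_set Ux)).
apply: cvg_trans cf; apply: (@near_eq_cvg _ _ (nbhs x)).
near=> y; apply: fg; rewrite inE.
by near: y; exact: open_nbhs_nbhs.
Unshelve. all: by end_near. Qed.

Lemma eq_Ck k U f g : open U -> {in U, f =1 g} -> Ck k U f -> Ck k U g.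
Proof.
move=> oU; elim: k f g => [|k IH] f g fg [cf df].
  by split=> // x Ux; exact: open_eq_continuous fg (cf x Ux).
split=> [x Ux|i]; first exact: open_eq_continuous fg (cf x Ux).
have [dfi ckf] := df i; split.
  move=> x Ux; exact: (open_eq_derivable oU Ux fg (dfi x Ux)).
apply: IH ckf => x; rewrite inE => Ux; exact: open_eq_partial fg.
Qed.

Lemma Ck_cst k U (c : R) : Ck k U (fun=> c).
Proof.
elim: k c => [|k IH] c; first by split=> // x _; exact: cst_continuous.
split=> [x _|i]; first exact: cst_continuous.
split=> [x _|]; first exact: derivable_cst.
rewrite (_ : partial i _ = fun=> 0)//; apply/funext => x; exact: partial_cst.
Qed.

Lemma CkD k U f g : open U -> Ck k U f -> Ck k U g ->
  Ck k U (fun x => f x + g x).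
Proof.
move=> oU; elim: k f g => [|k IH] f g [cf df] [cg dg].
  by split=> // x Ux; apply: continuousD; [exact: cf|exact: cg].
split=> [x Ux|i]; first by apply: continuousD; [exact: cf|exact: cg].
have [[dfi ckf] [dgi ckg]] := (df i, dg i); split.
  by move=> x Ux; apply: derivableD; [exact: dfi|exact: dgi].
apply: (eq_Ck oU _ (IH _ _ ckf ckg)) => x; rewrite inE => Ux.
by rewrite partialD//; [exact: dfi|exact: dgi].
Qed.

Lemma CkM k U f g : open U -> Ck k U f -> Ck k U g ->
  Ck k U (fun x => f x * g x).
Proof.
move=> oU; elim: k f g => [|k IH] f g.
  move=> [cf df] [cg dg].
  by split=> // x Ux; apply: continuousM; [exact: cf|exact: cg].
move=> Cf Cg; have [ckf ckg] := (CkW Cf, CkW Cg).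
have [[cf df] [cg dg]] := (Cf, Cg).
split=> [x Ux|i]; first by apply: continuousM; [exact: cf|exact: cg].
have [[dfi ckfi] [dgi ckgi]] := (df i, dg i); split.
  by move=> x Ux; apply: derivableM; [exact: dfi|exact: dgi].
apply: (eq_Ck oU _ (CkD oU (IH _ _ ckfi ckg) (IH _ _ ckf ckgi))) => x.
by rewrite inE => Ux; rewrite partialM//; [exact: dfi|exact: dgi].
Qed.

Lemma derivable_chain (phi : R -> R) f i x :
  derivable f x (e_ i) -> derivable phi (f x) 1 ->
  derivable (fun y => phi (f y)) x (e_ i) /\
  partial i (fun y => phi (f y)) x = 'D_1 phi (f x) * partial i f x.
Proof.
pose h t := f (t *: e_ i + x).
have h0 : h 0 = f x by rewrite /h scale0r add0r.
move=> /derivable1P dh; rewrite -h0 => dphi.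
have t1 (t : R) : t *: (1 : R) + 0 = t by rewrite addr0 /GRing.scale/= mulr1.
have H t : phi (f (t *: e_ i + x)) = (fun s => phi (h s)) (t *: (1 : R) + 0).
  by rewrite t1.
split; first exact: derivable_line H (derivable_comp1 dh dphi).
transitivity ('D_1 (fun s => phi (h s)) 0); first exact: derive_line H.
rewrite (derive_comp1 dh dphi); congr (_ * _).
by apply/esym/derive_line => t; rewrite t1.
Qed.

Lemma CkV k U f : open U -> (forall x, U x -> f x != 0) -> Ck k U f ->
  Ck k U (fun x => (f x)^-1).
Proof.
move=> oU f0; elim: k => [|k IH] Cf.
  by split=> // x Ux; apply: continuousV; [exact: f0|exact: Ck_continuous Cf Ux].
split=> [x Ux|i].
  by apply: continuousV; [exact: f0|exact: Ck_continuous Cf Ux].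
have [_ /(_ i)[dfi Cfi]] := Cf; split.
  by move=> x Ux; apply: derivableV; [exact: f0|exact: dfi].
have CV := IH (CkW Cf).
apply: (eq_Ck oU _ (CkM oU (Ck_cst _ _ (-1)) (CkM oU (CkM oU CV CV) Cfi))) => x.
rewrite inE => Ux; rewrite /partial /mpartial deriveV ?f0//; last exact: dfi.
by rewrite /GRing.scale/= mulN1r mulNr expr2 invfM.
Qed.

Lemma Ck_sqrt k U f : open U -> (forall x, U x -> 0 < f x) -> Ck k U f ->
  Ck k U (fun x => Num.sqrt (f x)).
Proof.
move=> oU f0; elim: k => [|k IH] Cf.
  split=> // x Ux; apply: (continuous_comp (Ck_continuous Cf Ux)).
  exact: sqrt_continuous.
split=> [x Ux|i].
  apply: (continuous_comp (Ck_continuous Cf Ux)); exact: sqrt_continuous.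
have [_ /(_ i)[dfi Cfi]] := Cf.
have ds x (Ux : U x) : is_derive (f x) 1 Num.sqrt (2 * Num.sqrt (f x))^-1.
  by apply: is_derive1_sqrt; exact: f0.
have dsx x (Ux : U x) : derivable Num.sqrt (f x) 1 := @ex_derive _ _ _ _ _ _ _ (ds x Ux).
split=> [x Ux|]; first by have [] := derivable_chain (dfi x Ux) (dsx x Ux).
have s0 x : U x -> Num.sqrt (f x) != 0 by move=> /f0 ?; rewrite gt_eqF// sqrtr_gt0.
have CV := CkV oU s0 (IH (CkW Cf)).
apply: (eq_Ck oU _ (CkM oU (CkM oU (Ck_cst _ _ 2^-1) CV) Cfi)) => x.
rewrite inE => Ux; have [_ ->] := derivable_chain (dfi x Ux) (dsx x Ux).
by rewrite (@derive_val _ _ _ _ _ _ _ (ds x Ux)) invfM.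
Qed.

End CkClosure.

Section SmoothClosure.
Context {R : realType} {a : nat}.
Implicit Types (f g : 'rV[R]_a -> R) (x : 'rV[R]_a) (U : set 'rV[R]_a).

Local Notation e_ i := (delta_mx 0 i).

Lemma smooth_derivable U f i x : smooth U f -> U x -> derivable f x (e_ i).
Proof. by move=> /(_ 1%N)[_ /(_ i)[df _]] /df. Qed.

Lemma smooth_continuous U f x : smooth U f -> U x -> {for x, continuous f}.
Proof. by move=> /(_ 0%N)/Ck_continuous; apply. Qed.

Lemma smooth_partial U f i : smooth U f -> smooth U (partial i f).
Proof. by move=> sf k; have [_ /(_ i)[]] := sf k.+1. Qed.

Lemma smoothS U f : (forall x, U x -> {for x, continuous f}) ->
  (forall i, (forall x, U x -> derivable f x (e_ i)) /\ smooth U (partial i f)) ->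
  smooth U f.
Proof.
move=> cf df [|k]; first by split.
by split=> // i; have [dfi sf] := df i; split.
Qed.

Lemma eq_smooth U f g : open U -> {in U, f =1 g} -> smooth U f -> smooth U g.
Proof. by move=> oU fg sf k; exact: eq_Ck fg (sf k). Qed.

Lemma smooth_cst U (c : R) : smooth U (fun=> c).
Proof. by move=> k; exact: Ck_cst. Qed.

Lemma smooth_coord U j : smooth U (fun x => x 0 j).
Proof.
apply: smoothS => [x _|i]; first exact: coord_continuous.
split=> [x _|]; first exact: derivable_coord.
rewrite (_ : partial i _ = fun=> (j == i)%:R); first exact: smooth_cst.
by apply/funext => x; exact: partial_coord.
Qed.

Section OpenDomain.
Variables (U : set 'rV[R]_a) (oU : open U).

Lemma smoothD f g : smooth U f -> smooth U g -> smooth U (fun x => f x + g x).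
Proof. by move=> sf sg k; exact: CkD. Qed.

Lemma smoothM f g : smooth U f -> smooth U g -> smooth U (fun x => f x * g x).
Proof. by move=> sf sg k; exact: CkM. Qed.

Lemma smoothZ c f : smooth U f -> smooth U (fun x => c * f x).
Proof. by apply: smoothM; exact: smooth_cst. Qed.

Lemma smoothN f : smooth U f -> smooth U (fun x => - f x).
Proof. by move=> /(smoothZ (-1)); under eq_fun do rewrite mulN1r. Qed.

Lemma smoothB f g : smooth U f -> smooth U g -> smooth U (fun x => f x - g x).
Proof. by move=> sf sg; apply: smoothD => //; exact: smoothN. Qed.

Lemma smoothV f : (forall x, U x -> f x != 0) -> smooth U f ->
  smooth U (fun x => (f x)^-1).
Proof. by move=> f0 sf k; exact: CkV. Qed.

Lemma smooth_sqrt f : (forall x, U x -> 0 < f x) -> smooth U f ->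
  smooth U (fun x => Num.sqrt (f x)).
Proof. by move=> f0 sf k; exact: Ck_sqrt. Qed.

Lemma smooth_sum I (r : seq I) (P : pred I) (F : I -> 'rV[R]_a -> R) :
  (forall i, smooth U (F i)) -> smooth U (fun x => \sum_(i <- r | P i) F i x).
Proof.
move=> sF; elim: r => [|i r IH].
  by under eq_fun do rewrite big_nil; exact: smooth_cst.
by under eq_fun do rewrite big_cons; case: (P i) => //; exact: smoothD.
Qed.

Lemma smooth_prod I (r : seq I) (P : pred I) (F : I -> 'rV[R]_a -> R) :
  (forall i, smooth U (F i)) -> smooth U (fun x => \prod_(i <- r | P i) F i x).
Proof.
move=> sF; elim: r => [|i r IH].
  by under eq_fun do rewrite big_nil; exact: smooth_cst.
by under eq_fun do rewrite big_cons; case: (P i) => //; exact: smoothM.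
Qed.

Lemma smooth_det b (F : 'rV[R]_a -> 'M[R]_b) :
  (forall i j, smooth U (fun x => F x i j)) -> smooth U (fun x => \det (F x)).
Proof.
move=> sF; rewrite /determinant; apply: smooth_sum => s; apply: smoothZ.
by apply: smooth_prod => i; exact: sF.
Qed.

Lemma smooth_invmx b (F : 'rV[R]_a -> 'M[R]_b) :
  (forall i j, smooth U (fun x => F x i j)) ->
  (forall x, U x -> F x \in unitmx) ->
  forall i j, smooth U (fun x => invmx (F x) i j).
Proof.
move=> sF uF i j.
apply: (@eq_smooth _ (fun x => (\det (F x))^-1 * \adj (F x) i j)) => //.
  by move=> x; rewrite inE => Ux; rewrite /invmx uF// !mxE.
apply: smoothM; first apply: smoothV.
- by move=> x /uF; rewrite unitmxE unitfE.
- exact: smooth_det.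
under eq_fun do rewrite mxE /cofactor.
apply: smoothZ.
apply: (@smooth_det _ (fun x => row' j (col' i (F x)))) => k l.
under eq_fun do rewrite !mxE; exact: sF.
Qed.

End OpenDomain.

End SmoothClosure.

(** A map that moves every coordinate line either nowhere or along a coordinate
    line of the target at unit speed commutes with partial derivatives.  Both
    the projections of a product domain and the inclusions of its slices are of
    this kind. *)
Definition coordinate_map {R : realType} {a b : nat}
    (A : 'rV[R]_a -> 'rV[R]_b) : Prop :=
  continuous A /\ forall i,
    (forall t z, A (t *: delta_mx 0 i + z) = A z) \/
    (exists j, forall t z, A (t *: delta_mx 0 i + z) = t *: delta_mx 0 j + A z).

Lemma smooth_coordinate_map {R : realType} {a b : nat} (U : set 'rV[R]_b)
    (U' : set 'rV[R]_a) (A : 'rV[R]_a -> 'rV[R]_b) f :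
  coordinate_map A -> (forall x, U' x -> U (A x)) ->
  smooth U f -> smooth U' (f \o A).
Proof.
move=> [cA lA] UA sf k; elim: k f sf => [|k IH] f sf.
  split=> // x Ux; apply: (continuous_comp (cA x)).
  exact: (smooth_continuous sf (UA x Ux)).
split=> [x Ux|i].
  apply: (continuous_comp (cA x)); exact: (smooth_continuous sf (UA x Ux)).
have [lAi|[j lAi]] := lA i.
  have H x t : (f \o A) (t *: delta_mx 0 i + x) = (f \o A) x by rewrite /= lAi.
  split=> [x _|]; first by have [] := partial_const_line (H x).
  rewrite (_ : partial i _ = fun=> 0); first exact: Ck_cst.
  by apply/funext => x; have [] := partial_const_line (H x).
have H x t : (f \o A) (t *: delta_mx 0 i + x) = f (t *: delta_mx 0 j + A x).
  by rewrite /= lAi.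
split=> [x Ux|].
  apply: (derivable_line (H x)); exact: smooth_derivable sf (UA x Ux).
rewrite (_ : partial i _ = partial j f \o A); first exact/IH/smooth_partial.
by apply/funext => x; exact: partial_line (H x).
Qed.

(** * Coordinate paths and symmetry of second derivatives *)

Section CoordinatePaths.
Context {R : realType} {a : nat}.
Implicit Types (f : 'rV[R]_a -> R) (x y z : 'rV[R]_a) (U : set 'rV[R]_a).

Local Notation e_ i := (delta_mx 0 i).

(** Balls of row vectors are cubes, so that two points of a ball are joined by
    coordinate steps that stay in it. *)
Lemma ball_steps (P : 'rV[R]_a -> Prop) x r y z :
    ball x r y -> ball x r z -> P y ->
    (forall (w : 'rV[R]_a) i, w 0 i = y 0 i -> ball x r w ->
       ball x r ((z 0 i - y 0 i) *: e_ i + w) -> P w ->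
       P ((z 0 i - y 0 i) *: e_ i + w)) ->
  P z.
Proof.
move=> xy xz Py step.
pose h k := \row_i (if (i < k)%N then z 0 i else y 0 i).
have hball k : ball x r (h k).
  case: xy xz => r0 xy [_ xz]; split=> // i j.
  by rewrite mxE (ord1 i); case: ifP => _; [exact: xz|exact: xy].
have hS (i : 'I_a) : h i.+1 = (z 0 i - y 0 i) *: e_ i + h i.
  apply/rowP => j; rewrite !mxE eqxx/= ltnS leq_eqVlt (inj_eq val_inj).
  case: eqVneq => [->|ij]; first by rewrite ltnn mulr1 subrK.
  by rewrite mulr0 add0r.
have Ph k : (k <= a)%N -> P (h k).
  elim: k => [|k IH] ka.
    by rewrite (_ : h 0%N = y)//; apply/rowP => j; rewrite mxE.
  rewrite (hS (Ordinal ka)); apply: step => //.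
  - by rewrite mxE/= ltnn.
  - by rewrite -hS; exact: hball.
  - by apply: IH; exact: ltnW.
rewrite (_ : z = h a); first exact: Ph.
by apply/rowP => j; rewrite mxE ltn_ord.
Qed.

Lemma ball_segment x r i t w theta : 0 <= theta <= 1 ->
  ball x r w -> ball x r (t *: e_ i + w) ->
  ball x r ((theta * t) *: e_ i + w).
Proof.
move=> /andP[t0 t1] [r0 xw] [_ xw']; split=> // k j; have := xw k j; have := xw' k j.
rewrite /ball/= !mxE; set d := (_ && _)%:R; set b := x k j; set c := w k j.
rewrite (_ : b - (theta * t * d + c) = (1 - theta) * (b - c) + theta * (b - (t * d + c))); last by ring.
move=> h2 h1; have hm : Num.max `|b - c| `|b - (t * d + c)| < r by rewrite gt_max h1 h2.
apply: le_lt_trans hm; apply: (le_trans (ler_normD _ _)).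
rewrite !normrM (ger0_norm t0) ger0_norm ?subr_ge0//.
set m := Num.max _ _; have m1 : `|b - c| <= m by rewrite le_max lexx.
have m2 : `|b - (t * d + c)| <= m by rewrite le_max lexx orbT.
rewrite (_ : m = (1 - theta) * m + theta * m); last by ring.
by rewrite lerD// ler_wpM2l// subr_ge0.
Qed.

Lemma is_derive_segment f i t z (s : R) :
  derivable f ((s * t) *: e_ i + z) (e_ i) ->
  is_derive s 1 (fun s : R => f ((s * t) *: e_ i + z))
    (t * partial i f ((s * t) *: e_ i + z)).
Proof.
move=> df; pose psi s := f (s *: e_ i + z).
have H u : psi (u *: 1 + s * t) = f (u *: e_ i + ((s * t) *: e_ i + z)).
  have -> : u *: (1 : R) = u by rewrite /GRing.scale/= mulr1.
  by rewrite /psi scalerDl addrA.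
have mE : (fun x : R => x * t) = t *: (id : R -> R).
  by apply/funext => x; rewrite mulrC.
have dm : derivable (fun x : R => x * t) s 1.
  by rewrite mE; exact: (@derivableZ R R R id t s 1 (@derivable_id _ _ s 1)).
have dp : derivable psi (s * t) 1 by exact: (derivable_line H df).
apply: DeriveDef; first exact: (derivable_comp1 dm dp).
rewrite (derive_comp1 dm dp) mulrC; congr (_ * _); last exact: derive_line H.
rewrite mE (@deriveZ R R R id t s 1 (@derivable_id _ _ s 1)) derive_id; exact: mulr1.
Qed.

Lemma MVT_line f i t z :
  (forall theta : R, 0 <= theta <= 1 -> derivable f ((theta * t) *: e_ i + z) (e_ i)) ->
  exists2 theta : R, 0 <= theta <= 1 &
    f (t *: e_ i + z) - f z = t * partial i f ((theta * t) *: e_ i + z).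
Proof.
move=> df; pose phi s := f ((s * t) *: e_ i + z).
have dphi (s : R) (s01 : 0 <= s <= 1) := is_derive_segment (df s s01).
have cphi : {within `[0, 1], continuous phi}.
  apply: derivable_within_continuous => s; rewrite in_itv/= => s01.
  exact: (@ex_derive _ _ _ _ _ _ _ (dphi s s01)).
have [s|s s01 E] := @MVT_segment R phi
    (fun s => t * partial i f ((s * t) *: e_ i + z)) 0 1 ler01 _ cphi.
  by rewrite in_itv/= => /andP[/ltW s0 /ltW s1]; apply: dphi; rewrite s0 s1.
exists s; first by move: s01; rewrite in_itv.
by move: E; rewrite /phi mul1r mul0r scale0r add0r subr0 mulr1.
Qed.

Lemma MVT_ball U f i x r t z : ball x r `<=` U ->
    (forall y, U y -> derivable f y (e_ i)) ->
    ball x r z -> ball x r (t *: e_ i + z) ->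
  exists2 y, ball x r y & f (t *: e_ i + z) - f z = t * partial i f y.
Proof.
move=> BU df xz xz'; have [theta t01|theta t01 E] := @MVT_line f i t z.
  by apply/df/BU; exact: ball_segment.
by exists ((theta * t) *: e_ i + z) => //; exact: ball_segment.
Qed.

Lemma open_ball U x : open U -> U x -> exists2 r : R, 0 < r & ball x r `<=` U.
Proof.
move=> oU Ux; have /nbhs_ballP[r /= r0 BU] : nbhs x U by exact: open_nbhs_nbhs.
by exists r.
Qed.

(** Locally bounded partial derivatives make f Lipschitz, since the mean value
    theorem applies to each of the coordinate steps between two points of a ball. *)
Lemma continuous_partials U f : open U ->
    (forall i x, U x -> derivable f x (e_ i)) ->
    (forall i x, U x -> {for x, continuous (partial i f)}) ->
  forall x, U x -> {for x, continuous f}.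
Proof.
move=> oU df cf x Ux; pose M := \sum_i `|partial i f x| + 1.
have [r r0 BU] := open_ball oU Ux.
have [d d0 Md] : exists2 d : R, 0 < d &
    forall y, ball x d y -> ball x r y /\ forall i, `|partial i f y| <= M.
  have : \forall y \near x, ball x r y /\ forall i, `|partial i f y| <= M.
    apply: filterI; first exact: nbhsx_ballx.
    apply: (@filter_forall _ _ (fun i y => `|partial i f y| <= M) (nbhs x)) => i.
    have /cvgr_norm_lt : partial i f y @[y --> x] --> partial i f x by exact: cf.
    move=> /(_ (`|partial i f x| + 1)); rewrite ltrDl => /(_ ltr01).
    apply: filterS => y /ltW /le_trans; apply.
    rewrite lerD2r (bigD1 i)//= lerDl; exact: sumr_ge0.
  by move=> /nbhs_ballP[d /= d0 H]; exists d.
have M0 : 0 < M by rewrite ltr_wpDl// sumr_ge0.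
have lip y : ball x d y -> `|f y - f x| <= M * \sum_i `|y 0 i - x 0 i|.
  move=> xy.
  apply: (@ball_steps (fun z => `|f z - f x| <= M * \sum_i `|z 0 i - x 0 i|) x d x y) => //.
  - exact: ballxx.
  - by rewrite subrr normr0 mulr_ge0// ?sumr_ge0// ltW.
  move=> w i wi xw xw' IH; set t := y 0 i - x 0 i.
  have Bd : ball x d `<=` U by move=> z /Md[/BU].
  have [z xz E] := MVT_ball Bd (df i) xw xw'.
  rewrite -(subrK (f w) (f _)) -addrA E (le_trans (ler_normD _ _))//.
  rewrite (bigD1 i)//= !mxE !eqxx mulr1 wi addrK mulrDr lerD//.
    by rewrite normrM mulrC ler_wpM2r//; have [_] := Md z xz; exact.
  apply: (le_trans IH); rewrite ler_wpM2l ?(ltW M0)// (bigD1 i)//= wi subrr normr0 add0r.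
  by apply: ler_sum => j ji; rewrite !mxE (negbTE ji) mulr0 add0r.
apply/(@cvgrPdist_le _ _ _ (nbhs x)) => eps eps0.
have N : \forall y \near x, ball x d y /\ forall i, `|y 0 i - x 0 i| <= eps / (M * a.+1%:R).
  apply: filterI; first exact: nbhsx_ballx.
  apply: (@filter_forall _ _ (fun i (y : 'rV[R]_a) => `|y 0 i - x 0 i| <= eps / (M * a.+1%:R)) (nbhs x)) => i.
  have /cvgr_dist_le : (y : 'rV[R]_a) 0 i @[y --> x] --> x 0 i by exact: coord_continuous.
  move=> /(_ (eps / (M * a.+1%:R))); rewrite divr_gt0 ?mulr_gt0//.
  by move=> /(_ isT); apply: filterS => y; rewrite distrC.
apply: (@filterS _ (nbhs x) _ _ _ _ N) => y [xy yx]; rewrite distrC (le_trans (lip y xy))//.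
have -> : eps = M * \sum_(i < a.+1) eps / (M * a.+1%:R).
  rewrite sumr_const card_ord -(mulr_natr (eps / _)); move: (ltr0Sn R a); move: (a.+1%:R) => b b0.
  by field; rewrite !gt_eqF.
rewrite ler_wpM2l ?(ltW M0)// big_ord_recr/= ler_wpDr//.
  by rewrite divr_ge0 ?mulr_ge0 ?(ltW M0) ?(ltW eps0).
by apply: ler_sum.
Qed.

(** Induction along chains of coordinate segments: the points that such chains
    reach form a set which is open and closed in U. *)
Lemma connected_steps U (P : 'rV[R]_a -> Prop) x0 : open U -> connected U ->
    U x0 -> P x0 ->
    (forall z i t, (forall theta : R, 0 <= theta <= 1 -> U ((theta * t) *: e_ i + z)) ->
       P z -> P (t *: e_ i + z)) ->
  forall x, U x -> P x.
Proof.
move=> oU cU Ux0 Px0 step.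
have local x r y z : ball x r `<=` U -> ball x r y -> ball x r z -> P y -> P z.
  move=> BU xy xz Py; apply: (ball_steps xy xz Py) => w i _ xw xw' Pw.
  by apply: step => // theta t01; apply/BU/ball_segment.
pose B := [set x | U x /\ P x].
have -> : U = B; last by move=> x [].
apply/esym/cU; first by exists x0.
- exists B; last by apply/seteqP; split=> x; [case=> Ux Px|case=> _ []].
  rewrite openE => x [Ux Px]; have [r r0 BU] := open_ball oU Ux.
  apply/nbhs_ballP; exists r => //= y xy; split; first exact: BU.
  by apply: (local x r x y) => //; exact: ballxx.
- exists (~` [set x | U x /\ ~ P x]).
    rewrite closedC openE => x [Ux nPx]; have [r r0 BU] := open_ball oU Ux.
    apply/nbhs_ballP; exists r => //= y xy; split; first exact: BU.
    by move=> Py; apply: nPx; apply: (local x r y x) => //; exact: ballxx.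
  apply/seteqP; split=> x /=; first by case=> Ux Px; split => // -[].
  by case=> Ux nP; split=> //; apply: contrapT => nPx; exact: nP.
Qed.

Lemma constant_partials U f : open U -> connected U ->
    (forall i x, U x -> derivable f x (e_ i)) ->
    (forall i x, U x -> partial i f x = 0) ->
  forall x y, U x -> U y -> f x = f y.
Proof.
move=> oU cU df f0 x y Ux Uy; apply/esym.
apply: (connected_steps (P := fun z => f z = f x) oU cU Ux) => // z i t Uz <-.
have [theta t01|theta t01] := @MVT_line f i t z; first exact/df/Uz.
by rewrite f0 ?mulr0; [move/eqP; rewrite subr_eq0 => /eqP|exact: Uz].
Qed.

Lemma eq_at_limit (F G : 'rV[R]_a -> R) x :
    {for x, continuous F} -> {for x, continuous G} ->
    (forall d : R, 0 < d -> exists y z, [/\ ball x d y, ball x d z & F y = G z]) ->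
  F x = G x.
Proof.
move=> cF cG FG; apply/eqP/negPn/negP => ne.
have e0 : 0 < `|F x - G x| / 2 by rewrite divr_gt0// normr_gt0 subr_eq0.
have : \forall y \near x, `|F x - F y| < `|F x - G x| / 2 /\ `|G x - G y| < `|F x - G x| / 2.
  have cF' : F y @[y --> x] --> F x by exact: cF.
  have cG' : G y @[y --> x] --> G x by exact: cG.
  apply: filterI; first by move: cF' => /cvgr_dist_lt/(_ _ e0).
  by move: cG' => /cvgr_dist_lt/(_ _ e0).
move=> /nbhs_ballP[d /= d0 H]; have [y [z [xy xz E]]] := FG d d0.
have [h1 _] := H y xy; have [_ h2] := H z xz.
suff : `|F x - G x| < `|F x - G x| by rewrite ltxx.
rewrite {1}(_ : F x - G x = (F x - F y) - (G x - G z)); last by rewrite E; ring.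
by apply: (le_lt_trans (ler_normB _ _)); lra.
Qed.

(** The mean value theorem in direction i and then in direction j. The same second
    difference with i and j exchanged is a value of the other mixed derivative. *)
Lemma second_difference U f i j x h : smooth U f ->
    (forall s t : R, 0 <= s <= 1 -> 0 <= t <= 1 ->
       U ((s * h) *: e_ i + ((t * h) *: e_ j + x))) ->
  exists s t : R, [/\ 0 <= s <= 1, 0 <= t <= 1 &
    f (h *: e_ i + (h *: e_ j + x)) - f (h *: e_ i + x) - (f (h *: e_ j + x) - f x)
    = h * (h * partial j (partial i f) ((s * h) *: e_ i + ((t * h) *: e_ j + x)))].
Proof.
move=> sf HU; pose G y := f (h *: e_ j + y) - f y.
have z01 : (0 : R) <= (0 : R) <= 1 by rewrite lexx ler01.
have o01 : (0 : R) <= (1 : R) <= 1 by rewrite lexx ler01.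
have U1 (s : R) : 0 <= s <= 1 -> U ((s * h) *: e_ i + x).
  by move=> s01; have := HU s 0 s01 z01; rewrite mul0r scale0r add0r.
have U2 (s : R) : 0 <= s <= 1 -> U (h *: e_ j + ((s * h) *: e_ i + x)).
  by move=> s01; have := HU s 1 s01 o01; rewrite mul1r addrCA.
have lineG z t : f (h *: e_ j + (t *: e_ i + z)) = f (t *: e_ i + (h *: e_ j + z)).
  by rewrite addrCA.
have dshift z : U (h *: e_ j + z) -> derivable (fun y => f (h *: e_ j + y)) z (e_ i).
  move=> Uz; apply: (derivable_line (g := f) (y := h *: e_ j + z) (w := e_ i)) => //.
  exact: smooth_derivable sf Uz.
have dG (s : R) : 0 <= s <= 1 -> derivable G ((s * h) *: e_ i + x) (e_ i) /\
    partial i G ((s * h) *: e_ i + x) =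
    partial i f (h *: e_ j + ((s * h) *: e_ i + x)) - partial i f ((s * h) *: e_ i + x).
  move=> s01; have d2 := smooth_derivable (i := i) sf (U1 s s01); have d1 := dshift _ (U2 s s01).
  split; first exact: derivableB.
  have E1 : partial i (fun y => f (h *: e_ j + y)) ((s * h) *: e_ i + x) =
      partial i f (h *: e_ j + ((s * h) *: e_ i + x)).
    by apply: partial_line => t; exact: lineG.
  by rewrite (partialB d1 d2) E1.
have [s s01|s s01 E] := @MVT_line G i h x; first by have [] := dG s s01.
have [t t01|t t01 E'] := @MVT_line (partial i f) j h ((s * h) *: e_ i + x).
  rewrite addrCA; apply: (smooth_derivable (i := j) (smooth_partial i sf)); exact: HU.
exists s, t; split=> //; rewrite (addrCA ((s * h) *: _)) -E'.
have [_ <-] := dG s s01; rewrite -E /G addrCA; ring.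
Qed.

(** Schwarz: over arbitrarily small squares at x both mixed derivatives take a
    value equal to the same second difference quotient. *)
Lemma partialC U f i j x : open U -> U x -> smooth U f ->
  partial i (partial j f) x = partial j (partial i f) x.
Proof.
move=> oU Ux sf.
have cij k l : {for x, continuous (partial k (partial l f))}.
  exact/(smooth_continuous _ Ux)/smooth_partial/smooth_partial.
apply: eq_at_limit => // d d0; have [r r0 BU] := open_ball oU Ux.
pose C := `|e_ i : 'rV[R]_a| + `|e_ j : 'rV[R]_a| + 1.
have C0 : 0 < C by rewrite ltr_wpDl// addr_ge0.
pose m := Num.min d r; have m0 : 0 < m by rewrite lt_min d0.
have [h h0 hC] : exists2 h : R, 0 < h & h * C < m.
  exists (m / (2 * C)); first by rewrite divr_gt0// mulr_gt0.
  rewrite (_ : m / (2 * C) * C = m / 2); last by rewrite invfM mulrA mulfVK ?gt_eqF.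
  by rewrite gtr_pMr// invf_lt1// ltr1n.
have near_x (s t : R) : 0 <= s <= 1 -> 0 <= t <= 1 ->
    ball x m ((s * h) *: e_ i + ((t * h) *: e_ j + x)).
  move=> /andP[s0 s1] /andP[t0 t1]; rewrite -ball_normE/=.
  rewrite addrA opprD addrCA subrr addr0 normrN.
  apply: (le_lt_trans (ler_normD _ _)); rewrite !normrZ.
  rewrite !ger0_norm ?mulr_ge0 ?(ltW h0)//.
  apply: le_lt_trans hC.
  rewrite /C !mulrDr; have := normr_ge0 (e_ i : 'rV[R]_a); have := normr_ge0 (e_ j : 'rV[R]_a).
  set p := `|_|; set q := `|_| => p0 q0.
  have : s * h * q <= h * q by rewrite ler_wpM2r// ler_piMl// ltW.
  have : t * h * p <= h * p by rewrite ler_wpM2r// ler_piMl// ltW.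
  by move=> h1 h2; rewrite mulr1 ler_wpDr ?(ltW h0)// lerD.
have inU (s t : R) : 0 <= s <= 1 -> 0 <= t <= 1 -> U ((s * h) *: e_ i + ((t * h) *: e_ j + x)).
  move=> s01 t01; apply: BU; apply: le_ball (near_x s t s01 t01).
  by rewrite ge_min lexx orbT.
have md : m <= d by rewrite ge_min lexx.
have [s [t [s01 t01 E]]] := second_difference sf inU.
have [t' [s' [t01' s01' E']]] := @second_difference U f j i x h sf
  (fun s t s01 t01 => eq_ind _ U (inU t s t01 s01) _ (addrCA _ _ _)).
exists ((s' * h) *: e_ i + ((t' * h) *: e_ j + x)).
exists ((s * h) *: e_ i + ((t * h) *: e_ j + x)).
split; [exact: le_ball md _ (near_x _ _ s01' t01')|exact: le_ball md _ (near_x _ _ s01 t01)|].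
apply: (mulfI (lt0r_neq0 h0)); apply: (mulfI (lt0r_neq0 h0)).
have sw (p q u v : R) : p - q - (u - v) = p - u - (q - v) by ring.
apply: etrans E; rewrite (addrCA ((s' * h) *: e_ i)); apply: (etrans (esym E')).
rewrite (addrCA (h *: e_ j)); exact: sw.
Qed.

End CoordinatePaths.

(** * Joint smoothness on product domains *)

Section ProductDomains.
Context {R : realType}.

Local Notation e_ i := (delta_mx 0 i).

Lemma continuous_rV (T : topologicalType) b (A : T -> 'rV[R]_b) x :
  (forall j, {for x, continuous (fun y => A y 0 j)}) -> {for x, continuous A}.
Proof.
move=> cA; rewrite /prop_for /continuous_at; apply/cvg_ballP => eps eps0.
have N : \forall y \near x, forall j, ball (A x 0 j) eps (A y 0 j).
  apply: (@filter_forall _ _ (fun j y => ball (A x 0 j) eps (A y 0 j)) (nbhs x)) => j.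
  have : A y 0 j @[y --> x] --> A x 0 j by exact: cA.
  by move=> /cvg_ballP/(_ eps eps0).
apply: (@filterS _ (nbhs x) _ _ _ _ N) => y Ay; split=> // i j.
by rewrite (ord1 i); exact: Ay.
Qed.

Section Maps.
Context {a b : nat}.
Implicit Types (x : 'rV[R]_a) (u : 'rV[R]_b) (z : 'rV[R]_(a + b)).

Lemma lsubmx_lshift i t z :
  lsubmx (t *: e_ (lshift b i) + z) = t *: e_ i + lsubmx z :> 'rV[R]_a.
Proof. by apply/rowP => j; rewrite !mxE (inj_eq (@lshift_inj _ _)). Qed.

Lemma lsubmx_rshift i t z :
  lsubmx (t *: e_ (rshift a i) + z) = lsubmx z :> 'rV[R]_a.
Proof. by apply/rowP => j; rewrite !mxE eq_lrshift andbF mulr0 add0r. Qed.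

Lemma rsubmx_lshift i t z :
  rsubmx (t *: e_ (lshift b i) + z) = rsubmx z :> 'rV[R]_b.
Proof. by apply/rowP => j; rewrite !mxE eq_rlshift andbF mulr0 add0r. Qed.

Lemma rsubmx_rshift i t z :
  rsubmx (t *: e_ (rshift a i) + z) = t *: e_ i + rsubmx z :> 'rV[R]_b.
Proof. by apply/rowP => j; rewrite !mxE (inj_eq (@rshift_inj _ _)). Qed.

Lemma row_mx_lshift i t x u :
  row_mx (t *: e_ i + x) u = t *: e_ (lshift b i) + row_mx x u.
Proof.
by rewrite -[LHS](hsubmxK) -[RHS]hsubmxK !row_mxKl !row_mxKr lsubmx_lshift
  rsubmx_lshift row_mxKl row_mxKr.
Qed.

Lemma row_mx_rshift i t x u :
  row_mx x (t *: e_ i + u) = t *: e_ (rshift a i) + row_mx x u.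
Proof.
by rewrite -[LHS](hsubmxK) -[RHS]hsubmxK !row_mxKl !row_mxKr lsubmx_rshift
  rsubmx_rshift row_mxKl row_mxKr.
Qed.

Lemma coordinate_map_lsubmx : coordinate_map (@lsubmx R 1 a b).
Proof.
split=> [z|i].
  apply: continuous_rV => j.
  have -> : (fun z => lsubmx z 0 j) = (fun z : 'rV[R]_(a + b) => z 0 (lshift b j)).
    by apply/funext => y; rewrite mxE.
  exact: coord_continuous.
case: (split_ordP i) => j ->; [right; exists j|left] => t z.
  exact: lsubmx_lshift.
exact: lsubmx_rshift.
Qed.

Lemma coordinate_map_rsubmx : coordinate_map (@rsubmx R 1 a b).
Proof.
split=> [z|i].
  apply: continuous_rV => j.
  have -> : (fun z => rsubmx z 0 j) = (fun z : 'rV[R]_(a + b) => z 0 (rshift a j)).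
    by apply/funext => y; rewrite mxE.
  exact: coord_continuous.
case: (split_ordP i) => j ->; [left|right; exists j] => t z.
  exact: rsubmx_lshift.
exact: rsubmx_rshift.
Qed.

Lemma coordinate_map_row_mxl u : coordinate_map (fun x : 'rV[R]_a => row_mx x u).
Proof.
split=> [x|i]; last by right; exists (lshift b i) => t x; exact: row_mx_lshift.
apply: continuous_rV => j; case: (split_ordP j) => k ->.
  have -> : (fun x => row_mx x u 0 (lshift b k)) = (fun x : 'rV[R]_a => x 0 k).
    by apply/funext => y; rewrite row_mxEl.
  exact: coord_continuous.
have -> : (fun x => row_mx x u 0 (rshift a k)) = (fun x : 'rV[R]_a => u 0 k).
  by apply/funext => y; rewrite row_mxEr.
exact: cst_continuous.
Qed.

Lemma coordinate_map_row_mxr x : coordinate_map (fun u : 'rV[R]_b => row_mx x u).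
Proof.
split=> [u|i]; last by right; exists (rshift a i) => t u; exact: row_mx_rshift.
apply: continuous_rV => j; case: (split_ordP j) => k ->.
  have -> : (fun u => row_mx x u 0 (lshift b k)) = (fun u : 'rV[R]_b => x 0 k).
    by apply/funext => y; rewrite row_mxEl.
  exact: cst_continuous.
have -> : (fun u => row_mx x u 0 (rshift a k)) = (fun u : 'rV[R]_b => u 0 k).
  by apply/funext => y; rewrite row_mxEr.
exact: coord_continuous.
Qed.

End Maps.

Definition product_domain {a b} (U : set 'rV[R]_a) (W : set 'rV[R]_b) :=
  [set z : 'rV[R]_(a + b) | U (lsubmx z) /\ W (rsubmx z)].

Section Smooth2.
Context {a b : nat} (U : set 'rV[R]_a) (W : set 'rV[R]_b).
Hypotheses (oU : open U) (oW : open W).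
Implicit Types (x : 'rV[R]_a) (u : 'rV[R]_b) (F : 'rV[R]_a -> 'rV[R]_b -> R).

Lemma open_product_domain : open (product_domain U W).
Proof.
have [cl _] := @coordinate_map_lsubmx a b; have [cr _] := @coordinate_map_rsubmx a b.
have -> : product_domain U W = lsubmx @^-1` U `&` rsubmx @^-1` W by [].
apply: openI.
  by apply: open_comp => // z _; exact: cl.
by apply: open_comp => // z _; exact: cr.
Qed.

Lemma eq_smooth2 F G : (forall x u, U x -> W u -> F x u = G x u) ->
  smooth2 U W F -> smooth2 U W G.
Proof.
move=> FG; apply: eq_smooth; first exact: open_product_domain.
by move=> z; rewrite inE => -[Ux Wu]; exact: FG.
Qed.

Lemma smooth2_slicel F u : smooth2 U W F -> W u -> smooth U (F^~ u).
Proof.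
move=> sF Wu.
have := @smooth_coordinate_map R _ _ _ U _ _ (coordinate_map_row_mxl u) _ sF.
rewrite /comp/=; under eq_fun do rewrite row_mxKl row_mxKr.
by apply=> x Ux; rewrite /= row_mxKl row_mxKr.
Qed.

Lemma smooth2_slicer F x : smooth2 U W F -> U x -> smooth W (F x).
Proof.
move=> sF Ux.
have := @smooth_coordinate_map R _ _ _ W _ _ (coordinate_map_row_mxr x) _ sF.
rewrite /comp/=; under eq_fun do rewrite row_mxKl row_mxKr.
by apply=> u Wu; rewrite /= row_mxKl row_mxKr.
Qed.

Lemma smooth2_fst (f : 'rV[R]_a -> R) : smooth U f -> smooth2 U W (fun x _ => f x).
Proof.
move=> sf; apply: (smooth_coordinate_map coordinate_map_lsubmx _ sf).
by move=> z [].
Qed.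

Lemma smooth2_snd (f : 'rV[R]_b -> R) : smooth W f -> smooth2 U W (fun _ u => f u).
Proof.
move=> sf; apply: (smooth_coordinate_map coordinate_map_rsubmx _ sf).
by move=> z [].
Qed.

Lemma partial_lshift F i (z : 'rV[R]_(a + b)) :
  partial (lshift b i) (fun z => F (lsubmx z) (rsubmx z)) z =
  partial i (F^~ (rsubmx z)) (lsubmx z).
Proof.
by apply: partial_line => t; rewrite lsubmx_lshift rsubmx_lshift.
Qed.

Lemma partial_rshift F i (z : 'rV[R]_(a + b)) :
  partial (rshift a i) (fun z => F (lsubmx z) (rsubmx z)) z =
  partial i (F (lsubmx z)) (rsubmx z).
Proof.
by apply: partial_line => t; rewrite lsubmx_rshift rsubmx_rshift.
Qed.

Lemma smooth2_partiall F i : smooth2 U W F ->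
  smooth2 U W (fun x u => partial i (F^~ u) x).
Proof.
move=> /(smooth_partial (lshift b i)); rewrite /smooth2 => sF.
rewrite (_ : (fun z => _) =
  partial (lshift b i) (fun z : 'rV[R]_(a + b) => F (lsubmx z) (rsubmx z)))//.
by apply/funext => z; rewrite partial_lshift.
Qed.

Lemma smooth2_partialr F i : smooth2 U W F ->
  smooth2 U W (fun x u => partial i (F x) u).
Proof.
move=> /(smooth_partial (rshift a i)); rewrite /smooth2 => sF.
rewrite (_ : (fun z => _) =
  partial (rshift a i) (fun z : 'rV[R]_(a + b) => F (lsubmx z) (rsubmx z)))//.
by apply/funext => z; rewrite partial_rshift.
Qed.

Lemma smooth2_derivablel F i x u : smooth2 U W F -> U x -> W u ->
  derivable (F^~ u) x (e_ i).
Proof. by move=> sF Ux Wu; exact: smooth_derivable (smooth2_slicel sF Wu) Ux. Qed.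

Lemma smooth2_derivabler F i x u : smooth2 U W F -> U x -> W u ->
  derivable (F x) u (e_ i).
Proof. by move=> sF Ux Wu; exact: smooth_derivable (smooth2_slicer sF Ux) Wu. Qed.

Lemma partiallr F i j x u : smooth2 U W F -> U x -> W u ->
  partial i (fun y => partial j (F y) u) x = partial j (fun w => partial i (F^~ w) x) u.
Proof.
move=> sF Ux Wu.
have zD : product_domain U W (row_mx x u) by split; rewrite ?row_mxKl ?row_mxKr.
have := partialC (lshift b i) (rshift a j) open_product_domain zD sF.
have -> : partial (rshift a j) (fun z : 'rV[R]_(a + b) => F (lsubmx z) (rsubmx z)) =
    (fun z => partial j (F (lsubmx z)) (rsubmx z)).
  by apply/funext => z; exact: partial_rshift.
have -> : partial (lshift b i) (fun z : 'rV[R]_(a + b) => F (lsubmx z) (rsubmx z)) =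
    (fun z => partial i (F^~ (rsubmx z)) (lsubmx z)).
  by apply/funext => z; exact: partial_lshift.
rewrite (partial_lshift (fun x u => partial j (F x) u)).
by rewrite (partial_rshift (fun x u => partial i (F^~ u) x)) row_mxKl row_mxKr.
Qed.

(** Joint continuity need not be assumed: it follows from the partial derivatives
    by [continuous_partials]. *)
Lemma smooth2_of_partials F
    (Fl : 'I_a -> 'rV[R]_a -> 'rV[R]_b -> R)
    (Fr : 'I_b -> 'rV[R]_a -> 'rV[R]_b -> R) :
  (forall i, smooth2 U W (Fl i)) -> (forall i, smooth2 U W (Fr i)) ->
  (forall i x u, U x -> W u ->
     derivable (F^~ u) x (e_ i) /\ partial i (F^~ u) x = Fl i x u) ->
  (forall i x u, U x -> W u ->
     derivable (F x) u (e_ i) /\ partial i (F x) u = Fr i x u) ->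
  smooth2 U W F.
Proof.
move=> sl sr dl dr; pose f z := F (lsubmx z) (rsubmx z).
have d i z : product_domain U W z -> derivable f z (e_ i).
  move=> [Ux Wu]; case: (split_ordP i) => j ->.
    apply: (derivable_line (g := F^~ (rsubmx z)) (y := lsubmx z) (w := e_ j)).
      by move=> t; rewrite /f lsubmx_lshift rsubmx_lshift.
    by have [] := dl j _ _ Ux Wu.
  apply: (derivable_line (g := F (lsubmx z)) (y := rsubmx z) (w := e_ j)).
    by move=> t; rewrite /f lsubmx_rshift rsubmx_rshift.
  by have [] := dr j _ _ Ux Wu.
have s i : smooth (product_domain U W) (partial i f).
  case: (split_ordP i) => j ->.
    apply: eq_smooth open_product_domain _ (sl j) => z; rewrite inE => -[Ux Wu].
    by rewrite partial_lshift; have [_ ->] := dl j _ _ Ux Wu.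
  apply: eq_smooth open_product_domain _ (sr j) => z; rewrite inE => -[Ux Wu].
  by rewrite partial_rshift; have [_ ->] := dr j _ _ Ux Wu.
apply: smoothS => [|i]; last by split; [exact: d|exact: s].
apply: continuous_partials open_product_domain d _ => i z zD.
exact: smooth_continuous (s i) zD.
Qed.

End Smooth2.

End ProductDomains.

(** * Integrals along coordinate segments *)

Section SegmentIntegral.
Context {R : realType} {a b : nat} (U : set 'rV[R]_a) (W : set 'rV[R]_b).
Hypotheses (oU : open U) (oW : open W).
Variables (z : 'rV[R]_a) (i : 'I_a) (t : R).

Local Notation e_ i := (delta_mx 0 i).

Let gamma (s : R) : 'rV[R]_a := (s * t) *: e_ i + z.

Hypothesis segU : forall s : R, 0 <= s <= 1 -> U (gamma s).

(** Parametrizing by the unit interval keeps the domain of integration fixed when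
    the length t varies, changes sign or vanishes; t times this average is the line
    integral. *)
Definition segment_integral (f : 'rV[R]_a -> 'rV[R]_b -> R) (u : 'rV[R]_b) : R :=
  \int[lebesgue_measure]_(s in `[0, 1]) f ((s * t) *: e_ i + z) u.

Let continuous_affine (c d : R) : continuous (fun s : R => s * t * c + d).
Proof.
move=> s; apply: cvgD; last exact: cvg_cst.
apply: cvgM; last exact: cvg_cst.
by apply: cvgM; [exact: cvg_id|exact: cvg_cst].
Qed.

Let gammaE s k : gamma s 0 k = s * t * (delta_mx 0 i : 'rV[R]_a) 0 k + z 0 k.
Proof. by rewrite !mxE. Qed.

Lemma continuous_segment : continuous gamma.
Proof.
move=> s; apply: continuous_rV => k.
have -> : (fun s => gamma s 0 k) =
    (fun s => s * t * (delta_mx 0 i : 'rV[R]_a) 0 k + z 0 k).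
  by apply/funext => r; rewrite gammaE.
exact: continuous_affine.
Qed.

Lemma continuous_along_segment f u : smooth2 U W f -> W u ->
  {in `[0, 1]%classic, continuous (fun s => f (gamma s) u)}.
Proof.
move=> sf Wu s; rewrite inE/= in_itv/= => s01.
apply: (@continuous_comp _ _ _ gamma (f^~ u)); first exact: continuous_segment.
exact: (smooth_continuous (smooth2_slicel sf Wu) (segU s01)).
Qed.

Lemma within_segment f u : smooth2 U W f -> W u ->
  {within `[0, 1], continuous (fun s => f (gamma s) u)}.
Proof.
by move=> sf Wu; exact/continuous_in_subspaceT/continuous_along_segment.
Qed.

Lemma segment_integrable f u : smooth2 U W f -> W u ->
  lebesgue_measure.-integrable `[0, 1] (EFin \o (fun s => f (gamma s) u)).
Proof.
move=> sf Wu; apply: continuous_compact_integrable; first exact: segment_compact.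
exact: within_segment.
Qed.

(** Domination for differentiating under the integral, from the compactness of the
    segment times a small interval of the A-th coordinate. *)
Lemma segment_bound f A u : smooth2 U W f -> W u ->
  exists d M : R, [/\ 0 < d, 0 <= M & forall h, -d <= h <= d ->
    W (h *: e_ A + u) /\
    forall s : R, 0 <= s <= 1 -> `|f (gamma s) (h *: e_ A + u)| <= M].
Proof.
move=> sf Wu.
pose delta (h : R) : 'rV[R]_b := h *: e_ A + u.
have cdelta : continuous delta.
  move=> h; apply: continuous_rV => k.
  have -> : (fun h => delta h 0 k) =
      (fun h => h * (delta_mx 0 A : 'rV[R]_b) 0 k + u 0 k).
    by apply/funext => r; rewrite !mxE.
  apply: cvgD; last exact: cvg_cst.
  by apply: cvgM; [exact: cvg_id|exact: cvg_cst].
have [d d0 dW] : exists2 d : R, 0 < d & forall h, -d <= h <= d -> W (delta h).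
  have : \forall h \near (0 : R), W (delta h).
    have Wd : nbhs (delta 0) W.
      by apply: open_nbhs_nbhs; split=> //; rewrite /delta scale0r add0r.
    exact: (cdelta 0 _ Wd).
  move=> /nbhs_ballP[r /= r0 H]; exists (r / 2); first by rewrite divr_gt0.
  move=> h hr; apply: H; rewrite -ball_normE/= sub0r normrN.
  have : `|h| <= r / 2 by rewrite ler_norml.
  by move/le_lt_trans; apply; rewrite gtr_pMr// invf_lt1// ltr1n.
pose m (p : R * R) : 'rV[R]_(a + b) := row_mx (gamma p.1) (delta p.2).
pose K : set (R * R) := `[0, 1] `*` `[- d, d].
have KD p : K p -> product_domain U W (m p).
  move=> [/= h1 h2]; split; rewrite ?row_mxKl ?row_mxKr.
    by apply: segU; move: h1; rewrite in_itv.
  by apply: dW; move: h2; rewrite in_itv.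
have cm : continuous m.
  move=> p; apply: continuous_rV => k; case: (split_ordP k) => l ->.
    have -> : (fun p => m p 0 (lshift b l)) = (fun s => gamma s 0 l) \o fst.
      by apply/funext => q; rewrite row_mxEl.
    apply: (@continuous_comp _ _ _ fst (fun s => gamma s 0 l)); first exact: cvg_fst.
    apply: (@continuous_comp _ _ _ gamma (fun v => v 0 l)); first exact: continuous_segment.
    exact: coord_continuous.
  have -> : (fun p => m p 0 (rshift a l)) = (fun s => delta s 0 l) \o snd.
    by apply/funext => q; rewrite row_mxEr.
  apply: (@continuous_comp _ _ _ snd (fun s => delta s 0 l)); first exact: cvg_snd.
  apply: (@continuous_comp _ _ _ delta (fun v => v 0 l)); first exact: cdelta.
  exact: coord_continuous.
pose g p := `|f (gamma p.1) (delta p.2)|.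
have gE : g = (fun x => `|x|) \o ((fun z : 'rV[R]_(a + b) => f (lsubmx z) (rsubmx z)) \o m).
  by apply/funext => p; rewrite /g/= row_mxKl row_mxKr.
have cg : {within K, continuous g}.
  apply: continuous_in_subspaceT => p; rewrite inE => Kp; rewrite gE.
  apply: (@continuous_comp _ _ _ _ (fun x : R => `|x|)); last exact: norm_continuous.
  apply: (@continuous_comp _ _ _ m); first exact: cm.
  exact: (smooth_continuous sf (KD p Kp)).
have cK : compact K by apply: compact_setX; exact: segment_compact.
have K0 : K (0, 0).
  by split; rewrite /= in_itv/= ?lexx ?ler01 ?oppr_le0 ?(ltW d0).
have [p Kp Mp] := compact_EVT_max (ex_intro _ _ K0) cK cg.
exists d, (g p); split; [exact: d0|exact: normr_ge0|move=> h hd; split; first exact: dW].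
by move=> s s01; apply: (Mp (s, h)); rewrite inE; split; rewrite /= in_itv.
Qed.

Lemma partial_segment_integral f A u : smooth2 U W f -> W u ->
  derivable (segment_integral f) u (e_ A) /\
  partial A (segment_integral f) u =
    segment_integral (fun x w => partial A (f x) w) u.
Proof.
move=> sf Wu.
have [d [M [d0 M0 dM]]] := segment_bound A (smooth2_partialr A sf) Wu.
pose F (h s : R) := f (gamma s) (h *: e_ A + u).
have line (h : R) : segment_integral f (h *: e_ A + u) =
    (fun h => \int[lebesgue_measure]_(s in `[0, 1]) F h s) (h *: (1 : R) + 0).
  have -> : h *: (1 : R) = h by rewrite /GRing.scale/= mulr1.
  by rewrite addr0.
have Ih (h : R) : `]-d, d[%classic h -> W (h *: e_ A + u).
  by rewrite /= in_itv/= => /andP[/ltW h1 /ltW h2]; have [] := dM h; rewrite ?h1 ?h2.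
have I0 : `]-d, d[%classic 0 by rewrite /= in_itv/= oppr_lt0 d0.
have shiftF (h s r : R) : F (r *: (1 : R) + h) s = f (gamma s) (r *: e_ A + (h *: e_ A + u)).
  have -> : r *: (1 : R) = r by rewrite /GRing.scale/= mulr1.
  by rewrite /F scalerDl addrA.
have intF (h : R) : `]-d, d[%classic h ->
    lebesgue_measure.-integrable `[0, 1] (EFin \o F h).
  by move=> /Ih Wh; exact: segment_integrable.
have dF (h s : R) : `]-d, d[%classic h -> `[0, 1]%classic s -> derivable (F^~ s) h 1.
  move=> /Ih Wh; rewrite /= in_itv/= => s01; apply: (derivable_line (shiftF h s)).
  exact: smooth2_derivabler sf (segU s01) Wh.
have dFE (h s : R) : partial1of2 F h s = partial A (f (gamma s)) (h *: e_ A + u).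
  by rewrite partial1of2E; exact: derive_line (shiftF h s).
have bF (h s : R) : `]-d, d[%classic h -> `[0, 1]%classic s ->
    `|partial1of2 F h s| <= M.
  rewrite /= !in_itv/= => /andP[/ltW h1 /ltW h2] s01; rewrite dFE.
  by have [|_] := dM h; [rewrite h1 h2|exact].
have iM : lebesgue_measure.-integrable `[0, 1] (EFin \o (fun _ : R => M)).
  apply: continuous_compact_integrable; first exact: segment_compact.
  by apply: continuous_subspaceT; exact: cst_continuous.
have mI : measurable (`[0, 1]%classic : set (measurableTypeR R)) by exact: measurable_itv.
split.
  apply: (derivable_line line).
  exact (@derivable_under_integral R _ (measurableTypeR R) lebesgue_measure F _ mI 0 (- d) d I0 intF dF
    (fun=> M) (fun=> M0) iM bF).
have := differentiation_under_integral mI I0 intF dF (fun=> M0) iM bF.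
rewrite derive1E => E; apply: etrans (derive_line line) _; apply: (etrans E).
rewrite /segment_integral; apply: eq_Rintegral => s _.
by rewrite dFE scale0r add0r.
Qed.

Lemma segment_integral_partial f u : smooth2 U W f -> W u ->
  segment_integral (fun x w => t * partial i (f^~ w) x) u =
  f (t *: e_ i + z) u - f z u.
Proof.
move=> sf Wu; have sfu := smooth2_slicel sf Wu.
pose F s := f (gamma s) u; pose dF s := t * partial i (f^~ u) (gamma s).
have der (s : R) (s01 : 0 <= s <= 1) : is_derive s 1 F (dF s).
  exact/is_derive_segment/(smooth_derivable _ (segU s01)).
have cF (s : R) (s01 : 0 <= s <= 1) : {for s, continuous F}.
  apply/differentiable_continuous/derivable1_diffP.
  exact: (@ex_derive _ _ _ _ _ _ _ (der s s01)).
have z01 : (0 : R) <= (0 : R) <= 1 by rewrite lexx ler01.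
have o01 : (0 : R) <= (1 : R) <= 1 by rewrite lexx ler01.
have cdF : {within `[0, 1], continuous dF}.
  apply: (@within_segment (fun x w => t * partial i (f^~ w) x) u _ Wu).
  apply: smoothZ; first exact: open_product_domain.
  exact: smooth2_partiall.
have D : derivable_oo_LRcontinuous F 0 1.
  split.
  - move=> s; rewrite in_itv/= => /andP[/ltW s0 /ltW s1].
    apply: (@ex_derive _ _ _ _ _ _ _ (der s _)); by rewrite s0 s1.
  - by apply: cvg_at_right_filter; exact: cF.
  - by apply: cvg_at_left_filter; exact: cF.
have FE : {in `]0, 1[, F^`()%classic =1 dF}.
  move=> s; rewrite in_itv/= => /andP[/ltW s0 /ltW s1].
  rewrite derive1E; apply: (@derive_val _ _ _ _ _ _ _ (der s _)); by rewrite s0 s1.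
have := continuous_FTC2 ltr01 cdF D FE.
rewrite /segment_integral /Rintegral => -> /=.
by rewrite /F /gamma mul1r mul0r scale0r add0r.
Qed.

End SegmentIntegral.

(** * Potentials of mixed closed one-forms *)

Section Potential.
Context {R : realType} {a b : nat} (U : set 'rV[R]_a) (W : set 'rV[R]_b).
Hypotheses (oU : open U) (oW : open W).

Local Notation e_ i := (delta_mx 0 i).

(** Differences of these averages are the difference quotients of the potential
    constructed below. *)
Lemma cvg_segment_integral f z i u : smooth2 U W f -> U z -> W u ->
  segment_integral z i h f u @[h --> (0 : R)] --> f z u.
Proof.
move=> sf Uz Wu; apply/cvgrPdist_le => eps eps0.
have [r r0 BU] := open_ball oU Uz.
have N0 : \forall y \near z, `|f z u - f y u| <= eps.
  have : f y u @[y --> z] --> f z u.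
    exact: (smooth_continuous (smooth2_slicel sf Wu) Uz).
  by move=> /cvgr_dist_le/(_ _ eps0).
have /nbhs_ballP[d /= d0 Hd] : nbhs z (ball z r `&` [set y | `|f z u - f y u| <= eps]).
  by apply: filterI => //; exact: nbhsx_ballx.
pose C := `|e_ i : 'rV[R]_a| + 1; have C0 : 0 < C by rewrite ltr_wpDl.
apply/nbhs_ballP; exists (d / C); first by rewrite /= divr_gt0.
move=> h; rewrite /ball_/= sub0r normrN => hd.
have seg (s : R) : 0 <= s <= 1 -> ball z d ((s * h) *: e_ i + z).
  move=> /andP[s0 s1]; rewrite -ball_normE/= opprD addrCA subrr addr0 normrN.
  rewrite normrZ normrM (ger0_norm s0).
  apply: (@le_lt_trans _ _ (`|h| * C)); last by rewrite -ltr_pdivlMr.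
  rewrite ler_pM ?mulr_ge0//; first by rewrite ler_piMl.
  by rewrite /C lerDl.
have segU (s : R) : 0 <= s <= 1 -> U ((s * h) *: e_ i + z).
  by move=> /seg/Hd[/BU].
have mI : measurable (`[0, 1]%classic : set (measurableTypeR R)) by exact: measurable_itv.
have int_cst (c : R) : lebesgue_measure.-integrable `[0, 1] (EFin \o (fun _ : R => c)).
  apply: continuous_compact_integrable; first exact: segment_compact.
  by apply: continuous_subspaceT; exact: cst_continuous.
have cstE (c : R) : \int[lebesgue_measure]_(s in `[0, 1]) c = c.
  rewrite Rintegral_cst// -[RHS]mulr1; congr (_ * _).
  apply: (@etrans _ _ (fine (1%E : \bar R))) => //; congr fine.
  apply: etrans (lebesgue_measure_itv `[(0 : R), 1]) _.
  by rewrite /= lte_fin ltr01 oppr0 adde0.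
have cdiff : {in `[0, 1]%classic, continuous (fun s : R => f z u - f ((s * h) *: e_ i + z) u)}.
  move=> s s01; apply: cvgB; first exact: cvg_cst.
  exact: (continuous_along_segment segU sf Wu).
have iF := segment_integrable segU sf Wu.
rewrite -{1}(cstE (f z u)) -(RintegralB mI (int_cst _) iF).
apply: (le_trans (le_normr_Rintegral mI _)).
  apply: continuous_compact_integrable; first exact: segment_compact.
  by apply: continuous_in_subspaceT => s s01; exact: cdiff.
rewrite -[leRHS]cstE; apply: le_Rintegral => //.
  apply: continuous_compact_integrable; first exact: segment_compact.
  apply: continuous_in_subspaceT => s s01.
  by apply: cvg_norm; exact: cdiff.
by move=> s; rewrite /= in_itv/= => /seg/Hd[].
Qed.

Hypotheses (cU : connected U) (cW : connected W).
Variables (beta : 'I_a -> 'rV[R]_a -> 'rV[R]_b -> R).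
Variables (theta : 'I_b -> 'rV[R]_a -> 'rV[R]_b -> R).
Hypotheses (sbeta : forall j, smooth2 U W (beta j)).
Hypotheses (stheta : forall A, smooth2 U W (theta A)).
Hypothesis closed_mixed : forall j A x u, U x -> W u ->
  partial j ((theta A)^~ u) x = partial A (beta j x) u.
Variables (x0 : 'rV[R]_a) (u0 : 'rV[R]_b).
Hypotheses (Ux0 : U x0) (Wu0 : W u0).

Let primitive x (f : 'rV[R]_b -> R) := forall A u, W u ->
  derivable f u (e_ A) /\ partial A f u = theta A x u - theta A x0 u.

Let jump z i t u := segment_integral z i t (fun x w => t * beta i x w) u.

Let partial_jump z i t A u :
    (forall s : R, 0 <= s <= 1 -> U ((s * t) *: e_ i + z)) -> W u ->
  derivable (jump z i t) u (e_ A) /\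
  partial A (jump z i t) u = theta A (t *: e_ i + z) u - theta A z u.
Proof.
move=> segU Wu; have oD := open_product_domain oU oW.
have sb : smooth2 U W (fun x w => t * beta i x w) by apply: smoothZ => //; exact: sbeta.
have [dJ ->] := partial_segment_integral oW segU A sb Wu; split => //.
rewrite -(segment_integral_partial oU oW segU (stheta A) Wu).
apply: eq_Rintegral => s; rewrite inE/= in_itv/= => s01.
rewrite partialZ ?closed_mixed//; first exact: segU.
by apply: smooth2_derivabler (sbeta i) _ _ => //; exact: segU.
Qed.

Let primitive_step z i t : (forall s : R, 0 <= s <= 1 -> U ((s * t) *: e_ i + z)) ->
  (exists f, primitive z f) -> exists f, primitive (t *: e_ i + z) f.
Proof.
move=> segU [f pf]; exists (fun u => f u + jump z i t u) => A u Wu.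
have [df fE] := pf A u Wu; have [dj jE] := partial_jump A segU Wu.
split; first exact: derivableD.
by rewrite partialD// fE jE; ring.
Qed.

(** The one-form with components theta A x u - theta A x0 u in the u-directions
    and beta j x u - beta j x u0 in the x-directions is closed if its mixed
    derivatives agree, and it is exact although neither U nor W need be simply
    connected: it vanishes on both slices through the base point.  Exactness on
    a slice propagates from x0 along coordinate segments, because the integral of
    beta along such a segment is a potential of the change of theta. *)
Lemma exists_potential : exists K : 'rV[R]_a -> 'rV[R]_b -> R,
  [/\ smooth2 U W K,
      forall A x u, U x -> W u -> partial A (K x) u = theta A x u - theta A x0 u
    & forall j x u, U x -> W u -> partial j (K^~ u) x = beta j x u - beta j x u0].
Proof.
have prim x : exists f, U x -> primitive x f.
  have [Ux|nUx] := pselect (U x); last by exists (fun=> 0).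
  suff [f pf] : exists f, primitive x f by exists f.
  apply: (connected_steps (P := fun x => exists f, primitive x f) oU cU Ux0 _ primitive_step) => //.
  exists (fun=> 0) => A u Wu; split; first exact: derivable_cst.
  by rewrite partial_cst subrr.
have [P HP] := choice prim.
pose K x u := P x u - P x u0.
have dK A x u : U x -> W u -> derivable (K x) u (e_ A) /\
    partial A (K x) u = theta A x u - theta A x0 u.
  move=> Ux Wu; have [dP PE] := HP x Ux A u Wu.
  split; first by apply: derivableB => //; exact: derivable_cst.
  by rewrite partialB// ?partial_cst ?subr0//; exact: derivable_cst.
have Kjump z i t u : U z -> (forall s : R, 0 <= s <= 1 -> U ((s * t) *: e_ i + z)) ->
    W u -> K (t *: e_ i + z) u - K z u = jump z i t u - jump z i t u0.
  move=> Uz segU Wu.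
  have Ut : U (t *: e_ i + z) by have := segU 1; rewrite mul1r lexx ler01 => /(_ isT).
  have : K (t *: e_ i + z) u - K z u - jump z i t u =
         K (t *: e_ i + z) u0 - K z u0 - jump z i t u0.
    have dJ A w : W w -> derivable (fun w => K (t *: e_ i + z) w - K z w - jump z i t w) w (e_ A) /\
        partial A (fun w => K (t *: e_ i + z) w - K z w - jump z i t w) w = 0.
      move=> Ww; have [d1 E1] := dK A _ _ Ut Ww; have [d2 E2] := dK A _ _ Uz Ww.
      have [d3 E3] := partial_jump A segU Ww.
      have d12 : derivable (fun w => K (t *: e_ i + z) w - K z w) w (e_ A).
        exact: derivableB.
      split; first exact: derivableB.
      by rewrite (partialB d12 d3) (partialB d1 d2) E1 E2 E3; ring.
    apply: (@constant_partials _ _ W (fun w => K (t *: e_ i + z) w - K z w - jump z i t w)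
      oW cW _ _ u u0 Wu Wu0) => A w Ww; first by have [] := dJ A w Ww.
    by have [] := dJ A w Ww.
  have K0 y : K y u0 = 0 by rewrite /K subrr.
  by rewrite !K0 subrr sub0r => /(canRL (subrK _)) ->; rewrite addrC.
have dx j x u : U x -> W u -> derivable (K^~ u) x (e_ j) /\
    partial j (K^~ u) x = beta j x u - beta j x u0.
  move=> Ux Wu; pose avg h w := segment_integral x j h (beta j) w.
  have cavg : avg h u - avg h u0 @[h --> (0 : R)] --> beta j x u - beta j x u0.
    by apply: cvgB; exact: cvg_segment_integral.
  have segU : \forall h \near (0 : R), forall s : R, 0 <= s <= 1 -> U ((s * h) *: e_ j + x).
    have [r r0 BU] := open_ball oU Ux.
    have cl : (h *: e_ j + x) @[h --> (0 : R)] --> x.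
      have := @continuous_segment R a x j 1 0.
      rewrite /continuous_at/= mul0r scale0r add0r.
      by under eq_fun do rewrite mulr1.
    have N : \forall h \near (0 : R), ball x r (h *: e_ j + x).
      exact: (cl _ (nbhsx_ballx x r r0)).
    apply: (@filterS _ (nbhs (0 : R)) _ _ _ _ N) => h xh s s01.
    by apply: BU; apply: ball_segment => //; exact: ballxx.
  have cvgK : h^-1 *: (K (h *: e_ j + x) u - K x u) @[h --> 0^'] -->
      beta j x u - beta j x u0.
    have cavg' : avg h u - avg h u0 @[h --> (0 : R)^'] --> beta j x u - beta j x u0.
      apply: cvg_trans cavg; apply: cvg_app; exact: cvg_within.
    apply: cvg_trans cavg'; apply: near_eq_cvg.
    rewrite near_withinE; near=> h => h0.
    have sU : forall s : R, 0 <= s <= 1 -> U ((s * h) *: e_ j + x) by near: h.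
    rewrite (Kjump x j h u)// /jump /avg /segment_integral.
    have mI : measurable (`[0, 1]%classic : set (measurableTypeR R)) by exact: measurable_itv.
    have iu w (Ww : W w) := segment_integrable sU (sbeta j) Ww.
    rewrite (RintegralZl h mI (iu u Wu)) (RintegralZl h mI (iu u0 Wu0)).
    by rewrite -mulrBr /GRing.scale/= mulrA mulVf ?mul1r.
  split; first by apply/cvg_ex; exists (beta j x u - beta j x u0).
  exact/cvg_lim.
exists K; split.
- apply: (@smooth2_of_partials _ _ _ U W oU oW K
    (fun j x u => beta j x u - beta j x u0) (fun A x u => theta A x u - theta A x0 u)) => //.
  + move=> j; apply: smoothB; [exact: open_product_domain|exact: sbeta|].
    apply: (@smooth2_fst _ _ _ U W (fun x => beta j x u0)); exact: smooth2_slicel (sbeta j) Wu0.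
  + move=> A; apply: smoothB; [exact: open_product_domain|exact: stheta|].
    apply: (@smooth2_snd _ _ _ U W (theta A x0)); exact: smooth2_slicer (stheta A) Ux0.
- by move=> A x u Ux Wu; have [] := dK A x u Ux Wu.
- by move=> j x u Ux Wu; have [] := dx j x u Ux Wu.
Unshelve. all: by end_near. Qed.

End Potential.

(** * Vector fields and the second jet space *)

Section VectorFields.
Context {R : realType} {a : nat} (U : set 'rV[R]_a).
Hypothesis oU : open U.
Implicit Types (V X : 'rV[R]_a -> 'rV[R]_a) (f h : 'rV[R]_a -> R).

Lemma smooth_along V f : vsmooth U V -> smooth U f -> smooth U (along V f).
Proof.
move=> sV sf; apply: smooth_sum => // k; apply: smoothM => //.
exact: smooth_partial.
Qed.

Lemma alongD V f h z : smooth U f -> smooth U h -> U z ->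
  along V (fun y => f y + h y) z = along V f z + along V h z.
Proof.
move=> sf sh Uz; rewrite /along -big_split; apply: eq_bigr => k _ /=.
by rewrite partialD ?mulrDr//; exact: smooth_derivable Uz.
Qed.

Lemma alongB V f h z : smooth U f -> smooth U h -> U z ->
  along V (fun y => f y - h y) z = along V f z - along V h z.
Proof.
move=> sf sh Uz; rewrite /along -sumrB; apply: eq_bigr => k _ /=.
by rewrite partialB ?mulrBr//; exact: smooth_derivable Uz.
Qed.

Lemma alongM V f h z : smooth U f -> smooth U h -> U z ->
  along V (fun y => f y * h y) z = along V f z * h z + f z * along V h z.
Proof.
move=> sf sh Uz; rewrite /along mulr_suml mulr_sumr -big_split.
apply: eq_bigr => k _ /=; rewrite partialM; first by ring.
- exact: smooth_derivable sf Uz.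
- exact: smooth_derivable sh Uz.
Qed.

Lemma along_sum V I (r : seq I) (P : pred I) (F : I -> 'rV[R]_a -> R) z :
  (forall i, smooth U (F i)) -> U z ->
  along V (fun y => \sum_(i <- r | P i) F i y) z = \sum_(i <- r | P i) along V (F i) z.
Proof.
move=> sF Uz; rewrite /along exchange_big/=; apply: eq_bigr => k _.
by rewrite partial_sum ?mulr_sumr// => i; exact: smooth_derivable Uz.
Qed.

Lemma along_cst V c z : along V (fun=> c) z = 0.
Proof. by rewrite /along big1// => k _; rewrite partial_cst mulr0. Qed.

Lemma along_coord V k z : along V (fun y => y 0 k) z = V z 0 k.
Proof.
rewrite /along (bigD1 k)//= partial_coord eqxx mulr1 big1 ?addr0// => j jk.
by rewrite partial_coord eq_sym (negbTE jk) mulr0.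
Qed.

Lemma eq_along V f h z : U z -> {in U, f =1 h} -> along V f z = along V h z.
Proof.
by move=> Uz fh; apply: eq_bigr => k _; rewrite (open_eq_partial k oU Uz fh).
Qed.

Lemma partial_along V f k z : vsmooth U V -> smooth U f -> U z ->
  partial k (along V f) z =
  along V (partial k f) z + \sum_j partial k (fun y => V y 0 j) z * partial j f z.
Proof.
move=> sV sf Uz; rewrite partial_sum; last first.
  move=> j; apply: (smooth_derivable (U := U)) Uz; apply: smoothM => //.
  exact: smooth_partial.
rewrite /along -big_split/=; apply: eq_bigr => j _.
rewrite partialM; first by rewrite (partialC k j oU Uz sf) addrC.
- exact: smooth_derivable (sV j) Uz.
- exact: smooth_derivable (smooth_partial j sf) Uz.
Qed.

(** The second derivatives of f cancel, so the commutator is again a first order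
    operator. *)
Lemma along_commutator V X f z : vsmooth U V -> vsmooth U X -> smooth U f -> U z ->
  along V (along X f) z = along X (along V f) z +
    \sum_k (along V (fun y => X y 0 k) z - along X (fun y => V y 0 k) z) * partial k f z.
Proof.
move=> sV sX sf Uz.
have L A B : vsmooth U B -> along A (along B f) z =
    \sum_j A z 0 j * along B (partial j f) z +
    \sum_k along A (fun y => B y 0 k) z * partial k f z.
  move=> sB; rewrite -[LHS]/(\sum_j A z 0 j * partial j (along B f) z).
  under eq_bigr do rewrite partial_along// mulrDr.
  rewrite big_split/=; congr (_ + _).
  under eq_bigr do rewrite mulr_sumr; rewrite exchange_big/=; apply: eq_bigr => k _.
  by rewrite /along mulr_suml; apply: eq_bigr => j _; rewrite mulrA.
rewrite (L _ _ sX) (L _ _ sV) -addrA; congr (_ + _).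
  rewrite /along; under eq_bigr do rewrite mulr_sumr.
  rewrite exchange_big/=; apply: eq_bigr => k _; rewrite mulr_sumr.
  by apply: eq_bigr => j _; rewrite mulrCA (partialC j k oU Uz sf).
rewrite -big_split/=; apply: eq_bigr => k _; ring.
Qed.

End VectorFields.

Lemma sum_mxvec_index (R : nmodType) a b (G : 'I_(a * b) -> R) :
  \sum_k G k = \sum_i \sum_j G (mxvec_index i j).
Proof.
rewrite pair_big/=; rewrite (reindex (uncurry (@mxvec_index a b)))/=.
  by apply: eq_bigr => -[i j] _.
exact: curry_mxvec_bij.
Qed.

Section JetSpace.
Context {R : realType} {n m : nat}.

Local Notation J := 'rV[R]_((n + m) + (n * m + n * n * m)).
Local Notation fun0 := ('rV[R]_n -> 'rV[R]_m -> R).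
Local Notation fun1 := ('rV[R]_n -> 'rV[R]_m -> 'M[R]_(n, m) -> R).
Local Notation fun2 :=
  ('rV[R]_n -> 'rV[R]_m -> 'M[R]_(n, m) -> 'M[R]_(n * n, m) -> R).
Implicit Types z : J.

Definition jetx z : 'rV[R]_n := lsubmx (lsubmx z).
Definition jetu z : 'rV[R]_m := rsubmx (lsubmx z).
Definition jetp z : 'M[R]_(n, m) := vec_mx (lsubmx (rsubmx z)).
Definition jetq z : 'M[R]_(n * n, m) := vec_mx (rsubmx (rsubmx z)).

(** Flattening second jets into one row vector turns total derivatives and
    prolongations into vector fields, to which [along_commutator] applies. *)
Definition jet x u p q : J := row_mx (row_mx x u) (row_mx (mxvec p) (mxvec q)).

Definition idx_x (i : 'I_n) : 'I_((n + m) + (n * m + n * n * m)) :=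
  lshift _ (lshift _ i).
Definition idx_u (A : 'I_m) : 'I_((n + m) + (n * m + n * n * m)) :=
  lshift _ (rshift _ A).
Definition idx_p (i : 'I_n) (A : 'I_m) : 'I_((n + m) + (n * m + n * n * m)) :=
  rshift _ (lshift _ (mxvec_index i A)).
Definition idx_q (k : 'I_(n * n)) (A : 'I_m) : 'I_((n + m) + (n * m + n * n * m)) :=
  rshift _ (rshift _ (mxvec_index k A)).

Lemma jetxE x u p q : jetx (jet x u p q) = x.
Proof. by rewrite /jetx /jet !row_mxKl. Qed.
Lemma jetuE x u p q : jetu (jet x u p q) = u.
Proof. by rewrite /jetu /jet row_mxKl row_mxKr. Qed.
Lemma jetpE x u p q : jetp (jet x u p q) = p.
Proof. by rewrite /jetp /jet row_mxKr row_mxKl mxvecK. Qed.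
Lemma jetqE x u p q : jetq (jet x u p q) = q.
Proof. by rewrite /jetq /jet !row_mxKr mxvecK. Qed.

Lemma jetp_coord z i A : jetp z i A = z 0 (idx_p i A).
Proof. by rewrite !mxE. Qed.
Lemma jetq_coord z k A : jetq z k A = z 0 (idx_q k A).
Proof. by rewrite !mxE. Qed.

Definition pull0 (f : fun0) z := f (jetx z) (jetu z).
Definition pull1 (f : fun1) z := f (jetx z) (jetu z) (jetp z).
Definition pull2 (f : fun2) z := f (jetx z) (jetu z) (jetp z) (jetq z).

Local Notation e_ i := (delta_mx 0 i).

Lemma vec_mx_line a b t (i : 'I_a) (j : 'I_b) (v : 'rV[R]_(a * b)) :
  vec_mx (t *: e_ (mxvec_index i j) + v) = t *: delta_mx i j + vec_mx v.
Proof. by rewrite linearD linearZ/= vec_mx_delta. Qed.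

Lemma line_x i t z : [/\ jetx (t *: e_ (idx_x i) + z) = t *: e_ i + jetx z,
  jetu (t *: e_ (idx_x i) + z) = jetu z, jetp (t *: e_ (idx_x i) + z) = jetp z &
  jetq (t *: e_ (idx_x i) + z) = jetq z].
Proof.
split; rewrite /jetx /jetu /jetp /jetq /idx_x.
- by rewrite lsubmx_lshift lsubmx_lshift.
- by rewrite lsubmx_lshift rsubmx_lshift.
- by rewrite rsubmx_lshift.
- by rewrite rsubmx_lshift.
Qed.

Lemma line_u i t z : [/\ jetx (t *: e_ (idx_u i) + z) = jetx z,
  jetu (t *: e_ (idx_u i) + z) = t *: e_ i + jetu z,
  jetp (t *: e_ (idx_u i) + z) = jetp z & jetq (t *: e_ (idx_u i) + z) = jetq z].
Proof.
split; rewrite /jetx /jetu /jetp /jetq /idx_u.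
- by rewrite lsubmx_lshift lsubmx_rshift.
- by rewrite lsubmx_lshift rsubmx_rshift.
- by rewrite rsubmx_lshift.
- by rewrite rsubmx_lshift.
Qed.

Lemma line_p i A t z : [/\ jetx (t *: e_ (idx_p i A) + z) = jetx z,
  jetu (t *: e_ (idx_p i A) + z) = jetu z,
  jetp (t *: e_ (idx_p i A) + z) = t *: delta_mx i A + jetp z &
  jetq (t *: e_ (idx_p i A) + z) = jetq z].
Proof.
split; rewrite /jetx /jetu /jetp /jetq /idx_p.
- by rewrite lsubmx_rshift.
- by rewrite lsubmx_rshift.
- by rewrite rsubmx_rshift lsubmx_lshift vec_mx_line.
- by rewrite rsubmx_rshift rsubmx_lshift.
Qed.

Lemma line_q k A t z : [/\ jetx (t *: e_ (idx_q k A) + z) = jetx z,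
  jetu (t *: e_ (idx_q k A) + z) = jetu z,
  jetp (t *: e_ (idx_q k A) + z) = jetp z &
  jetq (t *: e_ (idx_q k A) + z) = t *: delta_mx k A + jetq z].
Proof.
split; rewrite /jetx /jetu /jetp /jetq /idx_q.
- by rewrite lsubmx_rshift.
- by rewrite lsubmx_rshift.
- by rewrite rsubmx_rshift lsubmx_rshift.
- by rewrite rsubmx_rshift rsubmx_rshift vec_mx_line.
Qed.

Lemma partial_x f i z : partial (idx_x i) (pull2 f) z =
  partial i (fun y => f y (jetu z) (jetp z) (jetq z)) (jetx z).
Proof. by apply: partial_line => t; rewrite /pull2; case: (line_x i t z) => -> -> -> ->. Qed.

Lemma partial_u f A z : partial (idx_u A) (pull2 f) z =
  partial A (fun w => f (jetx z) w (jetp z) (jetq z)) (jetu z).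
Proof. by apply: partial_line => t; rewrite /pull2; case: (line_u A t z) => -> -> -> ->. Qed.

Lemma partial_p f i A z : partial (idx_p i A) (pull2 f) z =
  mpartial i A (fun p => f (jetx z) (jetu z) p (jetq z)) (jetp z).
Proof. by apply: derive_line => t; rewrite /pull2; case: (line_p i A t z) => -> -> -> ->. Qed.

Lemma partial_q f k A z : partial (idx_q k A) (pull2 f) z =
  mpartial k A (f (jetx z) (jetu z) (jetp z)) (jetq z).
Proof. by apply: derive_line => t; rewrite /pull2; case: (line_q k A t z) => -> -> -> ->. Qed.

Lemma partial_q_pull1 f k A z : partial (idx_q k A) (pull1 f) z = 0.
Proof.
apply: (proj2 (partial_const_line _)) => t.
by rewrite /pull1; case: (line_q k A t z) => -> -> -> _.
Qed.

Lemma partial_p_pull0 f i A z : partial (idx_p i A) (pull0 f) z = 0.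
Proof.
apply: (proj2 (partial_const_line _)) => t.
by rewrite /pull0; case: (line_p i A t z) => -> -> _ _.
Qed.

Lemma sum_jet (G : 'I_((n + m) + (n * m + n * n * m)) -> R) :
  \sum_k G k = \sum_i G (idx_x i) + \sum_A G (idx_u A) +
    (\sum_i \sum_A G (idx_p i A) + \sum_k \sum_A G (idx_q k A)).
Proof. by rewrite !big_split_ord/= !sum_mxvec_index. Qed.

(** The total derivative D_i, with the third derivatives of u set to zero: they
    do not enter the total derivative of a function of first jets. *)
Definition total_field (i : 'I_n) z : J :=
  row_mx (row_mx (e_ i) (row i (jetp z)))
    (row_mx (mxvec (\matrix_(j, A) jetq z (mxvec_index i j) A)) 0).

Definition prolongation xi eta z : J :=
  row_mx (row_mx (xi (jetx z) (jetu z)) (eta (jetx z) (jetu z)))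
    (row_mx (mxvec (\matrix_(i, A) prolong1 xi eta i A (jetx z) (jetu z) (jetp z)))
      (mxvec (\matrix_(k, A) mxvec (\matrix_(i, j)
         prolong2 xi eta i j A (jetx z) (jetu z) (jetp z) (jetq z)) 0 k))).

Lemma total_field_x i z j : total_field i z 0 (idx_x j) = (j == i)%:R.
Proof. by rewrite row_mxEl row_mxEl !mxE eqxx. Qed.
Lemma total_field_u i z A : total_field i z 0 (idx_u A) = jetp z i A.
Proof. by rewrite row_mxEl row_mxEr mxE. Qed.
Lemma total_field_p i z j A :
  total_field i z 0 (idx_p j A) = jetq z (mxvec_index i j) A.
Proof. by rewrite row_mxEr row_mxEl mxvecE mxE. Qed.
Lemma total_field_q i z k A : total_field i z 0 (idx_q k A) = 0.
Proof. by rewrite row_mxEr row_mxEr mxE. Qed.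

Lemma prolongation_x xi eta z j :
  prolongation xi eta z 0 (idx_x j) = xi (jetx z) (jetu z) 0 j.
Proof. by rewrite row_mxEl row_mxEl. Qed.
Lemma prolongation_u xi eta z A :
  prolongation xi eta z 0 (idx_u A) = eta (jetx z) (jetu z) 0 A.
Proof. by rewrite row_mxEl row_mxEr. Qed.
Lemma prolongation_p xi eta z i A : prolongation xi eta z 0 (idx_p i A) =
  prolong1 xi eta i A (jetx z) (jetu z) (jetp z).
Proof. by rewrite row_mxEr row_mxEl mxvecE mxE. Qed.
Lemma prolongation_q xi eta z i j A :
  prolongation xi eta z 0 (idx_q (mxvec_index i j) A) =
  prolong2 xi eta i j A (jetx z) (jetu z) (jetp z) (jetq z).
Proof. by rewrite row_mxEr row_mxEr mxvecE mxE mxvecE mxE. Qed.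

Lemma total1_along i (f : fun1) z :
  total1 i f (jetx z) (jetu z) (jetp z) (jetq z) = along (total_field i) (pull1 f) z.
Proof.
rewrite /along sum_jet [X in _ + (_ + X)]big1 ?addr0; last first.
  by move=> k _; rewrite big1// => A _; rewrite partial_q_pull1 mulr0.
rewrite /total1; apply: congr2; first apply: congr2.
- rewrite (bigD1 i)//= total_field_x eqxx mul1r big1 ?addr0 => [|j ji].
    by rewrite (partial_x (fun x u p _ => f x u p)).
  by rewrite total_field_x (negbTE ji) mul0r.
- apply: eq_bigr => A _; rewrite total_field_u.
  by rewrite (partial_u (fun x u p _ => f x u p)).
- apply: eq_bigr => j _; apply: eq_bigr => A _; rewrite total_field_p.
  by rewrite (partial_p (fun x u p _ => f x u p)).
Qed.

Lemma total0_along i (f : fun0) z :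
  total0 i f (jetx z) (jetu z) (jetp z) = along (total_field i) (pull0 f) z.
Proof.
rewrite -(total1_along i (fun x u _ => f x u)) /total1 [X in _ = _ + X]big1 ?addr0//.
move=> j _; rewrite big1// => A _; rewrite (_ : mpartial _ _ _ _ = 0) ?mulr0//.
exact: derive_cst.
Qed.

Lemma act1_along xi eta (f : fun1) z :
  act1 xi eta f (jetx z) (jetu z) (jetp z) = along (prolongation xi eta) (pull1 f) z.
Proof.
rewrite /along sum_jet [X in _ + (_ + X)]big1 ?addr0; last first.
  by move=> k _; rewrite big1// => A _; rewrite partial_q_pull1 mulr0.
rewrite /act1; apply: congr2; first apply: congr2.
- apply: eq_bigr => j _; rewrite prolongation_x.
  by rewrite (partial_x (fun x u p _ => f x u p)).
- apply: eq_bigr => A _; rewrite prolongation_u.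
  by rewrite (partial_u (fun x u p _ => f x u p)).
- apply: eq_bigr => j _; apply: eq_bigr => A _; rewrite prolongation_p.
  by rewrite (partial_p (fun x u p _ => f x u p)).
Qed.

Lemma act2_along xi eta (f : fun2) z :
  act2 xi eta f (jetx z) (jetu z) (jetp z) (jetq z) =
  along (prolongation xi eta) (pull2 f) z.
Proof.
rewrite /along sum_jet /act2 /act1 -[LHS]addrA.
apply: congr2; first apply: congr2; last apply: congr2.
- by apply: eq_bigr => j _; rewrite prolongation_x partial_x.
- by apply: eq_bigr => A _; rewrite prolongation_u partial_u.
- apply: eq_bigr => j _; apply: eq_bigr => A _.
  by rewrite prolongation_p partial_p.
- rewrite sum_mxvec_index; apply: eq_bigr => i _; apply: eq_bigr => j _.
  by apply: eq_bigr => A _; rewrite prolongation_q partial_q.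
Qed.

End JetSpace.

(** * Total derivatives and prolongations *)

Lemma eq_mxvec_index a b (i j : 'I_a) (A B : 'I_b) :
  (mxvec_index i A == mxvec_index j B) = (i == j) && (A == B).
Proof.
by rewrite /mxvec_index (inj_eq (@cast_ord_inj _ _ _)) (inj_eq enum_rank_inj) xpair_eqE.
Qed.

Section JetCalculus.
Context {R : realType} {n m : nat} (U : set 'rV[R]_n) (W : set 'rV[R]_m).
Hypotheses (oU : open U) (oW : open W).

Local Notation J := 'rV[R]_((n + m) + (n * m + n * n * m)).
Local Notation fun0 := ('rV[R]_n -> 'rV[R]_m -> R).
Local Notation fun1 := ('rV[R]_n -> 'rV[R]_m -> 'M[R]_(n, m) -> R).
Implicit Types (z : J) (f : fun0).

Definition jet_domain : set J := [set z | U (jetx z) /\ W (jetu z)].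

Lemma open_jet_domain : open jet_domain.
Proof.
have [cl _] := @coordinate_map_lsubmx R (n + m) (n * m + n * n * m).
have -> : jet_domain = lsubmx @^-1` (product_domain U W) by [].
apply: open_comp => [z _|]; first exact: cl.
exact: open_product_domain.
Qed.

Let oJ := open_jet_domain.

Lemma smooth_pull0 f : smooth2 U W f -> smooth jet_domain (pull0 f).
Proof.
by move=> sf; apply: (smooth_coordinate_map coordinate_map_lsubmx _ sf) => z [].
Qed.

Lemma jet_index_ind (P : 'I_((n + m) + (n * m + n * n * m)) -> Prop) :
  (forall i, P (idx_x i)) -> (forall A, P (idx_u A)) ->
  (forall i A, P (idx_p i A)) -> (forall i j A, P (idx_q (mxvec_index i j) A)) ->
  forall k, P k.
Proof.
move=> Px Pu Pp Pq k; case: (split_ordP k) => k1 ->; case: (split_ordP k1) => k2 ->.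
- exact: Px.
- exact: Pu.
- by case/mxvec_indexP: k2 => i A; exact: Pp.
- by case/mxvec_indexP: k2 => l A; case/mxvec_indexP: l => i j; exact: Pq.
Qed.

Lemma partial_u_pull0 f A :
  partial (idx_u A) (pull0 f) = pull0 (fun x u => partial A (f x) u).
Proof. by apply/funext => z; exact: (partial_u (fun x u _ _ => f x u)). Qed.

Lemma partial_q_pull0 f k A z : partial (idx_q k A) (pull0 f) z = 0.
Proof. exact: (partial_q_pull1 (fun x u _ => f x u)). Qed.

Lemma vsmooth_total_field i : vsmooth jet_domain (@total_field R n m i).
Proof.
move=> k; elim/jet_index_ind: k => [j|A|j A|j l A].
- rewrite (_ : (fun z => _) = fun=> (j == i)%:R); first exact: smooth_cst.
  by apply/funext => z; exact: total_field_x.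
- rewrite (_ : (fun z => _) = fun z : J => z 0 (idx_p i A)); first exact: smooth_coord.
  by apply/funext => z; rewrite total_field_u jetp_coord.
- rewrite (_ : (fun z => _) = fun z : J => z 0 (idx_q (mxvec_index i j) A)).
    exact: smooth_coord.
  by apply/funext => z; rewrite total_field_p jetq_coord.
- rewrite (_ : (fun z => _) = fun=> 0); first exact: smooth_cst.
  by apply/funext => z; exact: total_field_q.
Qed.

Lemma along_total_pull0 i f z : along (total_field i) (pull0 f) z =
  pull0 (fun x u => partial i (f^~ u) x) z +
  \sum_A z 0 (idx_p i A) * pull0 (fun x u => partial A (f x) u) z.
Proof.
rewrite -total0_along /total0; congr (_ + _).
by apply: eq_bigr => A _; rewrite jetp_coord.
Qed.

(** The bracket of D_i and D_j differentiates u^A by u^A_{,ij} - u^A_{,ji} and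
    leaves x alone; functions of x and u do not see its other components. *)
Lemma total_fieldC i j f z : smooth2 U W f -> jet_domain z ->
    symmetric_jet (jetq z) ->
  along (total_field i) (along (total_field j) (pull0 f)) z =
  along (total_field j) (along (total_field i) (pull0 f)) z.
Proof.
move=> sf Jz symz.
rewrite (along_commutator oJ (vsmooth_total_field i) (vsmooth_total_field j)
  (smooth_pull0 sf) Jz) sum_jet.
rewrite [X in _ + (X + _ + _)]big1 => [|k _]; last first.
  have E l r : along (total_field l) (fun y : J => total_field r y 0 (idx_x k)) z = 0.
    rewrite (_ : (fun y => _) = fun=> (k == r)%:R); first exact: along_cst.
    by apply/funext => y; rewrite total_field_x.
  by rewrite !E subrr mul0r.
rewrite [X in _ + (_ + X + _)]big1 => [|A _]; last first.
  have E k l : along (total_field k) (fun y : J => total_field l y 0 (idx_u A)) z =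
      jetq z (mxvec_index k l) A.
    rewrite (_ : (fun y => _) = fun y : J => y 0 (idx_p l A)).
      by rewrite along_coord total_field_p.
    by apply/funext => y; rewrite total_field_u jetp_coord.
  by rewrite !E symz subrr mul0r.
rewrite [X in _ + (_ + (X + _))]big1 => [|k _]; last first.
  by rewrite big1// => A _; rewrite partial_p_pull0 mulr0.
rewrite [X in _ + (_ + (_ + X))]big1 ?addr0// => k _.
by rewrite big1// => A _; rewrite partial_q_pull0 mulr0.
Qed.

(** No coefficient of D_i depends on u. *)
Lemma partial_u_total i A f z : smooth2 U W f -> jet_domain z ->
  partial (idx_u A) (along (total_field i) (pull0 f)) z =
  along (total_field i) (partial (idx_u A) (pull0 f)) z.
Proof.
move=> sf Jz; rewrite (partial_along oJ _ (vsmooth_total_field i) (smooth_pull0 sf) Jz).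
rewrite big1 ?addr0// => k _; apply/eqP; rewrite mulf_eq0; apply/orP; left; apply/eqP.
elim/jet_index_ind: k => [j|B|j B|j l B].
- rewrite (_ : (fun z => _) = fun=> (j == i)%:R); first exact: partial_cst.
  by apply/funext => y; exact: total_field_x.
- rewrite (_ : (fun z => _) = fun z : J => z 0 (idx_p i B)).
    by rewrite partial_coord eq_rlshift.
  by apply/funext => y; rewrite total_field_u jetp_coord.
- rewrite (_ : (fun z => _) = fun z : J => z 0 (idx_q (mxvec_index i j) B)).
    by rewrite partial_coord eq_rlshift.
  by apply/funext => y; rewrite total_field_p jetq_coord.
- rewrite (_ : (fun z => _) = fun=> 0); first exact: partial_cst.
  by apply/funext => y; exact: total_field_q.
Qed.

(** Among the coefficients of D_j only u^A_{,j}, the one of d/du^A, contains first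
    derivatives of u. *)
Lemma partial_p_total i j A f z : smooth2 U W f -> jet_domain z ->
  partial (idx_p i A) (along (total_field j) (pull0 f)) z =
  (i == j)%:R * partial (idx_u A) (pull0 f) z.
Proof.
move=> sf Jz; rewrite (partial_along oJ _ (vsmooth_total_field j) (smooth_pull0 sf) Jz).
rewrite [X in X + _]big1 ?add0r => [|k _]; last first.
  rewrite (_ : partial (idx_p i A) _ = fun=> 0) ?partial_cst ?mulr0//.
  by apply/funext => y; exact: partial_p_pull0.
rewrite sum_jet [X in X + _ + _]big1 ?add0r => [|k _]; last first.
  rewrite (_ : (fun z => _) = fun=> (k == j)%:R) ?partial_cst ?mul0r//.
  by apply/funext => y; exact: total_field_x.
rewrite [X in _ + (X + _)]big1 ?add0r => [|k _]; last first.
  by rewrite big1// => B _; rewrite partial_p_pull0 mulr0.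
rewrite [X in _ + X]big1 ?addr0 => [|k _]; last first.
  by rewrite big1// => B _; rewrite partial_q_pull0 mulr0.
have E B : partial (idx_p i A) (fun y : J => total_field j y 0 (idx_u B)) z =
    ((j == i) && (B == A))%:R.
  rewrite (_ : (fun y => _) = fun y : J => y 0 (idx_p j B)).
    rewrite partial_coord /idx_p (inj_eq (@rshift_inj _ _)) (inj_eq (@lshift_inj _ _)).
    by rewrite eq_mxvec_index.
  by apply/funext => y; rewrite total_field_u jetp_coord.
rewrite (bigD1 A)//= E eqxx andbT eq_sym big1 ?addr0// => B BA.
by rewrite E (negbTE BA) andbF mul0r.
Qed.

Section Prolongation.
Variables (xi : 'rV[R]_n -> 'rV[R]_n) (eta : 'rV[R]_n -> 'rV[R]_m -> 'rV[R]_m).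
Hypotheses (sxi : vsmooth U xi) (seta : vsmooth2 U W eta).

Let Xi (x : 'rV[R]_n) (u : 'rV[R]_m) := xi x.
Let X := @prolongation R n m Xi eta.
Let dxi i k : fun0 := fun x _ => partial i (fun y => xi y 0 k) x.
Let etaA A : fun0 := fun x u => eta x u 0 A.
Let zeta i A : J -> R := pull1 (prolong1 Xi eta i A).
Let zeta2 i j A : J -> R := pull2 (prolong2 Xi eta i j A).

Let sdxi i k : smooth2 U W (dxi i k).
Proof. exact/smooth2_fst/smooth_partial. Qed.

Let sxi0 k : smooth2 U W (fun x _ => xi x 0 k).
Proof. exact/smooth2_fst. Qed.

Let total0_xi i k x u p : total0 i (fun y (w : 'rV[R]_m) => xi y 0 k) x u p = dxi i k x u.
Proof.
rewrite /total0 big1 ?addr0// => A _.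
by rewrite (_ : partial A _ _ = 0) ?mulr0//; exact: partial_cst.
Qed.

Lemma prolong1E i A : zeta i A = fun z => along (total_field i) (pull0 (etaA A)) z -
  \sum_k z 0 (idx_p k A) * pull0 (dxi i k) z.
Proof.
apply/funext => z; rewrite /zeta /pull1 /prolong1; congr (_ - _).
  exact: (total0_along i (etaA A) z).
by apply: eq_bigr => k _; rewrite total0_xi jetp_coord.
Qed.

Lemma prolong2E i j A : zeta2 i j A = fun z => along (total_field j) (zeta i A) z -
  \sum_k z 0 (idx_q (mxvec_index i k) A) * pull0 (dxi j k) z.
Proof.
apply/funext => z; rewrite /zeta2 /pull2 /prolong2; congr (_ - _).
  exact: (total1_along j (prolong1 Xi eta i A) z).
by apply: eq_bigr => k _; rewrite total0_xi jetq_coord.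
Qed.

Lemma smooth_prolong1 i A : smooth jet_domain (zeta i A).
Proof.
rewrite prolong1E; apply: smoothB => //.
  apply: smooth_along => //; first exact: vsmooth_total_field.
  exact: (smooth_pull0 (seta A)).
apply: smooth_sum => // k; apply: smoothM => //; first exact: smooth_coord.
exact: smooth_pull0.
Qed.

Lemma smooth_prolong2 i j A : smooth jet_domain (zeta2 i j A).
Proof.
rewrite prolong2E; apply: smoothB => //.
  apply: smooth_along => //; first exact: vsmooth_total_field.
  exact: smooth_prolong1.
apply: smooth_sum => // k; apply: smoothM => //; first exact: smooth_coord.
exact: smooth_pull0.
Qed.

Lemma vsmooth_prolongation : vsmooth jet_domain X.
Proof.
move=> k; elim/jet_index_ind: k => [j|A|j A|j l A].
- rewrite (_ : (fun z => _) = pull0 (fun x _ => xi x 0 j)); first exact: (smooth_pull0 (sxi0 j)).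
  by apply/funext => z; rewrite /X prolongation_x.
- rewrite (_ : (fun z => _) = pull0 (etaA A)); first exact: (smooth_pull0 (seta A)).
  by apply/funext => z; rewrite /X prolongation_u.
- rewrite (_ : (fun z => _) = zeta j A); first exact: smooth_prolong1.
  by apply/funext => z; rewrite /X prolongation_p.
- rewrite (_ : (fun z => _) = zeta2 j l A); first exact: smooth_prolong2.
  by apply/funext => z; rewrite /X prolongation_q.
Qed.

(** The recursion that defines the second prolongation differentiates by j the
    first prolongation with index i; symmetry of the jet and of second derivatives
    lets i and j change roles. *)
Lemma total_prolong1 i j A z : jet_domain z -> symmetric_jet (jetq z) ->
  along (total_field i) (zeta j A) z = zeta2 i j A z +
    \sum_k jetq z (mxvec_index k j) A * pull0 (dxi i k) z.
Proof.
move=> Jz symz; rewrite prolong2E.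
pose T a b := along (total_field a) (along (total_field b) (pull0 (etaA A))) z.
pose Sq a b := \sum_k jetq z (mxvec_index a k) A * pull0 (dxi b k) z.
pose Sp a b := \sum_k jetp z k A *
  pull0 (fun x (_ : 'rV[R]_m) => partial a (partial b (fun y => xi y 0 k)) x) z.
have E a b : along (total_field a) (zeta b A) z = T a b - (Sq a b + Sp a b).
  have s1 : smooth jet_domain (along (total_field b) (pull0 (etaA A))).
    by apply: smooth_along => //; [exact: vsmooth_total_field|exact: (smooth_pull0 (seta A))].
  have s2 k : smooth jet_domain (fun z : J => z 0 (idx_p k A) * pull0 (dxi b k) z).
    by apply: smoothM => //; [exact: smooth_coord|exact: smooth_pull0].
  rewrite prolong1E (alongB _ s1 (smooth_sum oJ _ _ s2) Jz) (along_sum _ _ _ s2 Jz).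
  congr (_ - _); rewrite -big_split/=; apply: eq_bigr => k _.
  rewrite (alongM _ (smooth_coord _ _) (smooth_pull0 (sdxi b k)) Jz).
  rewrite along_coord total_field_p -jetp_coord; congr (_ + _ * _).
  rewrite along_total_pull0 big1 ?addr0// => B _.
  by rewrite [X in _ * X](_ : _ = 0) ?mulr0//; exact: partial_cst.
have ET : T i j = T j i by exact: (total_fieldC i j (seta A) Jz symz).
have ESp : Sp i j = Sp j i.
  have [Ux _] := Jz; apply: eq_bigr => k _.
  exact: (congr1 (fun r => jetp z k A * r) (partialC i j oU Ux (sxi k))).
have E1 : \sum_k z 0 (idx_q (mxvec_index i k) A) * pull0 (dxi j k) z = Sq i j.
  by apply: eq_bigr => k _; rewrite jetq_coord.
have E2 : \sum_k jetq z (mxvec_index k j) A * pull0 (dxi i k) z = Sq j i.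
  by apply: eq_bigr => k _; rewrite symz.
clearbody T Sq Sp; rewrite E1 E2 E (E j i) ET ESp; ring.
Qed.

(** The bracket of D_i and X is (D_i xi^k) D_k: the prolongation formulas are the
    ones for which the coefficients of both sides agree. *)
Lemma total_prolongation i (F : fun1) z : smooth jet_domain (pull1 F) ->
    jet_domain z -> symmetric_jet (jetq z) ->
  along (total_field i) (along X (pull1 F)) z =
  along X (along (total_field i) (pull1 F)) z +
    \sum_k pull0 (dxi i k) z * along (total_field k) (pull1 F) z.
Proof.
move=> sF Jz symz.
rewrite (along_commutator oJ (vsmooth_total_field i) vsmooth_prolongation sF Jz).
congr (_ + _); rewrite sum_jet [X in _ + (_ + X)]big1 ?addr0 => [|k _]; last first.
  by rewrite big1// => A _; rewrite partial_q_pull1 mulr0.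
have Ex k : along (total_field i) (fun y => X y 0 (idx_x k)) z -
    along X (fun y => total_field i y 0 (idx_x k)) z = pull0 (dxi i k) z.
  rewrite (_ : (fun y => X y 0 (idx_x k)) = pull0 (fun x _ => xi x 0 k)); last first.
    by apply/funext => y; rewrite /X prolongation_x.
  rewrite [X in _ - X](_ : _ = 0) ?subr0; last first.
    rewrite (_ : (fun y => _) = fun=> (k == i)%:R); first exact: along_cst.
    by apply/funext => y; rewrite total_field_x.
  by rewrite -total0_along total0_xi.
have Eu A : along (total_field i) (fun y => X y 0 (idx_u A)) z -
    along X (fun y => total_field i y 0 (idx_u A)) z =
    \sum_k jetp z k A * pull0 (dxi i k) z.
  rewrite (_ : (fun y => X y 0 (idx_u A)) = pull0 (etaA A)); last first.
    by apply/funext => y; rewrite /X prolongation_u.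
  rewrite (_ : (fun y : J => total_field i y 0 (idx_u A)) = fun y : J => y 0 (idx_p i A)); last first.
    by apply/funext => y; rewrite total_field_u jetp_coord.
  rewrite along_coord /X prolongation_p -[prolong1 _ _ _ _ _ _ _]/(zeta i A z) prolong1E.
  under [in RHS]eq_bigr do rewrite jetp_coord.
  ring.
have Ep j A : along (total_field i) (fun y => X y 0 (idx_p j A)) z -
    along X (fun y => total_field i y 0 (idx_p j A)) z =
    \sum_k jetq z (mxvec_index k j) A * pull0 (dxi i k) z.
  rewrite (_ : (fun y => X y 0 (idx_p j A)) = zeta j A); last first.
    by apply/funext => y; rewrite /X prolongation_p.
  rewrite (_ : (fun y : J => total_field i y 0 (idx_p j A)) =
    fun y : J => y 0 (idx_q (mxvec_index i j) A)); last first.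
    by apply/funext => y; rewrite total_field_p jetq_coord.
  rewrite along_coord /X prolongation_q -[prolong2 _ _ _ _ _ _ _ _ _]/(zeta2 i j A z).
  by rewrite total_prolong1//; ring.
under eq_bigr do rewrite Ex.
under [X in _ + X + _]eq_bigr do rewrite Eu mulr_suml.
under [X in _ + _ + X]eq_bigr do (under eq_bigr do rewrite Ep mulr_suml).
rewrite [X in _ + X + _]exchange_big/=.
under [X in _ + _ + X]eq_bigr do rewrite exchange_big/=.
rewrite [X in _ + _ + X]exchange_big/= -!big_split/=; apply: eq_bigr => k _.
rewrite -(total1_along k F) /total1 (partial_x (fun x u p _ => F x u p)).
rewrite !mulrDr; congr (_ + _ + _).
- rewrite mulr_sumr; apply: eq_bigr => A _.
  by rewrite (partial_u (fun x u p _ => F x u p)); ring.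
- rewrite mulr_sumr; apply: eq_bigr => j _; rewrite mulr_sumr; apply: eq_bigr => A _.
  by rewrite (partial_p (fun x u p _ => F x u p)); ring.
Qed.

End Prolongation.

End JetCalculus.

(** * From the Noether identity to Lie symmetry *)

(** The algebra of Noether's theorem at one jet that solves the Euler-Lagrange
    equations. In its use below P i B and Q B are the derivatives of L by u^B_{,i}
    and u^B, DP the total derivatives of P, d and e the first and second derivatives
    of xi, delta its divergence with total derivatives dd, h and s the u-derivatives
    of eta and their total derivatives, and g comes from the gauge field. *)
Lemma noether_cancellation (R : comPzRingType) n m (A : 'I_m)
    (g dd : 'I_n -> R) (h Q : 'I_m -> R) (s P : 'I_n -> 'I_m -> R)
    (DP : 'I_n -> 'I_n -> 'I_m -> R) (d e : 'I_n -> 'I_n -> R) (delta : R) :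
  (forall B, \sum_i DP i i B = Q B) -> (forall j, dd j = \sum_i e i j) ->
  \sum_i (g i - \sum_B (s i B * P i B + h B * DP i i B)
          + \sum_j (e i j * P j A + d j i * DP i j A)
          - (DP i i A * delta + P i A * dd i)
          - \sum_k d i k * DP k i A)
  = \sum_i g i - \sum_B h B * Q B - \sum_j \sum_B s j B * P j B - Q A * delta.
Proof.
move=> EL Ed.
under eq_bigr => i _ do rewrite !big_split/= !opprD.
rewrite !big_split/= !sumrN.
have -> : \sum_i \sum_B h B * DP i i B = \sum_B h B * Q B.
  by rewrite exchange_big; apply: eq_bigr => B _; rewrite -mulr_sumr EL.
have -> : \sum_i DP i i A * delta = Q A * delta by rewrite -mulr_suml EL.
have -> : \sum_i P i A * dd i = \sum_i \sum_j e i j * P j A.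
  rewrite exchange_big; apply: eq_bigr => i _ /=.
  by rewrite Ed mulrC mulr_suml.
have -> : \sum_i \sum_k d i k * DP k i A = \sum_i \sum_j d j i * DP i j A.
  by rewrite exchange_big.
ring.
Qed.

Section NoetherTheorem.
Context {R : realType} {n m : nat} (U : set 'rV[R]_n) (W : set 'rV[R]_m).
Hypotheses (oU : open U) (oW : open W).

Local Notation J := 'rV[R]_((n + m) + (n * m + n * n * m)).
Local Notation fun0 := ('rV[R]_n -> 'rV[R]_m -> R).
Local Notation fun1 := ('rV[R]_n -> 'rV[R]_m -> 'M[R]_(n, m) -> R).
Local Notation Jdom := (jet_domain U W).

Variables (L : fun1) (xi : 'rV[R]_n -> 'rV[R]_n).
Variables (eta : 'rV[R]_n -> 'rV[R]_m -> 'rV[R]_m).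
Variables (gauge : 'rV[R]_n -> 'rV[R]_m -> 'rV[R]_n).
Hypotheses (sL : smooth Jdom (pull1 L)) (sxi : vsmooth U xi).
Hypotheses (seta : vsmooth2 U W eta) (sgauge : vsmooth2 U W gauge).

Let oJ := open_jet_domain oU oW.
Let Xi (x : 'rV[R]_n) (u : 'rV[R]_m) := xi x.
Let X : J -> J := prolongation Xi eta.
Let D i : J -> J := total_field i.
Let l : J -> R := pull1 L.
Let P i A : J -> R := partial (idx_p i A) l.
Let Q A : J -> R := partial (idx_u A) l.
Let dxi i k : J -> R := pull0 (fun x _ => partial i (fun y => xi y 0 k) x).
Let etaA B : J -> R := pull0 (fun x u => eta x u 0 B).
Let gaugeI i : J -> R := pull0 (fun x u => gauge x u 0 i).
Let deta A B : J -> R := partial (idx_u A) (etaA B).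
Let delta : J -> R := pull0 (fun x _ => \sum_k partial k (fun y => xi y 0 k) x).
Let zeta i B : J -> R := pull1 (prolong1 Xi eta i B).

Let sX : vsmooth Jdom X. Proof. exact: vsmooth_prolongation. Qed.
Let sD i : vsmooth Jdom (D i). Proof. exact: vsmooth_total_field. Qed.
Let sP i A : smooth Jdom (P i A). Proof. exact: smooth_partial. Qed.
Let sQ A : smooth Jdom (Q A). Proof. exact: smooth_partial. Qed.
Let sdxi2 i k : smooth2 U W (fun x _ => partial i (fun y => xi y 0 k) x).
Proof. exact/smooth2_fst/smooth_partial. Qed.
Let sdxi i k : smooth Jdom (dxi i k). Proof. exact: (smooth_pull0 (sdxi2 i k)). Qed.
Let setaA B : smooth Jdom (etaA B). Proof. exact: (smooth_pull0 (seta B)). Qed.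
Let sdeta A B : smooth Jdom (deta A B). Proof. exact: smooth_partial. Qed.
Let sgaugeI i : smooth Jdom (gaugeI i). Proof. exact: (smooth_pull0 (sgauge i)). Qed.
Let sdelta2 : smooth2 U W (fun x _ => \sum_k partial k (fun y => xi y 0 k) x).
Proof. by apply: smooth2_fst; apply: smooth_sum => // k; exact: smooth_partial. Qed.
Let sdelta : smooth Jdom delta. Proof. exact: (smooth_pull0 sdelta2). Qed.

Let sDeta i B : smooth Jdom (along (D i) (etaA B)).
Proof. exact: (smooth_along oJ (sD i) (setaA B)). Qed.
Let sDgauge i : smooth Jdom (along (D i) (gaugeI i)).
Proof. exact: (smooth_along oJ (sD i) (sgaugeI i)). Qed.
Let sDP i k B : smooth Jdom (along (D i) (P k B)).
Proof. exact: (smooth_along oJ (sD i) (sP k B)). Qed.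
Let sXl : smooth Jdom (along X l).
Proof. exact: (smooth_along oJ sX sL). Qed.

Let PE i A : P i A = pull1 (fun x u p => mpartial i A (L x u) p).
Proof. by apply/funext => z; exact: (partial_p (fun x u p _ => L x u p)). Qed.
Let QE A : Q A = pull1 (fun x u p => partial A (fun w => L x w p) u).
Proof. by apply/funext => z; exact: (partial_u (fun x u p _ => L x u p)). Qed.

Let der k f z : smooth Jdom f -> Jdom z -> derivable f z (delta_mx 0 k).
Proof. by move=> sf Jz; exact: smooth_derivable sf Jz. Qed.

Let partial_p_zeta i A j B z : Jdom z ->
  partial (idx_p i A) (zeta j B) z =
  (i == j)%:R * deta A B z - (A == B)%:R * dxi j i z.
Proof.
move=> Jz; rewrite /zeta prolong1E partialB; first last.
- apply: (fun h => der h Jz); apply: smooth_sum => // k.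
  by apply: smoothM; [|exact: smooth_coord|exact: (sdxi j k)].
- exact: (der (sDeta j B) Jz).
rewrite (partial_p_total oU oW i j A (seta B) Jz); congr (_ - _).
rewrite partial_sum => [|k]; last first.
  by apply: (fun h => der h Jz); apply: smoothM; [|exact: smooth_coord|exact: (sdxi j k)].
have E k : partial (idx_p i A) (fun y : J => y 0 (idx_p k B) * dxi j k y) z =
    ((k == i) && (B == A))%:R * dxi j k z.
  rewrite partialM; [|exact: derivable_coord|exact: der (sdxi j k) Jz].
  rewrite partial_coord partial_p_pull0 mulr0 addr0.
  rewrite /idx_p (inj_eq (@rshift_inj _ _)) (inj_eq (@lshift_inj _ _)).
  by rewrite eq_mxvec_index.
rewrite (bigD1 i)//= E eqxx/= [B == A]eq_sym big1 ?addr0// => k ki.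
by rewrite E (negbTE ki) mul0r.
Qed.

Let partial_u_zeta A j B z : Jdom z ->
  partial (idx_u A) (zeta j B) z = along (D j) (deta A B) z.
Proof.
move=> Jz; rewrite /zeta prolong1E partialB; first last.
- apply: (fun h => der h Jz); apply: smooth_sum => // k.
  by apply: smoothM; [|exact: smooth_coord|exact: (sdxi j k)].
- exact: (der (sDeta j B) Jz).
rewrite (partial_u_total oU oW j A (seta B) Jz).
rewrite partial_sum => [|k]; last first.
  by apply: (fun h => der h Jz); apply: smoothM; [|exact: smooth_coord|exact: (sdxi j k)].
rewrite big1 ?subr0// => k _.
rewrite partialM; [|exact: derivable_coord|exact: der (sdxi j k) Jz].
rewrite partial_coord /idx_u /idx_p eq_rlshift mul0r add0r.
rewrite partial_u_pull0 [X in _ * X](_ : _ = 0) ?mulr0//; exact: partial_cst.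
Qed.

(* F and G are the two sides of the Noether identity on the jet space. *)
Let F z := along X l z + l z * delta z.

Let partialF k z : Jdom z -> partial k F z =
  along X (partial k l) z + \sum_j partial k (fun y => X y 0 j) z * partial j l z
  + (partial k l z * delta z + l z * partial k delta z).
Proof.
move=> Jz; rewrite partialD; first last.
- exact: (der (smoothM oJ sL sdelta) Jz).
- exact: (der sXl Jz).
rewrite (partial_along oJ k sX sL Jz) partialM//; [exact: der|exact: der].
Qed.

Let XxE j : (fun y => X y 0 (idx_x j)) = pull0 (fun x _ => xi x 0 j).
Proof. by apply/funext => y; rewrite /X prolongation_x. Qed.
Let XuE B : (fun y => X y 0 (idx_u B)) = etaA B.
Proof. by apply/funext => y; rewrite /X prolongation_u. Qed.
Let XpE j B : (fun y => X y 0 (idx_p j B)) = zeta j B.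
Proof. by apply/funext => y; rewrite /X prolongation_p. Qed.

Let partial_p_F i A z : Jdom z -> partial (idx_p i A) F z =
  along X (P i A) z + \sum_B deta A B z * P i B z - \sum_j dxi j i z * P j A z
  + P i A z * delta z.
Proof.
move=> Jz; rewrite partialF// partial_p_pull0 mulr0 addr0 sum_jet.
rewrite [X in _ + (X + _ + _)]big1 ?add0r => [|j _]; last first.
  by rewrite XxE partial_p_pull0 mul0r.
rewrite [X in _ + (X + _)]big1 ?add0r => [|B _]; last first.
  by rewrite XuE partial_p_pull0 mul0r.
rewrite [X in _ + (_ + X)]big1 ?addr0 => [|k _]; last first.
  by rewrite big1// => B _; rewrite partial_q_pull1 mulr0.
rewrite -[RHS]/(_ + _ + _ + _) -[in RHS](addrA (along _ _ _)).
congr (_ + _ + _).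
have E j B : partial (idx_p i A) (fun y => X y 0 (idx_p j B)) z * partial (idx_p j B) l z =
    (i == j)%:R * (deta A B z * P j B z) - (A == B)%:R * (dxi j i z * P j B z).
  by rewrite XpE partial_p_zeta// mulrBl -!mulrA.
under eq_bigr do (under eq_bigr do rewrite E).
under eq_bigr do rewrite big_split/= sumrN.
rewrite big_split/= sumrN; congr (_ - _).
  rewrite (bigD1 i)//= [X in _ + X]big1 ?addr0 => [|j ji].
    by apply: eq_bigr => B _; rewrite eqxx mul1r.
  by rewrite big1// => B _; rewrite eq_sym (negbTE ji) mul0r.
apply: eq_bigr => j _; rewrite (bigD1 A)//= eqxx mul1r big1 ?addr0// => B BA.
by rewrite eq_sym (negbTE BA) mul0r.
Qed.

Let partial_u_F A z : Jdom z -> partial (idx_u A) F z =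
  along X (Q A) z + \sum_B deta A B z * Q B z
  + \sum_j \sum_B along (D j) (deta A B) z * P j B z + Q A z * delta z.
Proof.
move=> Jz; rewrite partialF// partial_u_pull0 [X in l z * X](_ : _ = 0); last first.
  exact: partial_cst.
rewrite mulr0 addr0 sum_jet.
rewrite [X in _ + (X + _ + _)]big1 ?add0r => [|j _]; last first.
  rewrite XxE partial_u_pull0 [X in X * _](_ : _ = 0) ?mul0r//; exact: partial_cst.
rewrite [X in _ + (_ + (_ + X))]big1 ?addr0 => [|k _]; last first.
  by rewrite big1// => B _; rewrite partial_q_pull1 mulr0.
rewrite addrA; congr (_ + _ + _ + _).
  by apply: eq_bigr => B _; rewrite XuE.
by apply: eq_bigr => j _; apply: eq_bigr => B _; rewrite XpE partial_u_zeta.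
Qed.

Let G z := \sum_i along (D i) (gaugeI i) z.

Let partial_p_G i A z : Jdom z -> partial (idx_p i A) G z = partial (idx_u A) (gaugeI i) z.
Proof.
move=> Jz; rewrite partial_sum => [|k]; last exact: (der (sDgauge k) Jz).
rewrite (bigD1 i)//= (partial_p_total oU oW i i A (sgauge i) Jz) eqxx mul1r.
rewrite big1 ?addr0// => j ji.
by rewrite (partial_p_total oU oW i j A (sgauge j) Jz) eq_sym (negbTE ji) mul0r.
Qed.

Let partial_u_G A z : Jdom z ->
  partial (idx_u A) G z = \sum_i along (D i) (partial (idx_u A) (gaugeI i)) z.
Proof.
move=> Jz; rewrite partial_sum => [|k]; last exact: (der (sDgauge k) Jz).
by apply: eq_bigr => i _; exact: (partial_u_total oU oW i A (sgauge i) Jz).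
Qed.

Hypothesis identity : forall x u p, U x -> W u ->
  act1 Xi eta L x u p + L x u p * \sum_i total0 i (fun y w => Xi y w 0 i) x u p
  = \sum_i total0 i (fun y w => gauge y w 0 i) x u p.

Let FG z : Jdom z -> F z = G z.
Proof.
move=> [Ux Wu]; have := identity (jetp z) Ux Wu; rewrite act1_along => E.
rewrite /F /G; under [RHS]eq_bigr do rewrite -total0_along.
rewrite -E; congr (_ + _ * _); apply: eq_bigr => k _.
rewrite /total0 big1 ?addr0// => B _.
by rewrite [X in _ * X](_ : _ = 0) ?mulr0//; exact: partial_cst.
Qed.

(* Differentiating F = G by u^A_{,i} and by u^A gives the action of X on the
   derivatives of L. *)
Let X_P i A z : Jdom z -> along X (P i A) z =
  partial (idx_u A) (gaugeI i) z - \sum_B deta A B z * P i B z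
  + \sum_j dxi j i z * P j A z - P i A z * delta z.
Proof.
move=> Jz; have := partial_p_F i A Jz.
rewrite (@open_eq_partial _ _ _ F G _ _ oJ Jz); last by move=> y; rewrite inE; exact: FG.
by rewrite partial_p_G// => ->; ring.
Qed.

Let X_Q A z : Jdom z -> along X (Q A) z =
  \sum_i along (D i) (partial (idx_u A) (gaugeI i)) z - \sum_B deta A B z * Q B z
  - \sum_j \sum_B along (D j) (deta A B) z * P j B z - Q A z * delta z.
Proof.
move=> Jz; have := partial_u_F A Jz.
rewrite (@open_eq_partial _ _ _ F G _ _ oJ Jz); last by move=> y; rewrite inE; exact: FG.
by rewrite partial_u_G// => ->; ring.
Qed.

(** Applying the Euler operator to X L + L div xi = div gauge gives
    X E_A = - (d_A eta^B) E_B - (div xi) E_A, since the prolonged field commutes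
    with the total derivatives up to the derivative of xi and the Euler operator
    kills divergences. *)
Lemma lie_of_noether_identity : lie_point_symmetry U W L Xi eta.
Proof.
move=> x u p q Ux Wu symq EL A; pose z := jet x u p q.
have Jz : Jdom z by split; rewrite ?jetxE ?jetuE.
have symz : symmetric_jet (jetq z) by rewrite jetqE.
have at_z (f : 'rV[R]_n -> 'rV[R]_m -> 'M[R]_(n, m) -> 'M[R]_(n * n, m) -> R) :
    f x u p q = pull2 f z by rewrite /pull2 jetxE jetuE jetpE jetqE.
have elE B : pull2 (euler_lagrange L B) =
    fun y => \sum_i along (D i) (P i B) y - Q B y.
  apply/funext => y; rewrite /pull2 /euler_lagrange QE; congr (_ - _).
  by apply: eq_bigr => i _; rewrite PE -total1_along.
have ELz B : \sum_i along (D i) (P i B) z = Q B z.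
  by have := EL B; rewrite at_z elE => /eqP; rewrite subr_eq0 => /eqP.
have -> : act2 Xi eta (euler_lagrange L A) x u p q =
    along X (pull2 (euler_lagrange L A)) z.
  by rewrite (at_z (act2 _ _ _)) /pull2 act2_along.
rewrite elE (alongB _ _ (sQ A) Jz); last first.
  by apply: smooth_sum => // i; exact: sDP.
rewrite (along_sum _ _ _ _ Jz); last by move=> i; exact: sDP.
apply/eqP; rewrite subr_eq0 X_Q//; apply/eqP.
rewrite -(@noether_cancellation R n m A
  (fun i => along (D i) (partial (idx_u A) (gaugeI i)) z)
  (fun i => along (D i) delta z) (fun B => deta A B z) (fun B => Q B z)
  (fun i B => along (D i) (deta A B) z) (fun i B => P i B z)
  (fun i k B => along (D i) (P k B) z) (fun i k => dxi i k z)
  (fun i j => along (D i) (dxi j i) z) (delta z) ELz); last first.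
  move=> j; rewrite /delta along_total_pull0 big1 ?addr0 => [|B _]; last first.
    by rewrite [X in _ * X](_ : _ = 0) ?mulr0//; exact: partial_cst.
  have [Ux' _] := Jz; rewrite {1}/pull0 partial_sum => [|k]; last first.
    exact: (smooth_derivable (smooth_partial k (sxi k)) Ux').
  apply: eq_bigr => k _; rewrite /dxi along_total_pull0 big1 ?addr0 => [|B _]; last first.
    by rewrite [X in _ * X](_ : _ = 0) ?mulr0//; exact: partial_cst.
  exact: (partialC j k oU Ux' (sxi k)).
apply: eq_bigr => i _.
have sPi : smooth Jdom (pull1 (fun x u p => mpartial i A (L x u) p)) by rewrite -PE.
have := total_prolongation oU oW sxi seta i sPi Jz symz; rewrite -PE.
move=> /(canLR (addrK _)) <-; congr (_ - _).
have EX : {in Jdom, along X (P i A) =1 fun y =>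
  partial (idx_u A) (gaugeI i) y - \sum_B deta A B y * P i B y
  + \sum_j dxi j i y * P j A y - P i A y * delta y}.
  by move=> y; rewrite inE => Jy; exact: X_P.
rewrite (eq_along oJ (D i) Jz EX).
have sg : smooth Jdom (partial (idx_u A) (gaugeI i)) by exact: smooth_partial.
have s1 B : smooth Jdom (fun y => deta A B y * P i B y) by exact: smoothM.
have s2 j : smooth Jdom (fun y => dxi j i y * P j A y) by exact: smoothM.
have s3 : smooth Jdom (fun y => P i A y * delta y) by exact: smoothM.
have s1s := smooth_sum oJ (index_enum _) xpredT s1.
have s2s := smooth_sum oJ (index_enum _) xpredT s2.
have s4 := smoothB oJ sg s1s.
rewrite (alongB _ (smoothD oJ s4 s2s) s3 Jz) (alongD _ s4 s2s Jz) (alongB _ sg s1s Jz).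
rewrite (along_sum _ _ _ s1 Jz) (along_sum _ _ _ s2 Jz) (alongM _ (sP i A) sdelta Jz).
congr (_ - _ + _ - _); apply: eq_bigr => k _; first exact: (alongM _ (sdeta A k) (sP i k) Jz).
exact: (alongM _ (sdxi k i) (sP k A) Jz).
Qed.

End NoetherTheorem.

(** * Bilinear forms on first jets *)

Section BilinearForm.
Context {R : realType} {n m : nat}.
Implicit Types (M : 'M[R]_n) (N : 'M[R]_m) (p r : 'M[R]_(n, m)).

(** The contraction M^{ij} N_AB p^A_i r^B_j, written as a trace so that its
    symmetries and adjoints are matrix identities. *)
Definition jet_form M N p r : R := \tr (p^T *m M *m r *m N^T).

Lemma jet_formE M N p r : jet_form M N p r =
  \sum_i \sum_j \sum_A \sum_B M i j * N A B * p i A * r j B.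
Proof.
rewrite /jet_form /mxtrace.
transitivity (\sum_A \sum_B \sum_i \sum_j M i j * N A B * p i A * r j B).
  apply: eq_bigr => A _; rewrite mxE; apply: eq_bigr => B _.
  rewrite [X in X * _]mxE mulr_suml [RHS]exchange_big/=; apply: eq_bigr => j _.
  rewrite [X in X * _ * _]mxE !mulr_suml; apply: eq_bigr => i _; rewrite !mxE; ring.
under eq_bigr do rewrite exchange_big/=.
rewrite exchange_big/=; apply: eq_bigr => i _.
under eq_bigr do rewrite exchange_big/=.
by rewrite exchange_big.
Qed.

Lemma jet_formDl M N p p' r : jet_form M N (p + p') r = jet_form M N p r + jet_form M N p' r.
Proof. by rewrite /jet_form linearD/= !mulmxDl linearD. Qed.

Lemma jet_formDr M N p r r' : jet_form M N p (r + r') = jet_form M N p r + jet_form M N p r'.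
Proof. by rewrite /jet_form mulmxDr mulmxDl linearD. Qed.

Lemma jet_formZl M N c p r : jet_form M N (c *: p) r = c * jet_form M N p r.
Proof. by rewrite /jet_form linearZ/= -!scalemxAl linearZ. Qed.

Lemma jet_formZr M N c p r : jet_form M N p (c *: r) = c * jet_form M N p r.
Proof. by rewrite /jet_form -scalemxAr -!scalemxAl linearZ. Qed.

Lemma jet_form0l M N r : jet_form M N 0 r = 0.
Proof. by rewrite -(scale0r 0) jet_formZl mul0r. Qed.

Lemma jet_formNl M N p r : jet_form M N (- p) r = - jet_form M N p r.
Proof. by rewrite -scaleN1r jet_formZl mulN1r. Qed.

Lemma jet_form_DM M M' N p r :
  jet_form (M + M') N p r = jet_form M N p r + jet_form M' N p r.
Proof. by rewrite /jet_form mulmxDr !mulmxDl linearD. Qed.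

Lemma jet_form_ZM c M N p r : jet_form (c *: M) N p r = c * jet_form M N p r.
Proof. by rewrite /jet_form -scalemxAr -!scalemxAl linearZ. Qed.

Lemma jet_form_DN M N N' p r :
  jet_form M (N + N') p r = jet_form M N p r + jet_form M N' p r.
Proof. by rewrite /jet_form linearD mulmxDr linearD. Qed.

Lemma jet_form_ZN c M N p r : jet_form M (c *: N) p r = c * jet_form M N p r.
Proof. by rewrite /jet_form linearZ/= -scalemxAr linearZ. Qed.

Lemma jet_form_tr M N p r : jet_form M^T N^T p r = jet_form M N r p.
Proof.
by rewrite /jet_form -[RHS]mxtrace_tr !trmx_mul !trmxK [RHS]mxtrace_mulC !mulmxA.
Qed.

Lemma jet_formC M N p r : M^T = M -> N^T = N -> jet_form M N p r = jet_form M N r p.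
Proof. by move=> sM sN; rewrite -jet_form_tr sM sN. Qed.

Lemma jet_form_mull M N X p r : jet_form M N (X *m p) r = jet_form (X^T *m M) N p r.
Proof. by rewrite /jet_form trmx_mul !mulmxA. Qed.

Lemma jet_form_mulr M N E p r : jet_form M N (p *m E) r = jet_form M (E *m N) p r.
Proof. by rewrite /jet_form !trmx_mul -!mulmxA [LHS]mxtrace_mulC !mulmxA. Qed.

Lemma jet_form_delta M N i A r :
  jet_form M N (delta_mx i A) r = \sum_j \sum_B M i j * N A B * r j B.
Proof.
rewrite jet_formE (bigD1 i)//= [X in _ + X]big1 ?addr0 => [|k ki].
  apply: eq_bigr => j _; rewrite (bigD1 A)//= [X in _ + X]big1 ?addr0 => [|B BA].
    by apply: eq_bigr => B _; rewrite mxE !eqxx mulr1.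
  by rewrite big1// => C _; rewrite mxE (negbTE BA) andbF mulr0 mul0r.
rewrite big1// => j _; rewrite big1// => B _; rewrite big1// => C _.
by rewrite mxE (negbTE ki) mulr0 mul0r.
Qed.

Lemma jet_form_delta2 M N i A j B :
  jet_form M N (delta_mx i A) (delta_mx j B) = M i j * N A B.
Proof.
rewrite jet_form_delta (bigD1 j)//= [X in _ + X]big1 ?addr0 => [|k kj].
  rewrite (bigD1 B)//= [X in _ + X]big1 ?addr0 => [|C CB].
    by rewrite mxE !eqxx mulr1.
  by rewrite mxE (negbTE CB) andbF mulr0.
by rewrite big1// => C _; rewrite mxE (negbTE kj) mulr0.
Qed.

Lemma jet_form_matrix M N p r :
  jet_form M N p r = \sum_i \sum_A p i A * (\sum_j \sum_B M i j * N A B * r j B).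
Proof.
rewrite jet_formE; apply: eq_bigr => i _; rewrite exchange_big/=; apply: eq_bigr => A _.
rewrite mulr_sumr; apply: eq_bigr => j _; rewrite mulr_sumr.
by apply: eq_bigr => B _; ring.
Qed.

(** Polarization at pairs of elementary jets. *)
Lemma jet_form_polarize M M' N N' : M^T = M -> M'^T = M' -> N^T = N -> N'^T = N' ->
  (forall p, jet_form M N p p + jet_form M' N' p p = 0) ->
  forall i j A B, M i j * N A B + M' i j * N' A B = 0.
Proof.
move=> sM sM' sN sN' H i j A B; pose p := delta_mx i A : 'M[R]_(n, m).
pose r := delta_mx j B : 'M[R]_(n, m).
have := H (p + r); rewrite !jet_formDl !jet_formDr.
rewrite [jet_form M N r p]jet_formC// [jet_form M' N' r p]jet_formC//.
have := H p; have := H r; rewrite !(jet_form_delta2 _ _ i A j B); lra.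
Qed.

Lemma mpartial_quadratic (f : 'M[R]_(n, m) -> R) i A p (c0 c1 c2 : R) :
  (forall t, f (t *: delta_mx i A + p) = c0 + c1 * t + c2 * t ^+ 2) ->
  mpartial i A f p = c1.
Proof.
pose g (v : 'rV[R]_1) := c0 + c1 * v 0 0 + c2 * (v 0 0 * v 0 0).
move=> H; transitivity (partial 0 g 0).
  by apply: derive_line => t; rewrite H /g !mxE addr0 mulr1 expr2.
have d0 : derivable (fun v : 'rV[R]_1 => v 0 0) 0 (delta_mx 0 0) by exact: derivable_coord.
have dc : derivable (fun v : 'rV[R]_1 => c0) 0 (delta_mx 0 0) by exact: derivable_cst.
have dc1 : derivable (fun v : 'rV[R]_1 => c1) 0 (delta_mx 0 0) by exact: derivable_cst.
have dc2 : derivable (fun v : 'rV[R]_1 => c2) 0 (delta_mx 0 0) by exact: derivable_cst.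
have d1 := derivable_funM dc1 d0; have d2 := derivable_funM d0 d0.
have d3 := derivable_funD dc d1; have d4 := derivable_funM dc2 d2.
rewrite /g (partialD d3 d4) (partialD dc d1) (partialZ _ d0).
rewrite (partialZ _ d2) (partialM d0 d0) partial_cst partial_coord.
by rewrite !mxE eqxx/=; ring.
Qed.

End BilinearForm.

Lemma cubic_coefficients (R : realFieldType) (c0 c1 c2 c3 : R) :
  (forall t, c0 + c1 * t + c2 * t ^+ 2 + c3 * t ^+ 3 = 0) ->
  [/\ c0 = 0, c1 = 0, c2 = 0 & c3 = 0].
Proof.
move=> H; have := H 0; have := H 1; have := H (-1); have := H 2.
by split; nra.
Qed.

(** * The Lagrangian and its derivatives *)

(** If l w <> 0, expanding the product at w + t v in powers of t shows first that
    the quadratic form vanishes at w and then that w^T M v = 0 for all v, which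
    contradicts nondegeneracy. M may be indefinite. *)
Lemma quadratic_times_linear (R : realFieldType) k (M : 'M[R]_k) (l : 'rV[R]_k) :
  M \in unitmx -> M^T = M ->
  (forall w : 'cV[R]_k, (w^T *m M *m w) 0 0 * (l *m w) 0 0 = 0) -> l = 0.
Proof.
move=> uM sM H; suff lw (w : 'cV[R]_k) : (l *m w) 0 0 = 0.
  apply/rowP => j; rewrite mxE -(lw (delta_mx j 0)) mxE (bigD1 j)//= mxE !eqxx mulr1.
  by rewrite big1 ?addr0// => i ij; rewrite mxE (negbTE ij) mulr0.
apply/eqP/negPn/negP => lw0.
suff w0 : w^T = 0 by move: lw0; rewrite -[w]trmxK w0 trmx0 mulmx0 mxE eqxx.
have wM0 : w^T *m M = 0.
  apply/rowP => j; rewrite [RHS]mxE; pose v : 'cV[R]_k := delta_mx j 0.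
  have -> : (w^T *m M) 0 j = (w^T *m M *m v) 0 0.
    rewrite [RHS]mxE (bigD1 j)//= [X in _ * X]mxE !eqxx mulr1.
    by rewrite big1 ?addr0// => i ij; rewrite [X in _ * X]mxE (negbTE ij) mulr0.
  pose q0 := (w^T *m M *m w) 0 0; pose b := (w^T *m M *m v) 0 0.
  pose q1 := (v^T *m M *m v) 0 0; pose l0 := (l *m w) 0 0; pose l1 := (l *m v) 0 0.
  have bC : (v^T *m M *m w) 0 0 = b.
    rewrite /b; transitivity ((w^T *m M *m v)^T 0 0); last by rewrite mxE.
    by rewrite !trmx_mul trmxK sM mulmxA.
  have qE t : ((w + t *: v)^T *m M *m (w + t *: v)) 0 0 = q0 + 2 * b * t + q1 * t ^+ 2.
    have -> : (w + t *: v)^T = w^T + t *: v^T by rewrite linearD linearZ.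
    rewrite !mulmxDl !mulmxDr -!scalemxAl -!scalemxAr !mxE.
    rewrite -[in LHS]/q0; move: bC; rewrite /b /q0 /q1 !mxE => bC; rewrite bC; ring.
  have lE t : (l *m (w + t *: v)) 0 0 = l0 + l1 * t.
    by rewrite mulmxDr -scalemxAr /l0 /l1 !mxE mulrC.
  have [|h0 h1 h2 h3] := @cubic_coefficients R (q0 * l0) (q0 * l1 + 2 * b * l0)
      (2 * b * l1 + q1 * l0) (q1 * l1).
    by move=> t; rewrite -(H (w + t *: v)) qE lE; ring.
  have q00 : q0 = 0 by move/eqP: h0; rewrite mulf_eq0 (negbTE lw0) orbF => /eqP.
  move/eqP: h1; rewrite q00 mul0r add0r mulf_eq0 (negbTE lw0) orbF mulf_eq0.
  by rewrite pnatr_eq0/= => /eqP.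
by rewrite -(mulmxK uM w^T) wM0 mul0mx.
Qed.

Section MatrixAlong.
Context {R : realType} {a : nat} (U : set 'rV[R]_a).
Hypothesis oU : open U.

Definition along_mx b c (v : 'rV[R]_a -> 'rV[R]_a) (F : 'rV[R]_a -> 'M[R]_(b, c)) x
    : 'M[R]_(b, c) := \matrix_(i, j) along v (fun y => F y i j) x.

Lemma alongMr v f c x : smooth U f -> U x ->
  along v (fun y => f y * c) x = along v f x * c.
Proof.
move=> sf Ux; rewrite (alongM v sf (smooth_cst _ c) Ux).
by rewrite along_cst mulr0 addr0.
Qed.

Lemma alongZ v f c x : smooth U f -> U x ->
  along v (fun y => c * f y) x = c * along v f x.
Proof.
move=> sf Ux; rewrite (alongM v (smooth_cst _ c) sf Ux).
by rewrite along_cst mul0r add0r.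
Qed.

Lemma smooth_jet_form n m (M : 'rV[R]_a -> 'M[R]_n) (N : 'rV[R]_a -> 'M[R]_m)
    (p r : 'M[R]_(n, m)) :
  (forall i j, smooth U (fun y => M y i j)) -> (forall i j, smooth U (fun y => N y i j)) ->
  smooth U (fun y => jet_form (M y) (N y) p r).
Proof.
move=> sM sN; under eq_fun do rewrite jet_formE.
apply: smooth_sum => // i; apply: smooth_sum => // j; apply: smooth_sum => // A.
apply: smooth_sum => // B; do 2![apply: smoothM => //; last exact: smooth_cst].
exact: smoothM.
Qed.

Lemma along_jet_form n m v (M : 'rV[R]_a -> 'M[R]_n) (N : 'rV[R]_a -> 'M[R]_m)
    (p r : 'M[R]_(n, m)) x :
  (forall i j, smooth U (fun y => M y i j)) -> (forall i j, smooth U (fun y => N y i j)) ->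
  U x -> along v (fun y => jet_form (M y) (N y) p r) x =
    jet_form (along_mx v M x) (N x) p r + jet_form (M x) (along_mx v N x) p r.
Proof.
move=> sM sN Ux; under eq_fun do rewrite jet_formE.
have s4 i j A B : smooth U (fun y => M y i j * N y A B * p i A * r j B).
  by do 2![apply: smoothM => //; last exact: smooth_cst]; exact: smoothM.
have s3 i j A : smooth U (fun y => \sum_B M y i j * N y A B * p i A * r j B).
  by apply: smooth_sum => // B; exact: s4.
have s2 i j : smooth U (fun y => \sum_A \sum_B M y i j * N y A B * p i A * r j B).
  by apply: smooth_sum => // A; exact: s3.
have s1 i : smooth U (fun y => \sum_j \sum_A \sum_B M y i j * N y A B * p i A * r j B).
  by apply: smooth_sum => // j; exact: s2.
rewrite !jet_formE (along_sum _ _ _ s1 Ux) -big_split/=; apply: eq_bigr => i _.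
rewrite (along_sum _ _ _ (s2 i) Ux) -big_split/=; apply: eq_bigr => j _.
rewrite (along_sum _ _ _ (s3 i j) Ux) -big_split/=; apply: eq_bigr => A _.
rewrite (along_sum _ _ _ (s4 i j A) Ux) -big_split/=; apply: eq_bigr => B _.
have sMN : smooth U (fun y => M y i j * N y A B) by exact: smoothM.
have sMNp : smooth U (fun y => M y i j * N y A B * p i A).
  by apply: smoothM => //; exact: smooth_cst.
rewrite (alongMr _ _ sMNp Ux) (alongMr _ _ sMN Ux) (alongM _ (sM i j) (sN A B) Ux).
by rewrite !mxE; ring.
Qed.

End MatrixAlong.

Section MetricDensity.
Context {R : realType} {a : nat} (U : set 'rV[R]_a) (g : 'rV[R]_a -> 'M[R]_a).
Hypotheses (oU : open U) (mg : metric U g).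

Definition dens x : 'M[R]_a := sqrtg g x *: invmx (g x).

Lemma metric_sym x : U x -> (g x)^T = g x. Proof. by case: mg => _ sg _ /sg. Qed.
Lemma metric_unit x : U x -> g x \in unitmx. Proof. by case: mg => _ _ ug /ug. Qed.
Lemma metric_smooth i j : smooth U (fun x => g x i j). Proof. by case: mg. Qed.

Lemma det_metric_neq0 x : U x -> \det (g x) != 0.
Proof. by move=> /metric_unit; rewrite unitmxE unitfE. Qed.

Lemma invmx_sym x : U x -> (invmx (g x))^T = invmx (g x).
Proof. by move=> Ux; rewrite trmx_inv metric_sym. Qed.

Lemma smooth_invg i j : smooth U (fun x => invmx (g x) i j).
Proof.
by apply: smooth_invmx => // [k l|]; [exact: metric_smooth|exact: metric_unit].
Qed.

Lemma sqrtg_gt0 x : U x -> 0 < sqrtg g x.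
Proof. by move=> Ux; rewrite sqrtr_gt0 normr_gt0 det_metric_neq0. Qed.

Lemma smooth_detg : smooth U (fun x => \det (g x)).
Proof. by apply: smooth_det => // i j; exact: metric_smooth. Qed.

Lemma smooth_sqrtg : smooth U (sqrtg g).
Proof.
apply: (@eq_smooth _ _ _ (fun x => Num.sqrt (Num.sqrt (\det (g x) * \det (g x))))) => //.
  by move=> x _; rewrite /sqrtg -expr2 sqrtr_sqr.
have d0 x : U x -> 0 < \det (g x) * \det (g x).
  by move=> Ux; rewrite -expr2 exprn_even_gt0//= det_metric_neq0.
apply: smooth_sqrt => // [x Ux|]; first by rewrite sqrtr_gt0; exact: d0.
apply: smooth_sqrt => //; apply: smoothM => //; exact: smooth_detg.
Qed.

Lemma smooth_dens i j : smooth U (fun x => dens x i j).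
Proof.
under eq_fun do rewrite mxE; apply: smoothM => //; first exact: smooth_sqrtg.
exact: smooth_invg.
Qed.

Lemma dens_sym x : U x -> (dens x)^T = dens x.
Proof. by move=> Ux; rewrite linearZ/= invmx_sym. Qed.

Lemma dens_unit x : U x -> dens x \in unitmx.
Proof.
by move=> Ux; rewrite unitmxZ ?unitmx_inv ?metric_unit// unitfE gt_eqF ?sqrtg_gt0.
Qed.

End MetricDensity.

Section LagrangianDerivatives.
Context {R : realType} {n m : nat} (U : set 'rV[R]_n) (W : set 'rV[R]_m).
Variables (g : 'rV[R]_n -> 'M[R]_n) (H : 'rV[R]_m -> 'M[R]_m).
Variable V : 'rV[R]_n -> 'rV[R]_m -> R.
Hypotheses (oU : open U) (oW : open W) (mg : metric U g) (mH : metric W H).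
Hypothesis sV : smooth2 U W V.

Let L := lagrangian g H V.
Let pot x u := sqrtg g x * V x u.

Lemma lagrangianE x u p :
  L x u p = 2^-1 * jet_form (dens g x) (H u) p p - pot x u.
Proof.
rewrite /L /lagrangian /dens jet_form_ZM jet_formE; congr (_ - _).
by rewrite -mulrA.
Qed.

Lemma smooth2_pot : smooth2 U W pot.
Proof.
apply: smoothM => //; first exact: open_product_domain.
by apply: smooth2_fst; exact: smooth_sqrtg.
Qed.

Lemma mpartial_lagrangian x u p i A : U x -> W u ->
  mpartial i A (L x u) p = \sum_j \sum_B dens g x i j * H u A B * p j B.
Proof.
move=> Ux Wu; pose d : 'M[R]_(n, m) := delta_mx i A; pose Q := jet_form (dens g x) (H u).
rewrite (@mpartial_quadratic _ _ _ _ i A p (L x u p) (Q d p) (2^-1 * Q d d)).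
  by rewrite /Q jet_form_delta.
move=> t; rewrite !lagrangianE -/d -/Q.
have QC : Q p d = Q d p by apply: jet_formC; [exact: dens_sym mg _ Ux|exact: metric_sym mH _ Wu].
by rewrite /Q !jet_formDl !jet_formDr !jet_formZl !jet_formZr -/Q QC; field.
Qed.

Lemma along_lagrangian_x v x u p : U x -> W u ->
  along v (fun y => L y u p) x =
  2^-1 * jet_form (along_mx v (dens g) x) (H u) p p - along v (pot^~ u) x.
Proof.
move=> Ux Wu; under eq_fun do rewrite lagrangianE.
have sN i j : smooth U (fun _ : 'rV[R]_n => H u i j) by exact: smooth_cst.
have sF := smooth_jet_form oU p p (smooth_dens oU mg) sN.
rewrite (alongB _ (smoothZ oU _ sF) (smooth2_slicel smooth2_pot Wu) Ux) (alongZ _ _ sF Ux).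
rewrite (along_jet_form oU v p p (smooth_dens oU mg) sN Ux).
rewrite [X in _ + jet_form _ X _ _](_ : _ = 0); last first.
  by apply/matrixP => i j; rewrite !mxE along_cst.
by rewrite -(scale0r 0) jet_form_ZN mul0r addr0.
Qed.

Lemma along_lagrangian_u v x u p : U x -> W u ->
  along v (fun w => L x w p) u =
  2^-1 * jet_form (dens g x) (along_mx v H u) p p - along v (pot x) u.
Proof.
move=> Ux Wu; under eq_fun do rewrite lagrangianE.
have sM i j : smooth W (fun _ : 'rV[R]_m => dens g x i j) by exact: smooth_cst.
have sF := smooth_jet_form oW p p sM (metric_smooth mH).
rewrite (alongB _ (smoothZ oW _ sF) (smooth2_slicer smooth2_pot Ux) Wu) (alongZ _ _ sF Wu).
rewrite (along_jet_form oW v p p sM (metric_smooth mH) Wu).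
rewrite [X in jet_form X _ _ _ + _](_ : _ = 0); last first.
  by apply/matrixP => i j; rewrite !mxE along_cst.
by rewrite -(scale0r 0) jet_form_ZM mul0r add0r.
Qed.

Lemma smooth_lagrangian : smooth (jet_domain U W) (pull1 L).
Proof.
have oJ := open_jet_domain oU oW.
have E : pull1 L = fun z => 2^-1 * jet_form (dens g (jetx z)) (H (jetu z)) (jetp z) (jetp z)
    - pull0 pot z by apply/funext => z; rewrite /pull1 lagrangianE.
rewrite E; apply: smoothB => //; last exact/smooth_pull0/smooth2_pot.
apply: smoothZ => //; under eq_fun do rewrite jet_formE.
have sp i A : smooth (jet_domain U W) (fun z => (jetp z : 'M[R]_(n, m)) i A).
  by under eq_fun do rewrite jetp_coord; exact: smooth_coord.
apply: smooth_sum => // i; apply: smooth_sum => // j; apply: smooth_sum => // A.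
apply: smooth_sum => // B; apply: smoothM => //; apply: smoothM => //; apply: smoothM => //.
- apply: (@smooth_pull0 _ _ _ U W (fun x _ => dens g x i j)).
  exact/smooth2_fst/smooth_dens.
- apply: (@smooth_pull0 _ _ _ U W (fun _ u => H u A B)).
  exact/smooth2_snd/metric_smooth.
Qed.

End LagrangianDerivatives.

(** * The homogeneous parts of the Noether identity *)

(** The index of the derivative comes first, so that a jet p acts on jacobians in u
    by multiplication from the left. *)
Definition jacobian {R : realType} {a b : nat} (v : 'rV[R]_a -> 'rV[R]_b) x : 'M[R]_(a, b) :=
  \matrix_(i, A) partial i (fun y => v y 0 A) x.

Lemma lie_metricE (R : realType) a (g : 'rV[R]_a -> 'M[R]_a) v x :
  lie_metric g v x = along_mx v g x + jacobian v x *m g x + g x *m (jacobian v x)^T.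
Proof.
apply/matrixP => i j; rewrite !mxE !big_split/=; congr (_ + _ + _);
  apply: eq_bigr => k _; rewrite !mxE// mulrC//.
Qed.

Section NoetherCoefficients.
Context {R : realType} {n m : nat} (U : set 'rV[R]_n) (W : set 'rV[R]_m).
Variables (g : 'rV[R]_n -> 'M[R]_n) (H : 'rV[R]_m -> 'M[R]_m).
Variable V : 'rV[R]_n -> 'rV[R]_m -> R.
Hypotheses (oU : open U) (oW : open W) (mg : metric U g) (mH : metric W H).
Hypothesis sV : smooth2 U W V.
Variables (xi gauge : 'rV[R]_n -> 'rV[R]_m -> 'rV[R]_n).
Variable (eta : 'rV[R]_n -> 'rV[R]_m -> 'rV[R]_m).
Variables (x : 'rV[R]_n) (u : 'rV[R]_m).
Hypotheses (Ux : U x) (Wu : W u).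

Let L := lagrangian g H V.
Let a := dens g x.
Let w y v := sqrtg g y * V y v.
Let Xx : 'M[R]_n := jacobian (xi^~ u) x.
Let Xu : 'M[R]_(m, n) := jacobian (xi x) u.
Let Ex : 'M[R]_(n, m) := jacobian (eta^~ u) x.
Let Eu : 'M[R]_m := jacobian (eta x) u.
Let Ax : R := \tr (jacobian (gauge^~ u) x).
Let Au : 'M[R]_(m, n) := jacobian (gauge x) u.

(** The Lie derivative of the tensor density sqrt g g^{ij}. *)
Definition lie_dens : 'M[R]_n :=
  along_mx (xi^~ u) (dens g) x - Xx^T *m a - a *m Xx + \tr Xx *: a.

Implicit Types p : 'M[R]_(n, m).

Let prolong1_mx p : (\matrix_(i, A) prolong1 xi eta i A x u p) =
  Ex + p *m Eu - (Xx + p *m Xu) *m p.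
Proof.
apply/matrixP => i A; rewrite !mxE /prolong1 /total0; congr (_ + _ - _).
  by apply: eq_bigr => B _; rewrite !mxE.
by apply: eq_bigr => k _; rewrite !mxE mulrC; congr (_ * _); congr (_ + _);
   apply: eq_bigr => B _; rewrite !mxE.
Qed.

Let total0_sum (v : 'rV[R]_n -> 'rV[R]_m -> 'rV[R]_n) p :
  \sum_i total0 i (fun y w => v y w 0 i) x u p =
  \tr (jacobian (v^~ u) x) + \tr (p *m jacobian (v x) u).
Proof.
rewrite /total0 big_split/= /mxtrace; congr (_ + _); apply: eq_bigr => i _; rewrite !mxE//.
by apply: eq_bigr => A _; rewrite !mxE.
Qed.

(** The parts of degree 3, 2, 1 and 0 in p of the difference of the two sides of
    the Noether identity. *)
Definition noether3 p : R :=
  2^-1 * jet_form a (H u) p p * \tr (p *m Xu) - jet_form a (H u) (p *m Xu *m p) p.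
Definition noether2 p : R :=
  2^-1 * (jet_form lie_dens (H u) p p + jet_form a (lie_metric H (eta x) u) p p).
Definition noether1 p : R :=
  jet_form a (H u) Ex p - w x u * \tr (p *m Xu) - \tr (p *m Au).
Definition noether0 : R :=
  - (along (xi^~ u) (w^~ u) x + along (eta x) (w x) u + w x u * \tr Xx + Ax).

Let sa : a^T = a. Proof. exact: dens_sym mg _ Ux. Qed.
Let sH : (H u)^T = H u. Proof. exact: metric_sym mH _ Wu. Qed.

Lemma noether_expansion p :
  act1 xi eta L x u p + L x u p * \sum_i total0 i (fun y w => xi y w 0 i) x u p
  - \sum_i total0 i (fun y w => gauge y w 0 i) x u p =
  noether0 + noether1 p + noether2 p + noether3 p.
Proof.
have -> : act1 xi eta L x u p = along (xi^~ u) (fun y => L y u p) x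
    + along (eta x) (fun w => L x w p) u
    + jet_form a (H u) (\matrix_(i, A) prolong1 xi eta i A x u p) p.
  rewrite /act1; congr (_ + _ + _); rewrite jet_form_matrix.
  apply: eq_bigr => i _; apply: eq_bigr => A _.
  by rewrite mxE (mpartial_lagrangian V mg mH p i A Ux Wu).
rewrite (along_lagrangian_x H oU oW mg sV _ p Ux Wu).
rewrite (along_lagrangian_u oU oW mg mH sV _ p Ux Wu).
have EL : L x u p = 2^-1 * jet_form a (H u) p p - w x u by exact: lagrangianE.
rewrite !total0_sum prolong1_mx EL -/a -/Xx -/Xu -/Ax -/Au.
rewrite /noether0 /noether1 /noether2 /noether3 lie_metricE /lie_dens -/Eu -/(w x u).
rewrite mulmxDl opprD !jet_formDl !jet_formNl !jet_form_mull.
rewrite !jet_form_DM !jet_form_DN jet_form_mulr.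
rewrite -[- (Xx^T *m a)]scaleN1r -[- (a *m Xx)]scaleN1r !(jet_form_ZM (-1)) (jet_form_ZM (\tr Xx)).
have -> : jet_form (a *m Xx) (H u) p p = jet_form (Xx^T *m a) (H u) p p.
  by rewrite -[LHS]jet_form_tr sH trmx_mul sa.
have -> : jet_form a (H u *m Eu^T) p p = jet_form a (Eu *m H u) p p.
  by rewrite -[LHS]jet_form_tr sa trmx_mul trmxK sH.
by field.
Qed.

(** Evaluation at all multiples t p of a jet separates the degrees. *)
Lemma noether_coefficients :
  (forall p, act1 xi eta L x u p
      + L x u p * \sum_i total0 i (fun y w => xi y w 0 i) x u p
      = \sum_i total0 i (fun y w => gauge y w 0 i) x u p) <->
  [/\ noether0 = 0, forall p, noether1 p = 0, forall p, noether2 p = 0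
    & forall p, noether3 p = 0].
Proof.
split=> [E|[E0 E1 E2 E3] p]; last first.
  by apply/eqP; rewrite -subr_eq0 noether_expansion E0 E1 E2 E3 !addr0.
suff C p : [/\ noether0 = 0, noether1 p = 0, noether2 p = 0 & noether3 p = 0].
  by split=> [|p|p|p]; [have [] := C 0|have [] := C p|have [] := C p|have [] := C p].
apply: cubic_coefficients => t; have := E (t *: p) => /eqP.
rewrite -subr_eq0 noether_expansion => /eqP <-.
rewrite /noether1 /noether2 /noether3 -!scalemxAl -!scalemxAr !jet_formZl !jet_formZr.
rewrite !mxtraceZ; ring.
Qed.

(** On a jet of rank one, p^A_i = om_i v^A, the cubic part is - 1/2 times the product
    of v^A xi^i_{,A} om_i and the quadratic forms of om and v. By
    [quadratic_times_linear], used for om and then for v, the quadratic factors can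
    be cancelled. *)
Lemma noether3P : (forall p, noether3 p = 0) -> Xu = 0.
Proof.
move=> H3.
have rank1 (om : 'cV[R]_n) (v : 'rV[R]_m) :
    (v *m Xu *m om) 0 0 * (om^T *m a *m om) 0 0 * (v *m H u *m v^T) 0 0 = 0.
  have := H3 (om *m v); rewrite /noether3.
  set c := (v *m Xu *m om) 0 0; set q := (om^T *m a *m om) 0 0; set r := (v *m H u *m v^T) 0 0.
  have E1 : v *m Xu *m om = c%:M by rewrite [LHS]mx11_scalar.
  have E2 : om^T *m a *m om = q%:M by rewrite [LHS]mx11_scalar.
  have E3 : v *m H u *m v^T = r%:M by rewrite [LHS]mx11_scalar.
  have T1 : \tr (om *m v *m Xu) = c.
    by rewrite -mulmxA mxtrace_mulC E1 mxtrace_scalar mulr1n.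
  have T2 : om *m v *m Xu *m (om *m v) = c *: (om *m v).
    rewrite (_ : om *m v *m Xu *m (om *m v) = om *m (v *m Xu *m om) *m v).
      by rewrite E1 mul_mx_scalar -scalemxAl.
    by rewrite !mulmxA.
  have T3 : jet_form a (H u) (om *m v) (om *m v) = q * r.
    rewrite /jet_form sH (_ : _ *m H u = v^T *m (om^T *m a *m om) *m (v *m H u)).
      rewrite E2 mul_mx_scalar -scalemxAl mxtraceZ mxtrace_mulC E3 mxtrace_scalar.
      by rewrite mulr1n.
    by rewrite trmx_mul !mulmxA.
  rewrite T1 T2 jet_formZl T3 => E; apply: (mulfI (x := - 2^-1 : R)); last by rewrite mulr0 -E; field.
  by rewrite oppr_eq0 invr_eq0 pnatr_eq0.
have ua : a \in unitmx by exact: dens_unit mg _ Ux.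
have uH : H u \in unitmx by exact: metric_unit mH _ Wu.
apply/matrixP => A i; rewrite [RHS]mxE.
have lin (v : 'rV[R]_m) : (v *m H u *m v^T) 0 0 != 0 -> v *m Xu = 0.
  move=> v0; apply: (quadratic_times_linear ua sa) => om.
  move/eqP: (rank1 om v); rewrite mulf_eq0 (negbTE v0) orbF => /eqP <-; exact: mulrC.
pose l : 'rV[R]_m := (Xu *m delta_mx i 0)^T.
suff l0 : l = 0.
  transitivity (l 0 A); last by rewrite l0 mxE.
  rewrite [RHS]mxE [RHS]mxE (bigD1 i)//= [X in _ * X + _]mxE !eqxx mulr1 big1 ?addr0// => j ji.
  by rewrite [X in _ * X]mxE (negbTE ji) mulr0.
apply: (quadratic_times_linear uH sH) => v.
have [->|v0] := eqVneq ((v^T *m H u *m v) 0 0) 0; first by rewrite mul0r.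
have := lin v^T; rewrite trmxK => /(_ v0) E.
have -> : l *m v = (v^T *m Xu *m delta_mx i 0)^T.
  by rewrite /l -mulmxA !trmx_mul trmxK.
by rewrite E mul0mx trmx0 [X in _ * X]mxE mulr0.
Qed.

(** Both pairs of coefficient matrices are symmetric, so polarization applies. *)
Lemma noether2P : (forall p, noether2 p = 0) <->
  forall i j A B, lie_dens i j * H u A B + a i j * lie_metric H (eta x) u A B = 0.
Proof.
split=> [H2|H2 p].
  apply: jet_form_polarize => //.
  - have aux (M T X : 'M[R]_n) c : M^T = M -> T^T = T ->
        (T - X^T *m M - M *m X + c *: M)^T = T - X^T *m M - M *m X + c *: M.
      move=> sM sT; rewrite !linearD/= !linearN/= linearZ/= !trmx_mul trmxK sM sT.
      by rewrite -!addrA; congr (_ + _); rewrite addrCA.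
    apply: aux => //; apply/matrixP => i j; rewrite !mxE.
    apply: (eq_along oU _ Ux) => y; rewrite inE => Uy.
    by rewrite -{1}(dens_sym mg Uy) mxE.
  - rewrite lie_metricE !linearD/= !trmx_mul trmxK sH.
    rewrite [(along_mx _ _ _)^T](_ : _ = along_mx (eta x) H u); last first.
      apply/matrixP => i j; rewrite !mxE; apply: (eq_along oW _ Wu) => y; rewrite inE => Wy.
      by rewrite -{1}(metric_sym mH Wy) mxE.
    by rewrite addrAC.
  - by move=> p; have := H2 p; rewrite /noether2; lra.
rewrite /noether2 !jet_formE -big_split big1 ?mulr0// => i _.
rewrite -big_split big1// => j _; rewrite -big_split big1// => A _.
rewrite -big_split big1// => B _ /=.
by rewrite -!mulrDl H2 !mul0r.
Qed.

Lemma noether1P : Xu = 0 -> (forall p, noether1 p = 0) <->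
  forall i A, partial A (fun v => gauge x v 0 i) u =
    \sum_j \sum_B a i j * H u A B * partial j (fun y => eta y u 0 B) x.
Proof.
move=> Xu0; have E i A : \sum_j \sum_B a i j * H u A B * partial j (fun y => eta y u 0 B) x
    = jet_form a (H u) Ex (delta_mx i A).
  rewrite jet_formC// jet_form_delta; apply: eq_bigr => j _; apply: eq_bigr => B _.
  by rewrite [Ex j B]mxE.
have trE p : \tr (p *m Au) = \sum_i \sum_A p i A * partial A (fun v => gauge x v 0 i) u.
  by apply: eq_bigr => i _; rewrite mxE; apply: eq_bigr => A _; rewrite mxE.
split=> [H1 i A|H1 p].
  rewrite E; have := H1 (delta_mx i A); rewrite /noether1 Xu0 mulmx0 mxtrace0 mulr0 subr0.
  move/eqP; rewrite subr_eq0 => /eqP ->; rewrite trE.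
  rewrite (bigD1 i)//= [X in _ + X]big1 ?addr0 => [|j ji].
    rewrite (bigD1 A)//= mxE !eqxx mul1r big1 ?addr0// => B BA.
    by rewrite mxE (negbTE BA) andbF mul0r.
  by rewrite big1// => B _; rewrite mxE (negbTE ji) mul0r.
rewrite /noether1 Xu0 mulmx0 mxtrace0 mulr0 subr0 trE; apply/eqP; rewrite subr_eq0.
rewrite (jet_formC _ _ sa sH) jet_form_matrix; apply/eqP.
apply: eq_bigr => i _; apply: eq_bigr => A _; rewrite H1; congr (_ * _).
by apply: eq_bigr => j _; apply: eq_bigr => B _; rewrite [Ex j B]mxE.
Qed.

End NoetherCoefficients.

(** * Determinants, divergences and Laplacians *)

Section MatrixCalculus.
Context {R : realType} {a : nat} (U : set 'rV[R]_a).
Hypothesis oU : open U.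
Implicit Types (v : 'rV[R]_a -> 'rV[R]_a) (x : 'rV[R]_a).

Lemma along_delta k f x : along (fun=> delta_mx 0 k) f x = partial k f x.
Proof.
rewrite /along (bigD1 k)//= mxE !eqxx mul1r big1 ?addr0// => j jk.
by rewrite mxE (negbTE jk) andbF mul0r.
Qed.

Lemma along_mxM b c d v (F : 'rV[R]_a -> 'M[R]_(b, c)) (G : 'rV[R]_a -> 'M[R]_(c, d)) x :
  (forall i j, smooth U (fun y => F y i j)) -> (forall i j, smooth U (fun y => G y i j)) ->
  U x -> along_mx v (fun y => F y *m G y) x =
    along_mx v F x *m G x + F x *m along_mx v G x.
Proof.
move=> sF sG Ux; apply/matrixP => i j; rewrite !mxE.
have s k : smooth U (fun y => F y i k * G y k j) by exact: smoothM.
under [in LHS]eq_fun do rewrite mxE.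
rewrite (along_sum _ _ _ s Ux) -big_split/=; apply: eq_bigr => k _.
by rewrite (alongM _ (sF i k) (sG k j) Ux) !mxE.
Qed.

Lemma along_prod v (I : eqType) (r : seq I) (f : I -> 'rV[R]_a -> R) x : uniq r ->
  (forall i, smooth U (f i)) -> U x ->
  along v (fun y => \prod_(i <- r) f i y) x =
  \sum_(i <- r) along v (f i) x * \prod_(j <- r | j != i) f j x.
Proof.
move=> ur sf Ux; elim: r ur => [_|i r IH /= /andP[ir ur]].
  by rewrite big_nil; under eq_fun do rewrite big_nil; exact: along_cst.
under eq_fun do rewrite big_cons.
have sr : smooth U (fun y => \prod_(i <- r) f i y) by exact: smooth_prod.
rewrite (alongM _ (sf i) sr Ux) (IH ur) big_cons big_cons eqxx/=; congr (_ * _ + _).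
  rewrite big_seq [RHS]big_seq_cond; apply: eq_bigl => j.
  by case: (boolP (j \in r)) => //= jr; apply/esym; apply: contraNneq ir => <-.
rewrite mulr_sumr; apply: eq_big_seq => j jr.
rewrite big_cons ifT; last by apply: contraNneq ir => ->.
by rewrite mulrCA.
Qed.

(** Jacobi's formula: differentiating the rows one at a time gives determinants
    that expand along the differentiated row. *)
Lemma along_det b v (F : 'rV[R]_a -> 'M[R]_b) x :
  (forall i j, smooth U (fun y => F y i j)) -> U x ->
  along v (fun y => \det (F y)) x = \tr (\adj (F x) *m along_mx v F x).
Proof.
move=> sF Ux.
have sP (s : 'S_b) : smooth U (fun y => \prod_i F y i (s i)) by exact: smooth_prod.
have sS (s : 'S_b) : smooth U (fun y => (-1) ^+ s * \prod_i F y i (s i)) by exact: smoothZ.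
rewrite /determinant (along_sum _ _ _ sS Ux).
pose G i : 'M[R]_b := \matrix_(k, l) if k == i then along_mx v F x k l else F x k l.
transitivity (\sum_i \det (G i)).
  rewrite /determinant [RHS]exchange_big/=; apply: eq_bigr => s _.
  rewrite (alongZ _ _ (sP s) Ux) (along_prod _ (index_enum_uniq _) (fun i => sF i (s i)) Ux).
  rewrite mulr_sumr; apply: eq_bigr => i _; congr (_ * _).
  rewrite [RHS](bigD1 i)//= !mxE eqxx; congr (_ * _).
  by apply: eq_bigr => j ji; rewrite mxE (negbTE ji).
rewrite mxtrace_mulC /mxtrace; apply: eq_bigr => i _.
rewrite (expand_det_row _ i) mxE; apply: eq_bigr => j _.
rewrite mxE eqxx; congr (_ * _); rewrite mxE /cofactor; congr (_ * \det _).
by apply/matrixP => k l; rewrite !mxE eq_sym (negbTE (neq_lift _ _)).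
Qed.

Lemma along_mxZ b c v f (F : 'rV[R]_a -> 'M[R]_(b, c)) x : smooth U f ->
  (forall i j, smooth U (fun y => F y i j)) -> U x ->
  along_mx v (fun y => f y *: F y) x = along v f x *: F x + f x *: along_mx v F x.
Proof.
move=> sf sF Ux; apply/matrixP => i j; rewrite !mxE.
by under [in LHS]eq_fun do rewrite mxE; rewrite (alongM _ sf (sF i j) Ux).
Qed.

End MatrixCalculus.

Section MetricCalculus.
Context {R : realType} {a : nat} (U : set 'rV[R]_a) (g : 'rV[R]_a -> 'M[R]_a).
Hypotheses (oU : open U) (mg : metric U g).
Implicit Types (v : 'rV[R]_a -> 'rV[R]_a) (x : 'rV[R]_a).

Lemma along_invg v x : U x ->
  along_mx v (fun y => invmx (g y)) x =
  - (invmx (g x) *m along_mx v g x *m invmx (g x)).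
Proof.
move=> Ux; have ug := metric_unit mg Ux.
have := along_mxM oU v (smooth_invg oU mg) (metric_smooth mg) Ux.
rewrite (_ : along_mx v _ x = 0); last first.
  apply/matrixP => i j; rewrite !mxE.
  rewrite (@eq_along _ _ U oU v _ (fun=> (1%:M : 'M[R]_a) i j) x Ux) ?along_cst//.
  by move=> y; rewrite inE => Uy; rewrite (mulVmx (metric_unit mg Uy)).
move/esym/(canRL (addrK _)); rewrite sub0r => E.
by rewrite -mulNmx -E mulmxK.
Qed.

(** Differentiating sqrt(g)^4 = det(g)^2 avoids the absolute value. *)
Lemma along_sqrtg v x : U x ->
  along v (sqrtg g) x = 2^-1 * sqrtg g x * \tr (invmx (g x) *m along_mx v g x).
Proof.
move=> Ux; pose d y := \det (g y); pose s := sqrtg g.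
have sd : smooth U d by exact: smooth_detg.
have ss : smooth U s by exact: smooth_sqrtg.
have sss : smooth U (fun y => s y * s y) by exact: smoothM.
have E y : s y * s y * (s y * s y) = d y * d y.
  by rewrite /s /sqrtg -!expr2 sqr_sqrtr ?normr_ge0// real_normK ?num_real.
have s0 : s x != 0 by rewrite gt_eqF ?(sqrtg_gt0 mg Ux).
have d0 : d x != 0 by exact: (det_metric_neq0 mg Ux).
have := congr1 (fun f => along v f x) (funext E).
rewrite (alongM _ sss sss Ux) (alongM _ ss ss Ux) (alongM _ sd sd Ux).
rewrite {1 2}(along_det oU v (metric_smooth mg) Ux).
rewrite (_ : \adj (g x) = d x *: invmx (g x)); last first.
  by rewrite /invmx (metric_unit mg Ux) scalerA mulfV ?scale1r.
rewrite -scalemxAl mxtraceZ; set T := \tr _; set s' := along v s x => E'.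
have c0 : 4 * s x ^+ 3 != 0 by rewrite mulf_neq0 ?expf_neq0// pnatr_eq0.
apply: (mulfI c0).
transitivity ((s' * s x + s x * s') * (s x * s x) + s x * s x * (s' * s x + s x * s')).
  by rewrite /s'; ring.
rewrite E'; transitivity (2 * T * (d x * d x)); first by ring.
by rewrite -E -/s; field.
Qed.

Lemma along_dens v x : U x -> along_mx v (dens g) x =
  sqrtg g x *: (2^-1 * \tr (invmx (g x) *m along_mx v g x) *: invmx (g x)
    - invmx (g x) *m along_mx v g x *m invmx (g x)).
Proof.
move=> Ux.
rewrite (along_mxZ v (smooth_sqrtg oU mg) (smooth_invg oU mg) Ux).
rewrite along_sqrtg// along_invg// scalerBr scalerA scalerN; congr (_ *: _ - _).
by ring.
Qed.

Lemma sum_christoffel l x : U x ->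
  \sum_k christoffel g k k l x =
  2^-1 * \tr (invmx (g x) *m along_mx (fun=> delta_mx 0 l) g x).
Proof.
move=> Ux; rewrite /christoffel.
pose h i j := invmx (g x) i j; have hC i j : h i j = h j i.
  by rewrite /h -{1}(invmx_sym mg Ux) mxE.
transitivity (\sum_k \sum_r 2^-1 * (h k r * partial l (fun y => g y r k) x)
  + (\sum_k \sum_r 2^-1 * (h k r * partial k (fun y => g y r l) x)
     - \sum_k \sum_r 2^-1 * (h k r * partial r (fun y => g y k l) x))).
  rewrite -sumrB -big_split/=; apply: eq_bigr => k _; rewrite -sumrB -big_split/= mulr_sumr.
  by apply: eq_bigr => r _; rewrite /h; ring.
rewrite [X in _ + (_ - X)]exchange_big/= -sumrB [X in _ + X]big1 ?addr0 => [|k _]; last first.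
  by rewrite -sumrB big1// => r _; rewrite hC subrr.
rewrite /mxtrace mulr_sumr; apply: eq_bigr => k _; rewrite mxE mulr_sumr.
by apply: eq_bigr => r _; rewrite mxE along_delta.
Qed.

(** The trace of the Christoffel symbols is the logarithmic derivative of
    sqrt g. *)
Lemma divergence_density Z x : vsmooth U Z -> U x ->
  \sum_k partial k (fun y => sqrtg g y * Z y 0 k) x = sqrtg g x * divergence g Z x.
Proof.
move=> sZ Ux; rewrite /divergence big_split/= mulrDr.
rewrite [X in _ = _ + _ * X]exchange_big/= !mulr_sumr -big_split/=.
apply: eq_bigr => l _; rewrite -mulr_suml sum_christoffel// -along_delta.
rewrite (alongM _ (smooth_sqrtg oU mg) (sZ l) Ux) along_sqrtg// along_delta.
ring.
Qed.

Lemma vsmooth_grad f : smooth U f -> vsmooth U (grad g f).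
Proof.
move=> sf k; under eq_fun do rewrite mxE; apply: smooth_sum => // l.
by apply: smoothM => //; [exact: smooth_invg|exact: smooth_partial].
Qed.

(** The derivative of the inverse metric in the gradient and the trace of the
    Christoffel symbols in the divergence add up to - g^{ij} Gamma^k_ij. *)
Lemma divergence_grad f x : smooth U f -> U x ->
  divergence g (grad g f) x = laplacian g f x.
Proof.
move=> sf Ux; pose h i j := invmx (g x) i j; pose dg l := along_mx (fun=> delta_mx 0 l) g x.
have hC i j : h i j = h j i by rewrite /h -{1}(invmx_sym mg Ux) mxE.
have dgE l i j : dg l i j = partial l (fun y => g y i j) x by rewrite mxE along_delta.
have dh k i j : partial k (fun y => invmx (g y) i j) x =
    - \sum_r \sum_q h i q * dg k q r * h r j.
  have := along_invg (fun=> delta_mx 0 k) Ux => /matrixP/(_ i j).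
  rewrite mxE along_delta => ->; rewrite !mxE; congr (- _); apply: eq_bigr => r _.
  by rewrite mxE mulr_suml.
have E1 : divergence g (grad g f) x =
    \sum_k \sum_l (h k l * partial k (partial l f) x)
    - \sum_k \sum_l \sum_r \sum_q h k q * dg k q r * h r l * partial l f x
    + \sum_l \sum_j 2^-1 * \tr (invmx (g x) *m dg l) * (h l j * partial j f x).
  rewrite /divergence big_split/=; congr (_ + _); last first.
    rewrite exchange_big/=; apply: eq_bigr => l _; rewrite -mulr_suml sum_christoffel//.
    by rewrite mxE mulr_sumr.
  rewrite -sumrB; apply: eq_bigr => k _; rewrite -sumrB.
  under [in LHS]eq_fun do rewrite mxE.
  rewrite partial_sum => [|l]; last first.
    apply: (smooth_derivable (U := U)) Ux; apply: smoothM => //; first exact: smooth_invg.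
    exact: smooth_partial.
  apply: eq_bigr => l _; rewrite partialM; last 2 first.
  - exact: (smooth_derivable (smooth_invg oU mg k l) Ux).
  - exact: (smooth_derivable (smooth_partial l sf) Ux).
  rewrite dh addrC mulNr; congr (_ - _); rewrite mulr_suml; apply: eq_bigr => r _.
  by rewrite mulr_suml.
rewrite {}E1 /laplacian.
have -> : \sum_i \sum_j invmx (g x) i j * (partial j (partial i f) x
      - \sum_k christoffel g k i j x * partial k f x) =
    \sum_i \sum_j h i j * partial i (partial j f) x
    - \sum_k partial k f x * \sum_i \sum_j h i j * christoffel g k i j x.
  under [X in _ = _ - X]eq_bigr do rewrite mulr_sumr.
  rewrite [X in _ = _ - X]exchange_big/= -sumrB; apply: eq_bigr => i _.
  under [X in _ = _ - X]eq_bigr do rewrite mulr_sumr.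
  rewrite [X in _ = _ - X]exchange_big/= -sumrB; apply: eq_bigr => j _.
  rewrite mulrBr (partialC j i oU Ux sf); congr (_ - _); rewrite mulr_sumr.
  by apply: eq_bigr => k _; rewrite /h; ring.
rewrite -addrA; congr (_ + _).
have T1 : \sum_k \sum_l \sum_r \sum_q h k q * dg k q r * h r l * partial l f x =
    \sum_l partial l f x * \sum_r h l r * \sum_k \sum_q h k q * dg k q r.
  rewrite exchange_big/=; apply: eq_bigr => l _; rewrite exchange_big/= mulr_sumr.
  apply: eq_bigr => r _; rewrite mulr_sumr mulr_sumr; apply: eq_bigr => k _.
  rewrite mulr_sumr mulr_sumr; apply: eq_bigr => q _; rewrite (hC l r); ring.
have T2 : \sum_l \sum_j 2^-1 * \tr (invmx (g x) *m dg l) * (h l j * partial j f x) =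
    \sum_j partial j f x * \sum_l h j l * (2^-1 * \tr (invmx (g x) *m dg l)).
  rewrite exchange_big/=; apply: eq_bigr => j _; rewrite mulr_sumr.
  by apply: eq_bigr => l _; rewrite (hC j l); ring.
rewrite {}T1 {}T2 addrC -sumrB -sumrN; apply: eq_bigr => k _.
rewrite -mulrBr -mulrN; congr (_ * _); apply/esym.
have dgS l i j : dg l i j = dg l j i.
  rewrite !dgE; apply: open_eq_partial oU Ux _ => y; rewrite inE => Uy.
  by rewrite -{1}(metric_sym mg Uy) mxE.
have trE l : \tr (invmx (g x) *m dg l) = \sum_i \sum_j h i j * dg l i j.
  rewrite /mxtrace; apply: eq_bigr => i _; rewrite mxE; apply: eq_bigr => j _.
  by rewrite (dgS l i j).
have S1 l : \sum_i \sum_j h i j * dg j l i = \sum_i \sum_j h i j * dg i j l.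
  rewrite exchange_big/=; apply: eq_bigr => i _; apply: eq_bigr => j _.
  by rewrite (hC j i) (dgS i l j).
have S2 l : \sum_i \sum_j h i j * dg i l j = \sum_i \sum_j h i j * dg i j l.
  by apply: eq_bigr => i _; apply: eq_bigr => j _; rewrite (dgS i l j).
transitivity (- \sum_l h k l * (2^-1 * (\sum_i \sum_j h i j * dg i l j
    + \sum_i \sum_j h i j * dg j l i - \sum_i \sum_j h i j * dg l i j))).
  congr (- _); under [RHS]eq_bigr do
    (rewrite -big_split -sumrB/= !mulr_sumr; under eq_bigr do rewrite -big_split -sumrB/= !mulr_sumr).
  rewrite exchange_big/=; under [RHS]eq_bigr do rewrite exchange_big/=.
  rewrite [RHS]exchange_big/=; apply: eq_bigr => j _.
  rewrite [RHS]exchange_big/=; apply: eq_bigr => i _.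
  rewrite /christoffel !mulr_sumr; apply: eq_bigr => l _; rewrite !dgE /h; ring.
rewrite -sumrN -sumrB; apply: eq_bigr => l _; rewrite S1 S2 trE; by field.
Qed.

End MetricCalculus.

(** * Conformal fields and the Noether system *)

Section LieMetric.
Context {R : realType} {a : nat} (U : set 'rV[R]_a) (g : 'rV[R]_a -> 'M[R]_a).
Hypothesis oU : open U.
Implicit Types (v w : 'rV[R]_a -> 'rV[R]_a).

Lemma eq_lie_metric v w x : (forall y, U y -> v y = w y) -> U x ->
  lie_metric g v x = lie_metric g w x.
Proof.
move=> vw Ux; apply/matrixP => i j; rewrite !mxE; apply: eq_bigr => k _.
have E l : partial l (fun y => v y 0 k) x = partial l (fun y => w y 0 k) x.
  by apply: open_eq_partial oU Ux _ => y; rewrite inE => /vw ->.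
by rewrite vw// !E.
Qed.

Lemma lie_metric_linear c v w x : vsmooth U v -> vsmooth U w -> U x ->
  lie_metric g (fun y => c *: v y + w y) x = c *: lie_metric g v x + lie_metric g w x.
Proof.
move=> sv sw Ux; apply/matrixP => i j; rewrite !mxE mulr_sumr -big_split/=.
apply: eq_bigr => k _.
have E l : partial l (fun y => (c *: v y + w y) 0 k) x =
    c * partial l (fun y => v y 0 k) x + partial l (fun y => w y 0 k) x.
  under eq_fun do rewrite !mxE.
  have dv : derivable (fun y => v y 0 k) x (delta_mx 0 l) := smooth_derivable (sv k) Ux.
  have dw : derivable (fun y => w y 0 k) x (delta_mx 0 l) := smooth_derivable (sw k) Ux.
  have dcv := smooth_derivable (i := l) (smoothZ oU c (sv k)) Ux.
  by rewrite (partialD dcv dw) (partialZ c dv).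
rewrite !E !mxE; ring.
Qed.

Lemma smooth_lie_metric v : (forall i j, smooth U (fun x => g x i j)) -> vsmooth U v ->
  forall i j, smooth U (fun x => lie_metric g v x i j).
Proof.
move=> sg sv i j; under eq_fun do rewrite mxE; apply: smooth_sum => // k.
by apply: smoothD => //; [apply: smoothD => //|]; apply: smoothM => //; exact: smooth_partial.
Qed.

Lemma eq_homothetic v w c : (forall y, U y -> v y = w y) ->
  homothetic U g v c -> homothetic U g w c.
Proof. by move=> vw hv x Ux; rewrite -hv//; apply/esym/eq_lie_metric. Qed.

Lemma homothetic_linear c v w d e : vsmooth U v -> vsmooth U w ->
  homothetic U g v d -> homothetic U g w e ->
  homothetic U g (fun y => c *: v y + w y) (c * d + e).
Proof.
move=> sv sw hv hw x Ux; rewrite lie_metric_linear// hv// hw// scalerA -scalerDl.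
by congr (_ *: _); ring.
Qed.

Lemma homothetic0 : homothetic U g (fun=> 0) 0.
Proof.
move=> x Ux; apply/matrixP => i j; rewrite !mxE mulr0 mul0r big1// => k _.
by rewrite !mxE !partial_cst !mulr0 mul0r !addr0.
Qed.

End LieMetric.

Section Conformal.
Context {R : realType} {n m : nat} (U : set 'rV[R]_n) (g : 'rV[R]_n -> 'M[R]_n).
Hypotheses (oU : open U) (mg : metric U g).
Variable xi : 'rV[R]_n -> 'rV[R]_m -> 'rV[R]_n.

Lemma lie_densE x u : U x -> lie_dens g xi x u = sqrtg g x *:
  (2^-1 * \tr (invmx (g x) *m lie_metric g (xi^~ u) x) *: invmx (g x)
   - invmx (g x) *m lie_metric g (xi^~ u) x *m invmx (g x)).
Proof.
move=> Ux; have ug := metric_unit mg Ux.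
rewrite /lie_dens (along_dens oU mg _ Ux) lie_metricE /dens.
set h := invmx (g x); set dg := along_mx _ _ _; set X := jacobian _ _; set s := sqrtg g x.
have E1 : h *m (dg + X *m g x + g x *m X^T) *m h = h *m dg *m h + h *m X + X^T *m h.
  rewrite !mulmxDr !mulmxDl -!mulmxA mulmxV// mulmx1 (mulmxA h (g x)) mulVmx//.
  by rewrite mul1mx.
have E2 : \tr (h *m (dg + X *m g x + g x *m X^T)) = \tr (h *m dg) + 2 * \tr X.
  rewrite !mulmxDr !linearD/= (mulmxA h (g x)) mulVmx// mul1mx mxtrace_tr.
  by rewrite (mxtrace_mulC h (X *m g x)) -mulmxA mulmxV// mulmx1; ring.
rewrite E1 E2; apply/matrixP => i j; rewrite -scalemxAl -scalemxAr !mxE.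
by field.
Qed.

(** The trace formula is smooth for every smooth field, conformal or not. *)
Definition conformal_factor (v : 'rV[R]_n -> 'rV[R]_n) x : R :=
  \tr (invmx (g x) *m lie_metric g v x) / (2 * n%:R).

Lemma smooth_conformal_factor v : vsmooth U v -> smooth U (conformal_factor v).
Proof.
move=> sv; apply: smoothM => //; last exact: smooth_cst.
apply: smooth_sum => // i; under eq_fun do rewrite mxE; apply: smooth_sum => // k.
apply: smoothM => //; first exact: smooth_invg.
apply: smooth_lie_metric => //; exact: metric_smooth.
Qed.

(** Contracting with g over the x-indices determines the change N of H, with a
    factor that only depends on x; a nonzero entry of H then determines the change
    of the density, hence of g. *)
Lemma noether_conformal (N h : 'M[R]_m) x u : (0 < n)%N -> (0 < m)%N ->
    h \in unitmx -> U x ->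
    (forall i j A B, lie_dens g xi x u i j * h A B + dens g x i j * N A B = 0) ->
  lie_metric g (xi^~ u) x = (2 * conformal_factor (xi^~ u) x) *: g x /\
  N = ((2 - n%:R) * conformal_factor (xi^~ u) x) *: h.
Proof.
move=> n0 m0 uh Ux H; have ug := metric_unit mg Ux.
have nR : n%:R != 0 :> R by rewrite pnatr_eq0 -lt0n.
have s0 : sqrtg g x != 0 by rewrite gt_eqF ?(sqrtg_gt0 mg Ux).
set psi := conformal_factor _ _; set Lg := lie_metric _ _ _; set ginv := invmx (g x).
have trE : \tr (ginv *m Lg) = 2 * n%:R * psi.
  rewrite /psi /conformal_factor mulrC divfK// mulf_neq0// pnatr_eq0//.
pose S := (n%:R * psi) *: ginv - ginv *m Lg *m ginv.
have LE : lie_dens g xi x u = sqrtg g x *: S.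
  by rewrite lie_densE// trE /S; congr (_ *: (_ *: _ - _)); field.
have H' i j A B : S i j * h A B + ginv i j * N A B = 0.
  apply: (mulfI s0); rewrite mulr0 -(H i j A B) LE /dens.
  rewrite [(_ *: S) _ _]mxE [(_ *: invmx _) _ _]mxE -/ginv; ring.
have NE : N = ((2 - n%:R) * psi) *: h.
  apply/matrixP => A B; rewrite [RHS]mxE.
  have : \sum_i \sum_j g x i j * (S j i * h A B + ginv j i * N A B) = 0.
    by rewrite big1// => i _; rewrite big1// => j _; rewrite H' mulr0.
  have trS (T : 'M[R]_n) : \sum_i \sum_j g x i j * T j i = \tr (g x *m T).
    by apply: eq_bigr => i _; rewrite mxE.
  have -> : \sum_i \sum_j g x i j * (S j i * h A B + ginv j i * N A B) =
      \tr (g x *m S) * h A B + \tr (g x *m ginv) * N A B.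
    rewrite -!trS !mulr_suml -big_split; apply: eq_bigr => i _ /=.
    rewrite !mulr_suml -big_split; apply: eq_bigr => j _ /=; ring.
  rewrite /S mulmxBr linearB/= -scalemxAr linearZ/= -(mulmxA ginv) (mulmxA (g x)).
  rewrite mulmxV// mul1mx mxtrace1 mxtrace_mulC trE => E.
  apply: (mulfI nR); apply/eqP; rewrite -subr_eq0; apply/eqP.
  by rewrite -[RHS]E; ring.
split=> //.
have [[A B] /= hAB] : exists AB : 'I_m * 'I_m, h AB.1 AB.2 != 0.
  apply: contrapT => nh; have h0 : h = 0.
    apply/matrixP => A B; rewrite [RHS]mxE; apply/eqP/negPn/negP => hAB.
    by apply: nh; exists (A, B).
  have := mulmxV uh; rewrite h0 mul0mx => /matrixP/(_ (Ordinal m0) (Ordinal m0)).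
  by rewrite !mxE eqxx => /eqP; rewrite eq_sym oner_eq0.
have SE : S = ((n%:R - 2) * psi) *: ginv.
  apply/matrixP => i j; apply: (mulIf hAB); have := H' i j A B.
  rewrite NE [(_ *: h) _ _]mxE [(_ *: ginv) _ _]mxE => /eqP; rewrite addr_eq0 => /eqP ->.
  ring.
have E : ginv *m Lg *m ginv = (2 * psi) *: ginv.
  have -> : ginv *m Lg *m ginv = (n%:R * psi) *: ginv - S by rewrite /S opprB addrC subrK.
  by rewrite SE -scalerBl; congr (_ *: _); ring.
have -> : Lg = g x *m (ginv *m Lg *m ginv) *m g x.
  by rewrite !mulmxA mulmxV// mul1mx -mulmxA mulVmx// mulmx1.
by rewrite E -scalemxAr mulmxV// -scalemxAl mul1mx.
Qed.

Lemma lie_dens_conformal psi x u : U x ->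
  lie_metric g (xi^~ u) x = (2 * psi) *: g x ->
  lie_dens g xi x u = ((n%:R - 2) * psi) *: dens g x.
Proof.
move=> Ux E; have ug := metric_unit mg Ux.
rewrite lie_densE// E -scalemxAr mulVmx// linearZ/= mxtrace1 -scalemxAl mul1mx -scalerBl.
by rewrite /dens !scalerA; congr (_ *: _); field.
Qed.

End Conformal.

Section NoetherSystem.
Context {R : realType} {n m : nat} (U : set 'rV[R]_n) (W : set 'rV[R]_m).
Variables (g : 'rV[R]_n -> 'M[R]_n) (H : 'rV[R]_m -> 'M[R]_m).
Variable V : 'rV[R]_n -> 'rV[R]_m -> R.
Hypotheses (n0 : (0 < n)%N) (m0 : (0 < m)%N).
Hypotheses (oU : open U) (oW : open W) (mg : metric U g) (mH : metric W H).
Hypothesis sV : smooth2 U W V.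

Implicit Types (xi : 'rV[R]_n -> 'rV[R]_n) (psi : 'rV[R]_n -> R).
Implicit Types (eta : 'rV[R]_n -> 'rV[R]_m -> 'rV[R]_m).
Implicit Types (Z : 'rV[R]_n -> 'rV[R]_m -> 'rV[R]_n).

(** The linear part of the Noether identity, with Z the gauge field divided by
    sqrt g. *)
Definition gauge_equation eta Z : Prop := forall x u i A, U x -> W u ->
  partial A (fun v => Z x v 0 i) u =
  \sum_j \sum_B invmx (g x) i j * H u A B * partial j (fun y => eta y u 0 B) x.

(** What the Noether identity requires when xi depends on x only: the quadratic
    part, separated into its effects on g and H, the linear part, and the part of
    degree zero. *)
Definition noether_system xi psi eta Z : Prop :=
  [/\ conformal U g xi psi,
      forall x u, U x -> W u -> lie_metric H (eta x) u = ((2 - n%:R) * psi x) *: H u,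
      gauge_equation eta Z
    & forall x u, U x -> W u ->
        along xi (V^~ u) x + n%:R * psi x * V x u + along (eta x) (V x) u
        + divergence g (Z^~ u) x = 0].

Let noether0E (xi gauge Z : 'rV[R]_n -> 'rV[R]_m -> 'rV[R]_n) eta x u : U x -> W u ->
    vsmooth U (Z^~ u) -> (forall y, U y -> gauge y u = sqrtg g y *: Z y u) ->
  noether0 g V xi gauge eta x u = - (sqrtg g x * (along (xi^~ u) (V^~ u) x
    + 2^-1 * \tr (invmx (g x) *m lie_metric g (xi^~ u) x) * V x u
    + along (eta x) (V x) u + divergence g (Z^~ u) x)).
Proof.
move=> Ux Wu sZ gZ; rewrite /noether0; congr (- _).
have ss := smooth_sqrtg oU mg.
rewrite (alongM _ ss (smooth2_slicel sV Wu) Ux) (alongZ _ _ (smooth2_slicer sV Ux) Wu).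
have -> : \tr (jacobian (gauge^~ u) x) = sqrtg g x * divergence g (Z^~ u) x.
  rewrite -(divergence_density oU mg sZ Ux); apply: eq_bigr => k _; rewrite mxE.
  by apply: open_eq_partial oU Ux _ => y; rewrite inE => Uy; rewrite gZ// mxE.
rewrite (along_sqrtg oU mg _ Ux) lie_metricE !mulmxDr !linearD/=.
have ug := metric_unit mg Ux.
rewrite (mulmxA _ (g x)) mulVmx// mul1mx mxtrace_tr (mxtrace_mulC _ (_ *m g x)).
by rewrite -mulmxA mulmxV// mulmx1; field.
Qed.

Lemma noether_of_system xi psi eta Z :
    vsmooth U xi -> vsmooth2 U W eta -> vsmooth2 U W Z ->
    noether_system xi psi eta Z ->
  noether_point_symmetry U W (lagrangian g H V) (fun x _ => xi x) eta
    (fun x u => sqrtg g x *: Z x u).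
Proof.
move=> sxi seta sZ [cxi ceta cZ c0]; have oD := open_product_domain oU oW.
have Xu0 x u : jacobian (fun _ : 'rV[R]_m => xi x) u = 0.
  by apply/matrixP => A i; rewrite !mxE partial_cst.
have id : forall x u (p : 'M[R]_(n, m)), U x -> W u ->
  act1 (fun x _ => xi x) eta (lagrangian g H V) x u p
  + lagrangian g H V x u p * \sum_i total0 i (fun y (w : 'rV[R]_m) => xi y 0 i) x u p
  = \sum_i total0 i (fun y w => (sqrtg g y *: Z y w) 0 i) x u p.
  move=> x u p Ux Wu.
  apply: (proj2 (@noether_coefficients _ _ _ U W g H V oU oW mg mH sV
    (fun x _ => xi x) (fun x u => sqrtg g x *: Z x u) eta x u Ux Wu)).
  split.
  - have sZu : vsmooth U (Z^~ u) by move=> k; exact: (smooth2_slicel (sZ k) Wu).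
    rewrite (@noether0E (fun x _ => xi x) (fun x u => sqrtg g x *: Z x u) Z eta x u Ux Wu
      sZu (fun _ _ => erefl)).
    rewrite cxi// -scalemxAr mulVmx ?(metric_unit mg Ux)// mxtraceZ mxtrace1.
    apply/eqP; rewrite oppr_eq0; apply/eqP.
    transitivity (sqrtg g x * 0); last exact: mulr0.
    by congr (_ * _); rewrite -(c0 x u Ux Wu); congr (_ + _ * _ + _ + _); field.
  - apply/(noether1P V mg mH _ _ Ux Wu (Xu0 x u)) => i A.
    under eq_fun do rewrite mxE.
    rewrite (partialZ _ (smooth2_derivabler (sZ i) Ux Wu)) cZ// mulr_sumr.
    apply: eq_bigr => j _; rewrite mulr_sumr; apply: eq_bigr => B _.
    by rewrite [dens g x i j]mxE !mulrA.
  - apply/(noether2P oU oW mg mH _ _ Ux Wu) => i j A B.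
    rewrite (@lie_dens_conformal _ _ m _ _ oU mg _ (psi x)) ?cxi// ceta// !mxE; ring.
  - by move=> q; rewrite /noether3 Xu0 !mulmx0 mul0mx mxtrace0 mulr0 jet_form0l subr0.
split; last exact: id.
apply: (lie_of_noether_identity oU oW _ sxi seta _ id).
  exact: smooth_lagrangian.
move=> k; under eq_fun do (under eq_fun do rewrite mxE).
apply: smoothM => //; last exact: (sZ k).
exact: (@smooth2_fst _ _ _ U W (sqrtg g) (smooth_sqrtg oU mg)).
Qed.

Hypotheses (cW : connected W) (W0 : W !=set0).

(** The cubic part makes the u-derivatives of xi vanish, and W is connected. *)
Lemma system_of_noether (xi gauge : 'rV[R]_n -> 'rV[R]_m -> 'rV[R]_n) eta :
    vsmooth2 U W xi -> vsmooth2 U W eta -> vsmooth2 U W gauge ->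
    noether_point_symmetry U W (lagrangian g H V) xi eta gauge ->
  exists xi0 psi Z, [/\ vsmooth U xi0, smooth U psi, vsmooth2 U W Z,
    noether_system xi0 psi eta Z
    & forall x u, U x -> W u -> xi x u = xi0 x /\ gauge x u = sqrtg g x *: Z x u].
Proof.
move=> sxi seta sgauge [_ id]; have oD := open_product_domain oU oW.
have [u0 Wu0] := W0.
have coef x u (Ux : U x) (Wu : W u) := proj1 (@noether_coefficients _ _ _ U W g H V oU oW
  mg mH sV xi gauge eta x u Ux Wu) (fun p => id x u p Ux Wu).
have Xu0 x u : U x -> W u -> jacobian (xi x) u = 0.
  move=> Ux Wu; have [_ _ _] := coef x u Ux Wu.
  exact: (noether3P mg mH Ux Wu).
pose xi0 x := xi x u0.
have xiE x u : U x -> W u -> xi x u = xi0 x.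
  move=> Ux Wu; apply/rowP => k.
  apply: (@constant_partials _ _ W (fun v => xi x v 0 k) oW cW) => // A v Wv.
    exact: (smooth2_derivabler (sxi k) Ux Wv).
  by have /matrixP/(_ A k) := Xu0 x v Ux Wv; rewrite !mxE.
have sxi0 : vsmooth U xi0 by move=> k; exact: (smooth2_slicel (sxi k) Wu0).
pose psi := conformal_factor g xi0.
pose Z x u := (sqrtg g x)^-1 *: gauge x u.
have s0 x : U x -> sqrtg g x != 0 by move=> Ux; rewrite gt_eqF ?(sqrtg_gt0 mg Ux).
have gZ x u : U x -> gauge x u = sqrtg g x *: Z x u.
  by move=> Ux; rewrite /Z scalerA mulfV ?scale1r ?s0.
have sZ : vsmooth2 U W Z.
  move=> k; rewrite /Z; under eq_fun do (under eq_fun do rewrite mxE).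
  apply: smoothM => //; last exact: (sgauge k).
  apply: (@smooth2_fst _ _ _ U W (fun x => (sqrtg g x)^-1)).
  by apply: smoothV => //; exact: smooth_sqrtg.
have lieE x u : U x -> W u -> lie_metric g (xi^~ u) x = lie_metric g xi0 x.
  by move=> Ux Wu; exact: (eq_lie_metric g oU (fun y Uy => xiE y u Uy Wu) Ux).
have psiE x u : U x -> W u -> conformal_factor g (xi^~ u) x = psi x.
  by move=> Ux Wu; rewrite /psi /conformal_factor lieE.
have cc x u : U x -> W u -> lie_metric g xi0 x = (2 * psi x) *: g x /\
    lie_metric H (eta x) u = ((2 - n%:R) * psi x) *: H u.
  move=> Ux Wu; have [_ _ H2 _] := coef x u Ux Wu.
  have := noether_conformal oU mg n0 m0 (metric_unit mH Wu) Ux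
    ((noether2P oU oW mg mH _ _ Ux Wu).1 H2).
  by rewrite psiE// lieE.
exists xi0, psi, Z; split=> //; first exact: smooth_conformal_factor.
- split.
  + by move=> x Ux; have [] := cc x u0 Ux Wu0.
  + by move=> x u Ux Wu; have [] := cc x u Ux Wu.
  + move=> x u i A Ux Wu; have [_ H1 _ _] := coef x u Ux Wu.
    have := (noether1P V mg mH _ _ Ux Wu (Xu0 x u Ux Wu)).1 H1 i A => E.
    rewrite /Z; under eq_fun do rewrite mxE.
    rewrite (partialZ _ (smooth2_derivabler (sgauge i) Ux Wu)) E mulr_sumr.
    apply: eq_bigr => j _; rewrite mulr_sumr; apply: eq_bigr => B _.
    by rewrite [dens g x i j]mxE !mulrA mulVf ?mul1r// s0.
  + move=> x u Ux Wu; have [H0 _ _ _] := coef x u Ux Wu.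
    have sZu : vsmooth U (Z^~ u) by move=> k; exact: (smooth2_slicel (sZ k) Wu).
    move: H0; rewrite (@noether0E xi gauge Z eta x u Ux Wu sZu (fun y Uy => gZ y u Uy)).
    move/eqP; rewrite oppr_eq0 mulf_eq0 (negbTE (s0 x Ux))/= => /eqP.
    rewrite lieE//; have [-> _] := cc x u Ux Wu.
    rewrite -scalemxAr mulVmx ?(metric_unit mg Ux)// mxtraceZ mxtrace1 => <-.
    have -> : along (xi^~ u) (V^~ u) x = along xi0 (V^~ u) x.
      by rewrite /along xiE.
    by congr (_ + _ * _ + _ + _); field.
- by move=> x u Ux Wu; split; [exact: xiE|exact: gZ].
Qed.

End NoetherSystem.

(** * The gauge equation and gradient fields *)

Section GradientFields.
Context {R : realType} {n m : nat} (U : set 'rV[R]_n) (W : set 'rV[R]_m).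
Variables (g : 'rV[R]_n -> 'M[R]_n) (H : 'rV[R]_m -> 'M[R]_m).
Hypotheses (oU : open U) (oW : open W) (mg : metric U g) (mH : metric W H).

Lemma vsmooth2_gradr (f : 'rV[R]_n -> 'rV[R]_m -> R) : smooth2 U W f ->
  vsmooth2 U W (fun x u => grad H (f x) u).
Proof.
move=> sf k; have oD := open_product_domain oU oW.
apply: (eq_smooth2 oU oW (F := fun x u => \sum_l invmx (H u) k l * partial l (f x) u)).
  by move=> x u _ _; rewrite mxE.
apply: smooth_sum => // l; apply: smoothM => //; last exact: smooth2_partialr.
exact: (@smooth2_snd _ _ _ U W _ (smooth_invg oW mH k l)).
Qed.

Lemma vsmooth2_gradl (f : 'rV[R]_n -> 'rV[R]_m -> R) : smooth2 U W f ->
  vsmooth2 U W (fun x u => grad g (f^~ u) x).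
Proof.
move=> sf k; have oD := open_product_domain oU oW.
apply: (eq_smooth2 oU oW (F := fun x u => \sum_l invmx (g x) k l * partial l (f^~ u) x)).
  by move=> x u _ _; rewrite mxE.
apply: smooth_sum => // l; apply: smoothM => //; last exact: smooth2_partiall.
exact: (@smooth2_fst _ _ _ U W _ (smooth_invg oU mg k l)).
Qed.

Lemma vsmooth2D b (v w : 'rV[R]_n -> 'rV[R]_m -> 'rV[R]_b) :
  vsmooth2 U W v -> vsmooth2 U W w -> vsmooth2 U W (fun x u => v x u + w x u).
Proof.
move=> sv sw k; have oD := open_product_domain oU oW.
apply: (eq_smooth2 oU oW (F := fun x u => v x u 0 k + w x u 0 k)).
  by move=> x u _ _; rewrite mxE.
by apply: smoothD => //; [exact: (sv k)|exact: (sw k)].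
Qed.

Lemma vsmooth2Z (c : 'rV[R]_n -> 'rV[R]_m -> R) b (v : 'rV[R]_n -> 'rV[R]_m -> 'rV[R]_b) :
  smooth2 U W c -> vsmooth2 U W v -> vsmooth2 U W (fun x u => c x u *: v x u).
Proof.
move=> sc sv k; have oD := open_product_domain oU oW.
apply: (eq_smooth2 oU oW (F := fun x u => c x u * v x u 0 k)).
  by move=> x u _ _; rewrite mxE.
by apply: smoothM => //; exact: (sv k).
Qed.

Lemma vsmooth2_fst b (v : 'rV[R]_n -> 'rV[R]_b) : vsmooth U v ->
  vsmooth2 U W (fun x _ => v x).
Proof. by move=> sv k; exact: smooth2_fst (sv k). Qed.

Lemma vsmooth2_snd b (v : 'rV[R]_m -> 'rV[R]_b) : vsmooth W v ->
  vsmooth2 U W (fun _ u => v u).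
Proof. by move=> sv k; exact: smooth2_snd (sv k). Qed.

Lemma vsmooth2_slicer b (v : 'rV[R]_n -> 'rV[R]_m -> 'rV[R]_b) x :
  vsmooth2 U W v -> U x -> vsmooth W (v x).
Proof. by move=> sv Ux k; exact: smooth2_slicer (sv k) Ux. Qed.

Lemma vsmooth2_slicel b (v : 'rV[R]_n -> 'rV[R]_m -> 'rV[R]_b) u :
  vsmooth2 U W v -> W u -> vsmooth U (v^~ u).
Proof. by move=> sv Wu k; exact: smooth2_slicel (sv k) Wu. Qed.

Lemma sum_invmxK k (M : 'M[R]_k) (v : 'I_k -> R) i : M \in unitmx ->
  \sum_l invmx M i l * (\sum_b M l b * v b) = v i.
Proof.
move=> uM; under eq_bigr do rewrite mulr_sumr.
rewrite exchange_big/=; under eq_bigr do (under eq_bigr do rewrite mulrA).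
under eq_bigr do rewrite -mulr_suml.
rewrite (bigD1 i)//= [X in _ + X]big1 ?addr0 => [|b bi]; last first.
  have /matrixP/(_ i b) := mulVmx uM; rewrite !mxE eq_sym (negbTE bi) => ->.
  exact: mul0r.
by have /matrixP/(_ i i) := mulVmx uM; rewrite !mxE eqxx => ->; rewrite mul1r.
Qed.

Lemma sum_mxKinv k (M : 'M[R]_k) (v : 'I_k -> R) i : M \in unitmx ->
  \sum_l M i l * (\sum_b invmx M l b * v b) = v i.
Proof. by move=> uM; rewrite -{1}(invmxK M) sum_invmxK// unitmx_inv. Qed.

Lemma gauge_equation_linear c eta eta' Z Z' :
    vsmooth2 U W eta -> vsmooth2 U W eta' -> vsmooth2 U W Z -> vsmooth2 U W Z' ->
    gauge_equation U W g H eta Z -> gauge_equation U W g H eta' Z' ->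
  gauge_equation U W g H (fun x u => c *: eta x u + eta' x u)
    (fun x u => c *: Z x u + Z' x u).
Proof.
move=> se se' sZ sZ' E E' x u i A Ux Wu; have oD := open_product_domain oU oW.
have dl a b (f : 'rV[R]_a -> 'rV[R]_b) k l y : derivable (fun y => f y 0 k) y (delta_mx 0 l) ->
    derivable (fun y => c * f y 0 k) y (delta_mx 0 l).
  by move=> df; apply: derivable_funM => //; exact: derivable_cst.
under [in LHS]eq_fun do rewrite !mxE.
have dZ := smooth2_derivabler (i := A) (sZ i) Ux Wu.
have dZ' := smooth2_derivabler (i := A) (sZ' i) Ux Wu.
rewrite (partialD (dl _ _ _ _ _ _ dZ) dZ') (partialZ _ dZ) E// E'// mulr_sumr -big_split/=.
apply: eq_bigr => j _; rewrite mulr_sumr -big_split/=; apply: eq_bigr => B _.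
under [in RHS]eq_fun do rewrite !mxE.
have de := smooth2_derivablel (i := j) (se B) Ux Wu.
have de' := smooth2_derivablel (i := j) (se' B) Ux Wu.
by rewrite (partialD (dl _ _ _ _ _ _ de) de') (partialZ _ de); ring.
Qed.

(** Both sides contract the mixed second derivatives of the potential, which also
    serves as the potential of the gauge field. *)
Lemma gauge_equation_gradient KG KNG Phi :
  smooth2 U W KG -> vsmooth W KNG -> vsmooth U Phi ->
  gauge_equation U W g H (K_vector H KG KNG)
    (fun x u => grad g (KG^~ u) x + Phi x).
Proof.
move=> sK sN sP x u i A Ux Wu; have uH := metric_unit mH Wu.
have E1 : partial A (fun v => (grad g (KG^~ v) x + Phi x) 0 i) u =
    \sum_j invmx (g x) i j * partial A (fun v => partial j (KG^~ v) x) u.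
  under eq_fun do rewrite !mxE.
  have d1 j : derivable (fun v => partial j (KG^~ v) x) u (delta_mx 0 A).
    exact: (smooth2_derivabler (smooth2_partiall j sK) Ux Wu).
  have d2 j : derivable (fun v => invmx (g x) i j * partial j (KG^~ v) x) u (delta_mx 0 A).
    by apply: derivable_funM => //; exact: derivable_cst.
  have dc : derivable (fun _ : 'rV[R]_m => Phi x 0 i) u (delta_mx 0 A).
    exact: derivable_cst.
  rewrite (partialD (derivable_bigsum (r := index_enum _) (P := xpredT) d2) dc).
  rewrite partial_cst addr0 (partial_sum (index_enum _) xpredT d2).
  by apply: eq_bigr => j _; rewrite (partialZ _ (d1 j)).
have E2 j B : partial j (fun y => K_vector H KG KNG y u 0 B) x =
    \sum_C invmx (H u) B C * partial j (fun y => partial C (KG y) u) x.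
  under eq_fun do rewrite !mxE.
  have d1 C : derivable (fun y => partial C (KG y) u) x (delta_mx 0 j).
    exact: (smooth2_derivablel (smooth2_partialr C sK) Ux Wu).
  have d2 C : derivable (fun y => invmx (H u) B C * partial C (KG y) u) x (delta_mx 0 j).
    by apply: derivable_funM => //; exact: derivable_cst.
  have dc : derivable (fun _ : 'rV[R]_n => KNG u 0 B) x (delta_mx 0 j).
    exact: derivable_cst.
  rewrite (partialD (derivable_bigsum (r := index_enum _) (P := xpredT) d2) dc).
  rewrite partial_cst addr0 (partial_sum (index_enum _) xpredT d2).
  by apply: eq_bigr => C _; rewrite (partialZ _ (d1 C)).
rewrite E1; apply: eq_bigr => j _.
pose v C := partial j (fun y => partial C (KG y) u) x.
have P : partial A (fun w => partial j (KG^~ w) x) u = v A.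
  exact: esym (partiallr oU oW j A sK Ux Wu).
apply: (etrans (congr1 (fun r => invmx (g x) i j * r) P)).
rewrite -(sum_mxKinv v A uH) mulr_sumr; apply: eq_bigr => B _.
by rewrite E2 mulrA.
Qed.

(** Separation of variables: both sides are a derivative of Y times a gradient
    component of psi. *)
Lemma gauge_equation_homothety c psi Y : smooth U psi -> smooth W Y ->
  gauge_equation U W g H (fun x u => (c * psi x) *: grad H Y u)
    (fun x u => (c * Y u) *: grad g psi x).
Proof.
move=> sp sY x u i A Ux Wu; have uH := metric_unit mH Wu.
have E1 : partial A (fun v => ((c * Y v) *: grad g psi x) 0 i) u =
    c * partial A Y u * \sum_j invmx (g x) i j * partial j psi x.
  under eq_fun do rewrite !mxE.
  have dY : derivable Y u (delta_mx 0 A) := smooth_derivable sY Wu.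
  have dc (b : R) : derivable (fun _ : 'rV[R]_m => b) u (delta_mx 0 A).
    exact: derivable_cst.
  by rewrite (partialM (derivable_funM (dc c) dY) (dc _)) partial_cst (partialZ _ dY) mulr0 addr0.
have E2 j B : partial j (fun y => ((c * psi y) *: grad H Y u) 0 B) x =
    c * partial j psi x * \sum_C invmx (H u) B C * partial C Y u.
  under eq_fun do rewrite !mxE.
  have dp : derivable psi x (delta_mx 0 j) := smooth_derivable sp Ux.
  have dc (b : R) : derivable (fun _ : 'rV[R]_n => b) x (delta_mx 0 j).
    exact: derivable_cst.
  by rewrite (partialM (derivable_funM (dc c) dp) (dc _)) partial_cst (partialZ _ dp) mulr0 addr0.
rewrite E1 mulr_sumr; apply: eq_bigr => j _; under eq_bigr do rewrite E2.
rewrite -[in LHS](sum_mxKinv (fun C => partial C Y u) A uH) mulr_sumr mulr_suml.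
by apply: eq_bigr => B _; ring.
Qed.

Hypotheses (cU : connected U) (cW : connected W) (U0 : U !=set0) (W0 : W !=set0).

(** The gauge equation says that the one-form with components H_AB eta^B in the
    u-directions and g_ij Z^j in the x-directions is closed as far as its mixed
    derivatives are concerned. [exists_potential] then makes the change of eta from a
    base point of U a gradient. If eta is a gradient already at that point, its
    potential is absorbed and nothing else remains. *)
Lemma gradient_splitting eta Z : vsmooth2 U W eta -> vsmooth2 U W Z ->
    gauge_equation U W g H eta Z ->
  exists KG KNG Phi, [/\ smooth2 U W KG, vsmooth W KNG, vsmooth U Phi,
    forall x u, U x -> W u ->
      eta x u = grad H (KG x) u + KNG u /\ Z x u = grad g (KG^~ u) x + Phi x
    & (forall u, KNG u = 0) \/
      (exists2 x0, U x0 & KNG = eta x0) /\ ~ is_gradient W H KNG].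
Proof.
move=> se sZ GE; have oD := open_product_domain oU oW.
have [x0 Ux0] := U0; have [u0 Wu0] := W0.
pose theta A x u := \sum_B H u A B * eta x u 0 B.
pose beta j x u := \sum_i g x j i * Z x u 0 i.
have sH A B : smooth2 U W (fun _ u => H u A B).
  exact: (@smooth2_snd _ _ _ U W _ (metric_smooth mH A B)).
have sg i j : smooth2 U W (fun x _ => g x i j).
  exact: (@smooth2_fst _ _ _ U W _ (metric_smooth mg i j)).
have stheta A : smooth2 U W (theta A).
  by apply: smooth_sum => // B; apply: smoothM => //; [exact: (sH A B)|exact: (se B)].
have sbeta j : smooth2 U W (beta j).
  by apply: smooth_sum => // i; apply: smoothM => //; [exact: (sg j i)|exact: (sZ i)].
have closed j A x u : U x -> W u ->
    partial j ((theta A)^~ u) x = partial A (beta j x) u.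
  move=> Ux Wu; rewrite partial_sum => [|B]; last first.
    apply: derivable_funM; first exact: derivable_cst.
    exact: (smooth2_derivablel (se B) Ux Wu).
  rewrite partial_sum => [|i]; last first.
    apply: derivable_funM; first exact: derivable_cst.
    exact: (smooth2_derivabler (sZ i) Ux Wu).
  have dZ i := smooth2_derivabler (i := A) (sZ i) Ux Wu.
  have de B := smooth2_derivablel (i := j) (se B) Ux Wu.
  under [RHS]eq_bigr => i _ do rewrite (partialZ _ (dZ i)) GE//.
  under [LHS]eq_bigr => B _ do rewrite (partialZ _ (de B)).
  pose v k := \sum_B H u A B * partial k (fun y => eta y u 0 B) x.
  rewrite -/(v j) -(sum_mxKinv v j (metric_unit mg Ux)); apply: eq_bigr => i _.
  congr (_ * _); apply: eq_bigr => k _; rewrite mulr_sumr.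
  by apply: eq_bigr => B _; rewrite mulrA.
have [K [sK Ku Kx]] := exists_potential oU oW cU cW sbeta stheta closed Ux0 Wu0.
have gK f x u : smooth W f -> U x -> W u ->
    grad H (fun v => K x v + f v) u = eta x u - eta x0 u + grad H f u.
  move=> sf Ux Wu; apply/rowP => k; rewrite !mxE.
  have -> : eta x u 0 k - eta x0 u 0 k =
      \sum_l invmx (H u) k l * (theta l x u - theta l x0 u).
    rewrite -{1}(sum_invmxK (fun b => eta x u 0 b) k (metric_unit mH Wu)).
    rewrite -{1}(sum_invmxK (fun b => eta x0 u 0 b) k (metric_unit mH Wu)) -sumrB.
    by apply: eq_bigr => l _; rewrite -mulrBr.
  rewrite -big_split/=; apply: eq_bigr => l _.
  rewrite (partialD (smooth2_derivabler sK Ux Wu) (smooth_derivable sf Wu)) Ku//.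
  by rewrite mulrDr.
have gKx f x u : U x -> W u -> Z x u = grad g (fun y => K y u + f u) x + Z x u0.
  move=> Ux Wu; apply/rowP => k; rewrite !mxE.
  apply/eqP; rewrite -subr_eq; apply/eqP; apply/esym.
  rewrite -(sum_invmxK (fun i => Z x u 0 i) k (metric_unit mg Ux)).
  rewrite -(sum_invmxK (fun i => Z x u0 0 i) k (metric_unit mg Ux)) -sumrB.
  apply: eq_bigr => l _; rewrite -mulrBr; congr (_ * _).
  have dc : derivable (fun _ : 'rV[R]_n => f u) x (delta_mx 0 l) by exact: derivable_cst.
  by rewrite (partialD (smooth2_derivablel sK Ux Wu) dc) partial_cst addr0 Kx.
have sKf f : smooth W f -> smooth2 U W (fun x u => K x u + f u).
  by move=> sf; apply: smoothD => //; exact: (@smooth2_snd _ _ _ U W f sf).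
have sPhi : vsmooth U (fun x => Z x u0) by exact: vsmooth2_slicel.
have [[f sf fE]|ng] := pselect (is_gradient W H (eta x0)).
  exists (fun x u => K x u + f u), (fun=> 0), (fun x => Z x u0); split => //.
  - exact: sKf.
  - by move=> k; under eq_fun do rewrite mxE; exact: smooth_cst.
  - move=> x u Ux Wu; split; last exact: gKx.
    by rewrite gK// -fE// subrK addr0.
  - by left.
exists (fun x u => K x u + 0), (eta x0), (fun x => Z x u0); split => //.
- by apply: sKf; exact: smooth_cst.
- exact: vsmooth2_slicer.
- move=> x u Ux Wu; split; last exact: (gKx (fun=> 0)).
  rewrite (gK (fun=> 0) x u (smooth_cst _ _) Ux Wu).
  have -> : grad H (fun=> 0) u = 0.
    by apply/rowP => k; rewrite !mxE big1// => l _; rewrite partial_cst mulr0.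
  by rewrite addr0 subrK.
- by right; split => //; exists x0.
Qed.

End GradientFields.

(** * Fields built from a potential, and their balance conditions *)

Section NoetherBalance.
Context {R : realType}.

Lemma along_linear a (c : R) (v w : 'rV[R]_a -> 'rV[R]_a) f x :
  along (fun y => c *: v y + w y) f x = c * along v f x + along w f x.
Proof.
rewrite /along mulr_sumr -big_split/=; apply: eq_bigr => k _; rewrite !mxE; ring.
Qed.

Lemma divergence_linear a (U : set 'rV[R]_a) (g : 'rV[R]_a -> 'M[R]_a) c v w x :
  vsmooth U v -> vsmooth U w -> U x ->
  divergence g (fun y => c *: v y + w y) x = c * divergence g v x + divergence g w x.
Proof.
move=> sv sw Ux; rewrite /divergence mulr_sumr -big_split/=; apply: eq_bigr => k _.
under [in LHS]eq_fun do rewrite !mxE.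
have dv : derivable (fun y => v y 0 k) x (delta_mx 0 k) := smooth_derivable (sv k) Ux.
have dw : derivable (fun y => w y 0 k) x (delta_mx 0 k) := smooth_derivable (sw k) Ux.
have dc : derivable (fun _ : 'rV[R]_a => c) x (delta_mx 0 k) by exact: derivable_cst.
rewrite (partialD (derivable_funM dc dv) dw) (partialZ _ dv).
rewrite mulrDr addrACA; congr (_ + _); rewrite mulr_sumr -big_split/=.
by apply: eq_bigr => l _; rewrite !mxE; ring.
Qed.

End NoetherBalance.

Lemma eq_divergence (R : realType) a (U : set 'rV[R]_a) (g : 'rV[R]_a -> 'M[R]_a) v w x :
  open U -> U x -> (forall y, U y -> v y = w y) -> divergence g v x = divergence g w x.
Proof.
move=> oU Ux vw; apply: eq_bigr => k _; congr (_ + _).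
  by apply: open_eq_partial oU Ux _ => y; rewrite inE => /vw ->.
by apply: eq_bigr => l _; rewrite vw.
Qed.

Section Generators.
Context {R : realType} {n m : nat} (U : set 'rV[R]_n) (W : set 'rV[R]_m).
Variables (g : 'rV[R]_n -> 'M[R]_n) (H : 'rV[R]_m -> 'M[R]_m).
Variable V : 'rV[R]_n -> 'rV[R]_m -> R.
Hypotheses (oU : open U) (oW : open W) (mg : metric U g) (mH : metric W H).
Hypothesis sV : smooth2 U W V.

Let L := lagrangian g H V.

Lemma noether_current_lagrangian xi eta gauge x u (p : 'M[R]_(n, m)) i : U x -> W u ->
  noether_current L xi eta gauge i x u p =
    \sum_k xi x u 0 k * hamiltonian L i k x u p
    - \sum_A eta x u 0 A *
        (sqrtg g x * \sum_j \sum_B invmx (g x) i j * H u A B * p j B)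
    + gauge x u 0 i.
Proof.
move=> Ux Wu; rewrite /noether_current; congr (_ - _ + _); apply: eq_bigr => A _.
rewrite (mpartial_lagrangian V mg mH p i A Ux Wu); congr (_ * _); rewrite mulr_sumr.
apply: eq_bigr => j _; rewrite mulr_sumr; apply: eq_bigr => B _.
by rewrite mxE !mulrA.
Qed.

Lemma hamiltonian_lagrangian x u (p : 'M[R]_(n, m)) i k : U x -> W u ->
  hamiltonian L i k x u p =
    2^-1 * sqrtg g x * (\sum_A \sum_B H u A B *
      (2 * \sum_j invmx (g x) i j * (2^-1 * (p k A * p j B + p k B * p j A))
       - (i == k)%:R * \sum_r \sum_s invmx (g x) r s * p r A * p s B))
    + (i == k)%:R * sqrtg g x * V x u.
Proof.
move=> Ux Wu; rewrite /hamiltonian.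
have HC A B : H u A B = H u B A by rewrite -{1}(metric_sym mH Wu) mxE.
pose T := \sum_A \sum_B \sum_j H u A B * (invmx (g x) i j * (p k A * p j B)).
pose Q := \sum_A \sum_B H u A B * \sum_r \sum_s invmx (g x) r s * p r A * p s B.
have E1 : \sum_A p k A * mpartial i A (L x u) p = sqrtg g x * T.
  rewrite /T mulr_sumr; apply: eq_bigr => A _.
  rewrite (mpartial_lagrangian V mg mH p i A Ux Wu) exchange_big/= !mulr_sumr.
  apply: eq_bigr => B _; rewrite !mulr_sumr; apply: eq_bigr => j _.
  by rewrite mxE; ring.
have E2 : L x u p = 2^-1 * sqrtg g x * Q - sqrtg g x * V x u.
  rewrite /L /lagrangian; congr (_ * _ - _); rewrite /Q.
  under eq_bigr do rewrite exchange_big/=.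
  rewrite exchange_big/=; apply: eq_bigr => A _.
  under eq_bigr do rewrite exchange_big/=.
  rewrite exchange_big/=; apply: eq_bigr => B _; rewrite mulr_sumr.
  apply: eq_bigr => r _; rewrite mulr_sumr; apply: eq_bigr => s _; ring.
have E3 : \sum_A \sum_B H u A B * (2 * \sum_j invmx (g x) i j *
      (2^-1 * (p k A * p j B + p k B * p j A))
      - (i == k)%:R * \sum_r \sum_s invmx (g x) r s * p r A * p s B)
    = 2 * T - (i == k)%:R * Q.
  have ET : T = \sum_A \sum_B \sum_j H u A B * (invmx (g x) i j * (p k B * p j A)).
    rewrite /T exchange_big/=; apply: eq_bigr => A _; apply: eq_bigr => B _.
    by apply: eq_bigr => j _; rewrite HC.
  rewrite (_ : 2 * T = T + T); last by ring.
  rewrite {2}ET /T /Q mulr_sumr -big_split -sumrB/=; apply: eq_bigr => A _.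
  rewrite mulr_sumr -big_split -sumrB/=; apply: eq_bigr => B _.
  rewrite mulrBr mulrCA; congr (_ - _); last by ring.
  rewrite -big_split/= !mulr_sumr; apply: eq_bigr => j _; by field.
by rewrite E1 E2 E3; case: (i == k) => /=; field.
Qed.

Section Potential.
Variables (xi Phi : 'rV[R]_n -> 'rV[R]_n) (psi : 'rV[R]_n -> R).
Variables (KG : 'rV[R]_n -> 'rV[R]_m -> R) (KNG : 'rV[R]_m -> 'rV[R]_m).
Hypothesis sm : smooth_generators U W xi psi KG KNG Phi.

Let Kgauge x u := grad g (KG^~ u) x + Phi x.

Lemma vsmooth2_K_vector : vsmooth2 U W (K_vector H KG KNG).
Proof.
have [_ _ sK sN _] := sm.
exact: (vsmooth2D oU oW (vsmooth2_gradr oU oW mH sK) (vsmooth2_snd U sN)).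
Qed.

Lemma vsmooth2_K_gauge : vsmooth2 U W Kgauge.
Proof.
have [_ _ sK _ sP] := sm.
exact: (vsmooth2D oU oW (vsmooth2_gradl oU oW mg sK) (vsmooth2_fst W sP)).
Qed.

Lemma K_vector_homothetic c d x : U x ->
  homothetic W H (grad H (KG x)) c -> homothetic W H KNG d ->
  homothetic W H (K_vector H KG KNG x) (c + d).
Proof.
have [_ _ sK sN _] := sm; move=> Ux hG hN; rewrite -[c]mul1r.
have sg : vsmooth W (grad H (KG x)) := vsmooth2_slicer (vsmooth2_gradr oU oW mH sK) Ux.
apply: (eq_homothetic oW _ (homothetic_linear oW 1 sg sN hG hN)) => u _.
by rewrite scale1r.
Qed.

Lemma K_terms_divergence x u : U x -> W u ->
  along (K_vector H KG KNG x) (V x) u + divergence g (Kgauge^~ u) x =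
  K_terms g H V KG KNG Phi x u.
Proof.
have [_ _ sK _ sP] := sm; move=> Ux Wu.
have sKu := smooth2_slicel sK Wu.
rewrite /K_terms /Kgauge; under [X in divergence _ X]eq_fun do rewrite -[grad _ _ _]scale1r.
rewrite (divergence_linear g 1 (vsmooth_grad oU mg sKu) sP Ux) mul1r.
by rewrite (divergence_grad oU mg sKu Ux); ring.
Qed.

Lemma K_system : conformal U g xi psi ->
  (forall x, U x -> homothetic W H (K_vector H KG KNG x) ((2 - n%:R) / 2 * psi x)) ->
  (forall x u, U x -> W u -> along xi (V^~ u) x + n%:R * psi x * V x u
     + K_terms g H V KG KNG Phi x u = 0) ->
  noether_system U W g H V xi psi (K_vector H KG KNG) Kgauge.
Proof.
have [_ _ sK sN sP] := sm; move=> cxi hK E; split => //.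
- move=> x u Ux Wu; rewrite hK//; congr (_ *: _); by field.
- exact: gauge_equation_gradient.
- by move=> x u Ux Wu; rewrite -addrA K_terms_divergence// E.
Qed.

Lemma noether_of_K_system : noether_system U W g H V xi psi (K_vector H KG KNG) Kgauge ->
  noether_point_symmetry U W L (fun x _ => xi x) (K_vector H KG KNG) (K_gauge g KG Phi).
Proof.
have [sxi _ _ _ _] := sm; apply: noether_of_system => //.
  exact: vsmooth2_K_vector.
exact: vsmooth2_K_gauge.
Qed.

Variable Y : 'rV[R]_m -> R.
Hypotheses (sY : smooth W Y) (hY : homothetic W H (grad H Y) 1).

Let c : R := (2 - n%:R) / 2.
Let Yvector x u := (c * psi x) *: grad H Y u.
Let Ygauge x u := (c * Y u) *: grad g psi x.

Let sgY : vsmooth W (grad H Y). Proof. exact: vsmooth_grad. Qed.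
Let sgp : vsmooth U (grad g psi). Proof. by have [_ ? _ _ _] := sm; exact: vsmooth_grad. Qed.

Let spsi2 : smooth2 U W (fun x _ => c * psi x).
Proof.
have [_ sp _ _ _] := sm; apply: (@smooth2_fst _ _ _ U W (fun x => c * psi x)).
exact: smoothZ.
Qed.

Let sY2 : smooth2 U W (fun _ u => c * Y u).
Proof. by apply: (@smooth2_snd _ _ _ U W (fun u => c * Y u)); exact: smoothZ. Qed.

Let sYvector : vsmooth2 U W Yvector.
Proof. exact: (vsmooth2Z oU oW spsi2 (vsmooth2_snd U sgY)). Qed.

Let sYgauge : vsmooth2 U W Ygauge.
Proof. exact: (vsmooth2Z oU oW sY2 (vsmooth2_fst W sgp)). Qed.

Lemma vsmooth2_Y_vector : vsmooth2 U W (Y_vector H psi Y KG KNG).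
Proof. exact: (vsmooth2D oU oW sYvector vsmooth2_K_vector). Qed.

Let Ytotal x u := Ygauge x u + Kgauge x u.

Lemma vsmooth2_Y_gauge : vsmooth2 U W Ytotal.
Proof. exact: (vsmooth2D oU oW sYgauge vsmooth2_K_gauge). Qed.

Lemma Y_balance x u : U x -> W u ->
  along (Y_vector H psi Y KG KNG x) (V x) u + divergence g (Ytotal^~ u) x =
  c * (psi x * along (grad H Y) (V x) u + Y u * laplacian g psi x)
  + K_terms g H V KG KNG Phi x u.
Proof.
have [_ sp _ _ _] := sm; move=> Ux Wu.
rewrite -K_terms_divergence// [along (Y_vector _ _ _ _ _ _) _ _]along_linear.
rewrite (divergence_linear g (c * Y u) sgp (vsmooth2_slicel vsmooth2_K_gauge Wu) Ux).
by rewrite (divergence_grad oU mg sp Ux) -/c; ring.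
Qed.

Lemma Y_vector_homothetic d x : U x -> homothetic W H (K_vector H KG KNG x) d ->
  homothetic W H (Y_vector H psi Y KG KNG x) (c * psi x + d).
Proof.
move=> Ux hK; rewrite -[c * psi x]mulr1.
exact: (homothetic_linear oW (c * psi x) sgY (vsmooth2_slicer vsmooth2_K_vector Ux) hY hK).
Qed.

Lemma Y_system : conformal U g xi psi ->
  (forall x, U x -> killing W H (K_vector H KG KNG x)) ->
  (forall x u, U x -> W u ->
     along xi (V^~ u) x + n%:R * psi x * V x u
     + c * (psi x * along (grad H Y) (V x) u + Y u * laplacian g psi x)
     + K_terms g H V KG KNG Phi x u = 0) ->
  noether_system U W g H V xi psi (Y_vector H psi Y KG KNG) Ytotal.
Proof.
have [_ sp sK sN sP] := sm; move=> cxi hK E; split => //.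
- move=> x u Ux Wu; rewrite (Y_vector_homothetic Ux (hK x Ux) Wu).
  by congr (_ *: _); rewrite /c; field.
- have := gauge_equation_linear oU oW 1 sYvector vsmooth2_K_vector sYgauge vsmooth2_K_gauge
    (gauge_equation_homothety g mH c sp sY) (gauge_equation_gradient g oU oW mH sK sN sP).
  move=> GE x u i A Ux Wu; have := GE x u i A Ux Wu.
  under [in LHS]eq_fun do rewrite scale1r.
  under [in RHS]eq_bigr do (under eq_bigr do (under eq_fun do rewrite scale1r)).
  exact.
- by move=> x u Ux Wu; rewrite -addrA Y_balance// addrA E.
Qed.

Lemma noether_of_Y_system :
  noether_system U W g H V xi psi (Y_vector H psi Y KG KNG) Ytotal ->
  noether_point_symmetry U W L (fun x _ => xi x) (Y_vector H psi Y KG KNG)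
    (Y_gauge g psi Y KG Phi).
Proof.
have [sxi _ _ _ _] := sm => S.
have -> : Y_gauge g psi Y KG Phi = fun x u => sqrtg g x *: Ytotal x u.
  by apply/funext => x; apply/funext => u; rewrite /Y_gauge /Ytotal /Kgauge addrA.
exact: (noether_of_system oU oW mg mH sV sxi vsmooth2_Y_vector vsmooth2_Y_gauge S).
Qed.

End Potential.

(** The gradient part is, for each x, a difference of two homothetic fields. *)
Lemma splitting_homothetic eta KG KNG (d : 'rV[R]_n -> R) e :
  vsmooth2 U W eta -> vsmooth W KNG ->
  (forall x, U x -> homothetic W H (eta x) (d x)) ->
  (forall x u, U x -> W u -> eta x u = grad H (KG x) u + KNG u) ->
  homothetic W H KNG e ->
  forall x, U x -> homothetic W H (grad H (KG x)) (d x - e).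
Proof.
move=> seta sN he E hN x Ux.
have -> : d x - e = -1 * e + d x by ring.
have := homothetic_linear oW (-1) sN (vsmooth2_slicer seta Ux) hN (he x Ux).
apply: (eq_homothetic oW) => u Wu.
by rewrite scaleN1r E// addrC addrK.
Qed.

Lemma K_balance xi psi eta Z KG KNG Phi :
  smooth_generators U W xi psi KG KNG Phi ->
  (forall x u, U x -> W u ->
     eta x u = K_vector H KG KNG x u /\ Z x u = grad g (KG^~ u) x + Phi x) ->
  noether_system U W g H V xi psi eta Z ->
  forall x u, U x -> W u ->
    along xi (V^~ u) x + n%:R * psi x * V x u + K_terms g H V KG KNG Phi x u = 0.
Proof.
move=> sm E [_ _ _ B] x u Ux Wu; rewrite -(K_terms_divergence sm Ux Wu) addrA -(B x u Ux Wu).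
congr (_ + _ + _).
  by have [e _] := E x u Ux Wu; rewrite /along -e.
by apply: eq_divergence oU Ux _ => y Uy; have [_ ->] := E y u Uy Wu.
Qed.

End Generators.

(** * The classification of Noether point symmetries *)

Theorem theorem2 (R : realType) (n m : nat)
    (U : set 'rV[R]_n) (W : set 'rV[R]_m)
    (g : 'rV[R]_n -> 'M[R]_n) (H : 'rV[R]_m -> 'M[R]_m)
    (V : 'rV[R]_n -> 'rV[R]_m -> R)
    (hn : (2 <= n)%N) (hm : (1 <= m)%N)
    (U_open : open U) (U_conn : connected U) (U_nonempty : U !=set0)
    (W_open : open W) (W_conn : connected W) (W_nonempty : W !=set0)
    (g_metric : metric U g) (H_metric : metric W H) (V_smooth : smooth2 U W V) :
  let L := lagrangian g H V in
  let current_is xi eta gauge :=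
    forall x u (p : 'M[R]_(n, m)) i, U x -> W u ->
      noether_current L xi eta gauge i x u p =
        \sum_k xi x u 0 k * hamiltonian L i k x u p
        - \sum_A eta x u 0 A *
            (sqrtg g x * \sum_j \sum_B invmx (g x) i j * H u A B * p j B)
        + gauge x u 0 i in
  let same xi eta gauge xi' eta' gauge' :=
    forall (x : 'rV[R]_n) (u : 'rV[R]_m), U x -> W u ->
      [/\ xi x u = xi' x u :> 'rV[R]_n, eta x u = eta' x u :> 'rV[R]_m
        & gauge x u = gauge' x u :> 'rV[R]_n] in
  [/\ (* (a) *)
      (2 < n)%N -> forall Y : 'rV[R]_m -> R,
        smooth W Y -> homothetic W H (grad H Y) 1 ->
        (forall xi psi KG KNG Phi,
           generators_Y U W g H V Y xi psi KG KNG Phi ->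
           noether_point_symmetry U W L (fun x _ => xi x)
             (Y_vector H psi Y KG KNG) (Y_gauge g psi Y KG Phi) /\
           current_is (fun x _ => xi x)
             (Y_vector H psi Y KG KNG) (Y_gauge g psi Y KG Phi)) /\
        (forall xi eta gauge,
           vsmooth2 U W xi -> vsmooth2 U W eta -> vsmooth2 U W gauge ->
           noether_point_symmetry U W L xi eta gauge ->
           exists xi0 psi KG KNG Phi,
             generators_Y U W g H V Y xi0 psi KG KNG Phi /\
             same xi eta gauge (fun x _ => xi0 x)
               (Y_vector H psi Y KG KNG) (Y_gauge g psi Y KG Phi)),
      (* (b) *)
      (2 < n)%N -> ~ admits_proper_gradient_hv W H ->
        (forall xi KG KNG Phi,
           generators_KV U W g H V xi KG KNG Phi ->
           noether_point_symmetry U W L (fun x _ => xi x)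
             (K_vector H KG KNG) (K_gauge g KG Phi) /\
           current_is (fun x _ => xi x)
             (K_vector H KG KNG) (K_gauge g KG Phi)) /\
        (forall xi eta gauge,
           vsmooth2 U W xi -> vsmooth2 U W eta -> vsmooth2 U W gauge ->
           noether_point_symmetry U W L xi eta gauge ->
           exists xi0 KG KNG Phi,
             (generators_KV U W g H V xi0 KG KNG Phi \/
              exists c, generators_nongradient_HV U W g H V c xi0 KG KNG Phi) /\
             same xi eta gauge (fun x _ => xi0 x)
               (K_vector H KG KNG) (K_gauge g KG Phi)),
      (* (c) *)
      n = 2%N ->
        (forall xi psi KG KNG Phi,
           generators_dim2 U W g H V xi psi KG KNG Phi ->
           noether_point_symmetry U W L (fun x _ => xi x)
             (K_vector H KG KNG) (K_gauge g KG Phi) /\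
           current_is (fun x _ => xi x)
             (K_vector H KG KNG) (K_gauge g KG Phi)) /\
        (forall xi eta gauge,
           vsmooth2 U W xi -> vsmooth2 U W eta -> vsmooth2 U W gauge ->
           noether_point_symmetry U W L xi eta gauge ->
           exists xi0 psi KG KNG Phi,
             generators_dim2 U W g H V xi0 psi KG KNG Phi /\
             same xi eta gauge (fun x _ => xi0 x)
               (K_vector H KG KNG) (K_gauge g KG Phi))
    & (* the Hamiltonian *)
      forall x u (p : 'M[R]_(n, m)) i k, U x -> W u ->
        hamiltonian L i k x u p =
          2^-1 * sqrtg g x * (\sum_A \sum_B H u A B *
            (2 * \sum_j invmx (g x) i j *
                   (2^-1 * (p k A * p j B + p k B * p j A))
             - (i == k)%:R * \sum_r \sum_s invmx (g x) r s * p r A * p s B))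
          + (i == k)%:R * sqrtg g x * V x u].
Proof.
move=> L current_is same; have n0 : (0 < n)%N by exact: leq_trans hn.
have to_system := system_of_noether n0 hm U_open W_open g_metric H_metric V_smooth
  W_conn W_nonempty.
have split_gradient := gradient_splitting U_open W_open g_metric H_metric U_conn W_conn
  U_nonempty W_nonempty.
have eta_homothetic xi psi eta Z : noether_system U W g H V xi psi eta Z ->
    forall x, U x -> homothetic W H (eta x) ((2 - n%:R) / 2 * psi x).
  by move=> [_ he _ _] x Ux u Wu; rewrite he//; congr (_ *: _); field.
have currents xi eta gauge : current_is xi eta gauge.
  by move=> x u p i Ux Wu; exact: (noether_current_lagrangian V g_metric H_metric).
split.
- move=> n2 Y sY hY; split=> [xi psi KG KNG Phi [sm cxi [_ _ _ hK] E]|].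
    split; last exact: currents.
    apply: (noether_of_Y_system U_open W_open g_metric H_metric V_smooth sm sY).
    exact: (Y_system U_open W_open g_metric H_metric sm sY hY cxi hK E).
  move=> xi eta gauge sxi seta sgauge N.
  have [xi0 [psi [Z [sxi0 spsi sZ NS eqs]]]] := to_system _ _ _ sxi seta sgauge N.
  have [cxi _ GE B] := NS; pose c : R := (2 - n%:R) / 2.
  (* Removing the multiple of grad Y that carries the homothetic factor leaves
     Killing fields, which the splitting applies to. *)
  pose eta' x u := 1 *: ((- c * psi x) *: grad H Y u) + eta x u.
  pose Z' x u := 1 *: ((- c * Y u) *: grad g psi x) + Z x u.
  have sgY := vsmooth_grad W_open H_metric sY.
  have sgp := vsmooth_grad U_open g_metric spsi.
  have sYv : vsmooth2 U W (fun x u => (- c * psi x) *: grad H Y u).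
    apply: (vsmooth2Z U_open W_open (c := fun x _ => - c * psi x)); last exact: vsmooth2_snd.
    by apply: (@smooth2_fst _ _ _ U W (fun x => - c * psi x)); exact: smoothZ.
  have sYg : vsmooth2 U W (fun x u => (- c * Y u) *: grad g psi x).
    apply: (vsmooth2Z U_open W_open (c := fun _ u => - c * Y u)); last exact: vsmooth2_fst.
    by apply: (@smooth2_snd _ _ _ U W (fun u => - c * Y u)); exact: smoothZ.
  have GE' : gauge_equation U W g H eta' Z'.
    apply: (gauge_equation_linear U_open W_open 1 sYv seta sYg sZ _ GE).
    exact: gauge_equation_homothety.
  have etaE x u : eta' x u = - ((c * psi x) *: grad H Y u) + eta x u.
    by rewrite /eta' scale1r mulNr scaleNr.
  have ZE x u : Z' x u = - ((c * Y u) *: grad g psi x) + Z x u.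
    by rewrite /Z' scale1r mulNr scaleNr.
  have seta' : vsmooth2 U W eta'.
    by apply: vsmooth2D => // k; apply: (eq_smooth2 U_open W_open _ (sYv k)) => x u _ _;
       rewrite scale1r.
  have sZ' : vsmooth2 U W Z'.
    by apply: vsmooth2D => // k; apply: (eq_smooth2 U_open W_open _ (sYg k)) => x u _ _;
       rewrite scale1r.
  have kill x : U x -> killing W H (eta' x).
    move=> Ux; have := homothetic_linear W_open (- c * psi x) sgY
      (vsmooth2_slicer seta Ux) hY (eta_homothetic _ _ _ _ NS x Ux).
    rewrite (_ : - c * psi x * 1 + (2 - n%:R) / 2 * psi x = 0); last by rewrite /c; ring.
    by apply: (eq_homothetic W_open) => u _; rewrite /eta' scale1r.
  have [KG [KNG [Phi [sKG sKNG sPhi spl alt]]]] := split_gradient _ _ seta' sZ' GE'.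
  have sm : smooth_generators U W xi0 psi KG KNG Phi by split.
  have killN : killing W H KNG.
    case: alt => [N0|[[x0 Ux0 ->] _]]; last exact: kill.
    by apply: (eq_homothetic W_open _ (homothetic0 H)) => u _; rewrite N0.
  have eqY x u : U x -> W u -> eta x u = Y_vector H psi Y KG KNG x u /\
      Z x u = (c * Y u) *: grad g psi x + (grad g (KG^~ u) x + Phi x).
    move=> Ux Wu; have [E1 E2] := spl x u Ux Wu.
    by rewrite /Y_vector /K_vector -/c -E1 -E2 etaE ZE !addrA !subrr !add0r.
  exists xi0, psi, KG, KNG, Phi; split; last first.
    move=> x u Ux Wu; have [E1 E2] := eqs x u Ux Wu; have [E3 E4] := eqY x u Ux Wu.
    by split=> //; rewrite E2 E4 /Y_gauge addrA.
  split=> //; first split.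
  + move=> x Ux; exists (0 - 0).
    apply: (splitting_homothetic W_open seta' sKNG (d := fun=> 0) kill _ killN Ux).
    by move=> y u Uy Wu; have [] := spl y u Uy Wu.
  + by exists 0.
  + by case: alt => [N0|[_ ng]]; [left|right].
  + move=> x Ux; apply: (eq_homothetic W_open _ (kill x Ux)) => u Wu.
    by have [] := spl x u Ux Wu.
  + move=> x u Ux Wu; rewrite -/c -addrA.
    rewrite -(Y_balance H V U_open W_open g_metric sm Y Ux Wu) addrA -(B x u Ux Wu).
    congr (_ + _ + _).
      by have [e _] := eqY x u Ux Wu; rewrite /along -e.
    by apply: (eq_divergence g U_open Ux) => y Uy; have [_ ->] := eqY y u Uy Wu.
- move=> n2 no_hv; split=> [xi KG KNG Phi [sm kxi kG [kN _] E]|].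
    split; last exact: currents.
    apply: (noether_of_K_system U_open W_open g_metric H_metric V_smooth sm).
    apply: (K_system U_open W_open g_metric H_metric sm kxi) => [x Ux|x u Ux Wu].
      rewrite (_ : _ * 0 = 0 + 0); last by rewrite mulr0 addr0.
      exact: (K_vector_homothetic U_open W_open H_metric sm Ux (kG x Ux) kN).
    by rewrite mulr0 mul0r addr0 E.
  move=> xi eta gauge sxi seta sgauge N.
  have [xi0 [psi [Z [sxi0 spsi sZ NS eqs]]]] := to_system _ _ _ sxi seta sgauge N.
  have [cxi _ GE B] := NS.
  have [KG [KNG [Phi [sKG sKNG sPhi spl alt]]]] := split_gradient _ _ seta sZ GE.
  have sm : smooth_generators U W xi0 psi KG KNG Phi by split.
  have bal := K_balance U_open g_metric sm spl NS.
  have he := eta_homothetic _ _ _ _ NS.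
  have spl1 x u (Ux : U x) (Wu : W u) := proj1 (spl x u Ux Wu).
  have n2R : (2 - n%:R) / 2 != 0 :> R.
    rewrite mulf_neq0 ?invr_eq0 ?pnatr_eq0// subr_eq0 eqr_nat.
    by rewrite neq_ltn n2.
  have nohv x d : U x -> homothetic W H (grad H (KG x)) d -> d = 0.
    move=> Ux hd; apply/eqP/negPn/negP => d0; apply: no_hv; exists (KG x), d.
    by split=> //; exact: smooth2_slicer Ux.
  (* The gradient part at x is homothetic with the factor of eta x minus that of
     KNG, so it is Killing: psi has the constant value that KNG prescribes. *)
  have [c [e [cE eE hN cN]]] : exists c e,
      [/\ forall x, U x -> psi x = c, e = (2 - n%:R) / 2 * c, homothetic W H KNG e
        & c = 0 \/ ~ is_gradient W H KNG].
    case: alt => [N0|[[x0 Ux0 NE] ng]].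
      have hN : homothetic W H KNG 0.
        by apply: (eq_homothetic W_open _ (homothetic0 H)) => u _; rewrite N0.
      exists 0, 0; split => //; [|by rewrite mulr0|by left].
      move=> x Ux; apply: (mulfI n2R); rewrite mulr0 -[LHS]subr0.
      exact: (nohv x _ Ux (splitting_homothetic W_open seta sKNG he spl1 hN Ux)).
    have hN : homothetic W H KNG ((2 - n%:R) / 2 * psi x0) by rewrite NE; exact: he.
    exists (psi x0), ((2 - n%:R) / 2 * psi x0); split=> //; last by right.
    move=> x Ux.
    apply: (mulfI n2R); apply/eqP; rewrite -subr_eq0; apply/eqP.
    exact: (nohv x _ Ux (splitting_homothetic W_open seta sKNG he spl1 hN Ux)).
  have kG x : U x -> killing W H (grad H (KG x)).
    move=> Ux; have := splitting_homothetic W_open seta sKNG he spl1 hN Ux.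
    by rewrite cE// eE subrr.
  have hxi : homothetic U g xi0 c by move=> x Ux; rewrite cxi// cE.
  exists xi0, KG, KNG, Phi; split; last first.
    move=> x u Ux Wu; have [E1 E2] := eqs x u Ux Wu; have [E3 E4] := spl x u Ux Wu.
    by split=> //; rewrite E2 E4.
  have [c0|c0] := eqVneq c 0.
    left; split.
    + by split=> //; exact: smooth_cst.
    + by rewrite /killing -c0.
    + exact: kG.
    + split; first by rewrite /killing -[X in homothetic _ _ _ X](mulr0 ((2 - n%:R) / 2)) -c0 -eE.
      by case: alt => [N0|[_ ng]]; [left|right].
    + by move=> x u Ux Wu; have := bal x u Ux Wu; rewrite cE// c0 mulr0 mul0r addr0.
  right; exists c; split.
  + by split=> //; exact: smooth_cst.
  + by [].
  + exact: kG.
  + split; first by rewrite -eE.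
    by case: cN c0 => [->|//]; rewrite eqxx.
  + by move=> x u Ux Wu; have := bal x u Ux Wu; rewrite cE.
- move=> n2; have nR : n%:R = 2 :> R by rewrite n2.
  split=> [xi psi KG KNG Phi [sm cxi [_ _ _ hK] E]|].
    split; last exact: currents.
    apply: (noether_of_K_system U_open W_open g_metric H_metric V_smooth sm).
    apply: (K_system U_open W_open g_metric H_metric sm cxi) => [x Ux|x u Ux Wu].
      by rewrite nR subrr !mul0r; exact: hK.
    by rewrite nR E.
  move=> xi eta gauge sxi seta sgauge N.
  have [xi0 [psi [Z [sxi0 spsi sZ NS eqs]]]] := to_system _ _ _ sxi seta sgauge N.
  have [cxi _ GE B] := NS.
  have [KG [KNG [Phi [sKG sKNG sPhi spl alt]]]] := split_gradient _ _ seta sZ GE.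
  have sm : smooth_generators U W xi0 psi KG KNG Phi by split.
  have kill x : U x -> killing W H (eta x).
    move=> Ux; have := eta_homothetic _ _ _ _ NS x Ux.
    by rewrite nR subrr !mul0r.
  have spl1 x u (Ux : U x) (Wu : W u) := proj1 (spl x u Ux Wu).
  have killN : killing W H KNG.
    case: alt => [N0|[[x0 Ux0 ->] _]]; last exact: kill.
    by apply: (eq_homothetic W_open _ (homothetic0 H)) => u _; rewrite N0.
  exists xi0, psi, KG, KNG, Phi; split; last first.
    move=> x u Ux Wu; have [E1 E2] := eqs x u Ux Wu; have [E3 E4] := spl x u Ux Wu.
    by split=> //; rewrite E2 E4.
  split=> //; first split.
  + move=> x Ux; exists (0 - 0).
    exact: (splitting_homothetic W_open seta sKNG (d := fun=> 0) kill spl1 killN Ux).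
  + by exists 0.
  + by case: alt => [N0|[_ ng]]; [left|right].
  + move=> x Ux; apply: (eq_homothetic W_open _ (kill x Ux)) => u Wu.
    exact: spl1.
  + move=> x u Ux Wu.
    by have := K_balance U_open g_metric sm spl NS Ux Wu; rewrite nR.
- by move=> x u p i k Ux Wu; exact: (hamiltonian_lagrangian V g_metric H_metric).
Qed.
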